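(* Let $A$ and $M$ be integers with $0<A\le M$, let $r$ be a positive integer and let $s$ be a positive integer. Then, as $n\to\infty$, $$\varsigma_{M,A}^{[s]}(r;n)\sim 2^{\frac{3r-12}{4}}\,3^{\frac{r-2}{4}}\,\pi^{-\frac r2}\,M^{\frac r2}\,s^{-\frac r2}\,r\,\Gamma\!\left(\tfrac r2\right)\,n^{\frac{r-4}{4}}\,e^{\pi\sqrt{\frac{2n}{3}}},$$ where $\Gamma(z)$ is Euler's gamma function.
   Context: A partition $\pi$ of $n$ (written $\pi\vdash n$) is a weakly decreasing finite sequence of positive integers, called parts, with sum $n$. The frequency of a positive integer $k$ in $\pi$ is the number of times $k$ occurs as a part of $\pi$ (possibly $0$). For a positive integer $s$ and integers $A,M$ with $0<A\le M$, $\operatorname{mex}_{M,A}^{[s]}(\pi)$ denotes the smallest positive integer congruent to $A$ modulo $M$ whose frequency in $\pi$ is less than $s$. For a nonnegative integer $r$, define $$\varsigma_{M,A}^{[s]}(r;n):=\sum_{\pi\vdash n}\big(\operatorname{mex}_{M,A}^{[s]}(\pi)\big)^r.$$ The notation $f(n)\sim g(n)$ as $n\to\infty$ means $f(n)/g(n)\to 1$. *)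

(* Defs.v *)
From HB Require Import structures.
From mathcomp Require Import all_boot all_order all_algebra.
From mathcomp Require Import all_classical all_reals all_analysis.
Set Implicit Arguments.
Unset Strict Implicit.
Unset Printing Implicit Defensive.
Import Order.TTheory GRing.Theory Num.Theory.
Import numFieldNormedType.Exports.
Local Open Scope classical_set_scope.
Local Open Scope ring_scope.

Definition is_partition (n : nat) (p : seq nat) : bool :=
  [&& sorted geq p, all (leq 1) p & sumn p == n].

Definition partitions_of (n : nat) : set (seq nat) := [set p | is_partition n p].

(* Needed for the sum [varsigma] below to be meaningful: \sum_(p \in D) is 0
   when infinitely many terms are nonzero. *)
Lemma finite_partitions_of (n : nat) : finite_set (partitions_of n).
Proof.
pose f (b : n.-bseq 'I_n.+1) : seq nat := map val b.
apply: (@sub_finite_set _ _ (f @` setT)); last first.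
  by apply: finite_image; exact: finite_finset.
move=> p /and3P[_ p_gt0 /eqP sum_p].
have le_sum k : k \in p -> (k <= n)%N.
  by move=> kp; rewrite -sum_p sumnE (big_rem k) //= leq_addr.
have size_p : (size p <= n)%N.
  rewrite -sum_p; elim: p p_gt0 {sum_p le_sum} => //= k p IH /andP[k_gt0 /IH].
  by move=> le_p; rewrite -add1n leq_add.
have size_q : (size (map (@inord n) p) <= n)%N by rewrite size_map.
exists (Bseq size_q) => //; rewrite /f /= -map_comp -[RHS]map_id.
by apply/eq_in_map => k kp /=; rewrite inordK // ltnS le_sum.
Qed.

Definition mex_candidate (s M A : nat) (p : seq nat) (k : nat) : bool :=
  [&& 0 < k, k == A %[mod M] & count_mem k p < s]%N.

(* The value 0 is only a placeholder for degenerate parameters: see [mexP]. *)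
Definition mex (s M A : nat) (p : seq nat) : nat :=
  match pselect (exists k, mex_candidate s M A p k) with
  | left ex_k => ex_minn ex_k
  | right _ => 0
  end.

Lemma mexP (s M A : nat) (p : seq nat) : (0 < s)%N -> (0 < A <= M)%N ->
  mex_candidate s M A p (mex s M A p) /\
  forall k, mex_candidate s M A p k -> (mex s M A p <= k)%N.
Proof.
move=> s_gt0 /andP[A_gt0 AM]; rewrite /mex; case: pselect => [ex_k|[]].
  by case: ex_minnP.
have M_gt0 : (0 < M)%N by exact: leq_trans AM.
exists ((sumn p).+1 * M + A)%N; apply/and3P; split.
- by rewrite addn_gt0 A_gt0 orbT.
- by rewrite modnMDl.
- rewrite (count_memPn _) //; apply/negP => kp.
  have : ((sumn p).+1 * M + A <= sumn p)%N.
    by rewrite {2}sumnE (big_rem _ kp) /= leq_addr.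
  apply/negP; rewrite -ltnNge; apply: leq_trans (leq_addr _ _).
  exact: leq_pmulr.
Qed.

Definition varsigma (R : realType) (s M A r n : nat) : R :=
  \sum_(p \in partitions_of n) ((mex s M A p)%:R ^+ r : R).

(* Euler's integral of the second kind, which gives Gamma(z) only for z > 0. *)
Definition Gamma (R : realType) (z : R) : R :=
  \int[lebesgue_measure]_(t in `]0, +oo[) (t `^ (z - 1) * expR (- t)).

(* Main.v *)
Require Import Defs.
From HB Require Import structures.
From mathcomp Require Import finmap.
From mathcomp Require Import all_boot all_order all_algebra.
From mathcomp Require Import all_classical all_reals all_analysis.
From mathcomp Require Import measurable_realfun.
From mathcomp Require Import ring lra zify.
Import Order.TTheory GRing.Theory Num.Theory.
Import numFieldNormedType.Exports.
Local Open Scope classical_set_scope.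
Local Open Scope ring_scope.
Set Implicit Arguments.
Unset Strict Implicit.
Unset Printing Implicit Defensive.

(** Let c_j = A + j M. The mex of a partition p is c_J for the largest J such
    that each of c_0, ..., c_(J-1) occurs at least s times in p, so mex(p)^r is
    the telescoping sum of c_j^r - c_(j-1)^r over j <= J. The partitions that
    contain s copies of each of c_0, ..., c_(j-1) correspond, by deletion of
    these copies, to the partitions of n - T_j, where T_j = s (c_0 + ... +
    c_(j-1)). Hence [varsigmaE]

      sum over p of mex(p)^r = sum over j of (c_j^r - c_(j-1)^r) p(n - T_j),

    where p(n) is the number of partitions of n. Since p(n - m) / p(n) is about
    exp(- pi m / sqrt(6 n)) and T_j is about s M j^2 / 2, only the indices j of
    order n^(1/4) matter. With j = x n^(1/4) the sum becomes a Riemann sum, in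
    fact the integral of a step function [step_integral], for the integral over
    x > 0 of r M^r x^(r-1) exp(- kappa x^2), kappa = pi s M / (2 sqrt 6), and
    this integral is a value of the Gamma function [gauss_moment]. The passage
    to the limit is dominated convergence: the pointwise limits come from
    [increment_cvg] and [npartitions_rest_cvg], the dominating function from
    the uniform bound [npartitions_ratio_le].

    Everything rests on p(n) ~ exp(pi sqrt(2 n / 3)) / (4 sqrt 3 n)
    [npartitions_asymp], which is proved by a probabilistic saddle point
    argument. Give each partition of total N the weight exp(- t N). Then the
    multiplicity of the part k is geometric with ratio exp(- k t), these
    multiplicities are independent, and p(n) exp(- t n) / P(t), with
    P(t) the product of the 1 / (1 - exp(- k t)), is the probability that the
    random partition has total n. Fourier inversion [fourier_inversion]
    expresses this probability through the characteristic function, which is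
    handled by its modulus and argument, so that all computations are real. For
    t = pi / sqrt(6 n) the mean is n up to lower order and the rescaled
    characteristic function tends to a Gaussian one [fourier_coef_cvg].

    There remains the behaviour as t tends to 0 of log P(t), of the mean and of
    the variance, which are its first two derivatives up to sign. One has
    log P(t) = pi^2 / (6 t) + (ln t) / 2 - (ln (2 pi)) / 2 + o(1)
    [logP_rem_cvg0]. The leading coefficient is zeta(2), by comparison of the
    series with the dilogarithm; the lower terms follow from the fact that
    2 log P(t) - 4 log P(2 t) + ln(1 - exp(- t)) is the logarithm of a q-analogue
    of Wallis' product for pi / 2. The two derivatives are then obtained from
    convexity alone [slope_transfer]. *)

(** * Derivatives *)

Section PointwiseDerivatives.
Context {R : realType}.
Implicit Types (f g : R -> R) (x a b : R).

(** The rules of derivation for functions written as lambda terms, with an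
    explicit value of the derivative: compound derivatives can be built as proof
    terms and the value adjusted at the end. *)
Lemma isdC a x : is_derive x 1 (fun _ : R => a) 0.
Proof. exact: is_derive_cst. Qed.

Lemma isdI x : is_derive x 1 (fun y : R => y) 1.
Proof. exact: is_derive_id. Qed.

Lemma isdD f g x a b : is_derive x 1 f a -> is_derive x 1 g b ->
  is_derive x 1 (fun y => f y + g y) (a + b).
Proof. exact: is_deriveD. Qed.

Lemma isdN f x a : is_derive x 1 f a -> is_derive x 1 (fun y => - f y) (- a).
Proof. exact: is_deriveN. Qed.

Lemma isdB f g x a b : is_derive x 1 f a -> is_derive x 1 g b ->
  is_derive x 1 (fun y => f y - g y) (a - b).
Proof. by move=> hf hg; apply: isdD => //; exact: isdN. Qed.

Lemma isdM f g x a b : is_derive x 1 f a -> is_derive x 1 g b ->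
  is_derive x 1 (fun y => f y * g y) (a * g x + f x * b).
Proof.
by move=> hf hg; apply: is_derive_eq; rewrite /GRing.scale /=; ring.
Qed.

Lemma isdX f x a n : is_derive x 1 f a ->
  is_derive x 1 (fun y => f y ^+ n) (n%:R * f x ^+ n.-1 * a).
Proof.
move=> hf.
have -> : (fun y => f y ^+ n) = (f ^+ n : R -> R).
  by apply/funext => y; rewrite fctE.
by apply: is_derive_eq; rewrite /GRing.scale /=; ring.
Qed.

Lemma isdcomp f g x a b : is_derive x 1 f a -> is_derive (f x) 1 g b ->
  is_derive x 1 (fun y => g (f y)) (a * b).
Proof.
by move=> hf hg; rewrite mulrC; exact: (@is_derive1_comp _ g f).
Qed.

Lemma isdV f x a : f x != 0 -> is_derive x 1 f a ->
  is_derive x 1 (fun y => (f y)^-1) (- a / f x ^+ 2).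
Proof.
move=> fx0 hf; apply: is_derive_eq.
by rewrite /GRing.scale /= mulNr mulrC mulNr.
Qed.

Lemma is_derive_continuous f x a : is_derive x 1 f a -> {for x, continuous f}.
Proof.
by move=> [hf _]; apply: differentiable_continuous; apply/derivable1_diffP.
Qed.

Lemma MVT_is_derive f (df : R -> R) a b : a <= b ->
  (forall x, a <= x <= b -> is_derive x 1 f (df x)) ->
  exists2 c, a <= c <= b & f b - f a = df c * (b - a).
Proof.
move=> ab hf.
have [] := @MVT_segment R f df a b ab.
- by move=> x; rewrite in_itv/= => /andP[ax xb]; apply: hf; rewrite !ltW.
- apply: continuous_in_subspaceT => x; rewrite inE/= in_itv/= => /hf.
  exact: is_derive_continuous.
- by move=> c; rewrite in_itv/= => ? ?; exists c.
Qed.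

End PointwiseDerivatives.

(** * Integrated slopes *)

Section Slope.
Context {R : realType}.
Implicit Types (F f : R -> R) (x y d t : R).

(** A form of F' = - f with f nonincreasing that involves no derivative: F is
    convex and its difference quotients lie between values of - f. Unlike
    differentiability it passes to sums of series without uniformity. *)
Definition slope F f := forall x d, 0 < x -> 0 < d ->
  d * f (x + d) <= F x - F (x + d) <= d * f x.

Lemma slope_derive F f : (forall x, 0 < x -> is_derive x 1 F (- f x)) ->
  (forall x y, 0 < x -> x <= y -> f y <= f x) -> slope F f.
Proof.
move=> dF nf x d x0 d0.
have xd : x <= x + d by rewrite lerDl ltW.
have [y /andP[ay yb]|c /andP[xc cd] e] := @MVT_is_derive R F (\- f) _ _ xd.
  by apply: dF; apply: lt_le_trans x0 ay.
have -> : F x - F (x + d) = d * f c.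
  by rewrite -opprB e /=; ring.
by rewrite !ler_pM2l// !nf//; exact: lt_le_trans x0 xc.
Qed.

Lemma slope_scale F f (a c : R) : 0 <= a -> 0 < c -> slope F f ->
  slope (fun x => a * F (c * x)) (fun x => a * (c * f (c * x))).
Proof.
move=> a0 c0 sF x d x0 d0.
have /andP[h1 h2] := sF (c * x) (c * d) (mulr_gt0 c0 x0) (mulr_gt0 c0 d0).
rewrite mulrDr -mulrBr.
have -> u : d * (a * (c * u)) = a * (c * d * u) by ring.
have -> u : d * (a * (c * u)) = a * (c * d * u) by ring.
by apply/andP; split; exact: ler_wpM2l.
Qed.

(** Convergence of the series of the slopes comes for free: each slope is at
    most a difference quotient of the convergent series. *)
Lemma slope_series (F f : nat -> R -> R) :
  (forall m, slope (F m) (f m)) ->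
  (forall m x, 0 < x -> 0 <= F m x) -> (forall m x, 0 < x -> 0 <= f m x) ->
  (forall x, 0 < x -> cvgn (series (F ^~ x))) ->
  (forall x, 0 < x -> cvgn (series (f ^~ x))) /\
  slope (fun x => limn (series (F ^~ x))) (fun x => limn (series (f ^~ x))).
Proof.
move=> sF F0 f0 cF.
have cf x : 0 < x -> cvgn (series (f ^~ x)).
  move=> x0; have h0 : 0 < x / 2 by rewrite divr_gt0.
  apply: (@series_le_cvg _ _ ((x / 2)^-1 *: (F ^~ (x / 2)))).
  - by move=> n; exact: f0.
  - by move=> n; rewrite fctE mulr_ge0 ?invr_ge0 ?F0// ltW.
  - move=> n; rewrite fctE /GRing.scale/= ler_pdivlMl//.
    have /andP[+ _] := sF n _ _ h0 h0; rewrite -splitr => /le_trans; apply.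
    by rewrite gerBl F0.
  - by apply: is_cvg_seriesZ; exact: cF.
split=> // x d x0 d0.
have xd0 : 0 < x + d by rewrite addr_gt0.
have E (a b : R^nat) k : cvgn (series a) -> cvgn (series b) ->
   limn (series (k *: a)) = k * limn (series a) /\
   (limn (series (a - b)) = limn (series a) - limn (series b) /\
   cvgn (series (a - b))).
  move=> ca cb; split; first by rewrite lim_seriesZ.
  by split; [rewrite lim_seriesB|exact: is_cvg_seriesB].
have [_ [<- ?]] := E _ _ 0 (cF _ x0) (cF _ xd0).
rewrite -[d * _](E _ _ d (cf _ xd0) (cf _ xd0)).1.
rewrite -[d * _](E _ _ d (cf _ x0) (cf _ x0)).1.
apply/andP; split; apply: lim_series_le => //; try exact/is_cvg_seriesZ/cf;
  by move=> n; have /andP[] := sF n x d x0 d0.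
Qed.

End Slope.

Section EqCvg.
Context {R : realType}.

Lemma cvg_ext (f g : nat -> R) (l l' : R) : f n @[n --> \oo] --> l ->
  (forall n, f n = g n) -> l = l' -> g n @[n --> \oo] --> l'.
Proof. by move=> fl fg <-; have -> : g = f by apply/funext => n; rewrite fg. Qed.

End EqCvg.

(** * The functions -ln(1 - e^(-x)), 1 / (e^x - 1) and e^x / (e^x - 1)^2 *)

Section BoseFunctions.
Context {R : realType}.
Implicit Types (x y d t u : R).

(** For a geometric variable of ratio exp(-x), bose0 is minus the logarithm of
    the normalizing constant, bose1 the mean and bose2 the variance. *)
Definition bose0 x : R := - ln (1 - expR (- x)).
Definition bose1 x : R := expR (- x) / (1 - expR (- x)).
Definition bose2 x : R := expR (- x) / (1 - expR (- x)) ^+ 2.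

Lemma expRN_gt0_lt1 x : 0 < x -> 0 < expR (- x) < 1.
Proof. by move=> x0; rewrite expR_gt0 expR_lt1 oppr_lt0. Qed.

Lemma onem_expRN_gt0 x : 0 < x -> 0 < 1 - expR (- x).
Proof. by move=> /expRN_gt0_lt1/andP[_]; rewrite subr_gt0. Qed.

Lemma onem_expRN_le x : 1 - expR (- x) <= x.
Proof. by have := expR_ge1Dx (- x); lra. Qed.

Lemma bose0_ge0 x : 0 < x -> 0 <= bose0 x.
Proof.
by move=> x0; rewrite /bose0 oppr_ge0 ln_le0// gerBl expR_ge0.
Qed.

Lemma bose1_ge0 x : 0 < x -> 0 <= bose1 x.
Proof. by move=> x0; rewrite divr_ge0 ?expR_ge0// ltW// onem_expRN_gt0. Qed.

Lemma bose2_ge0 x : 0 <= bose2 x.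
Proof. by rewrite divr_ge0 ?expR_ge0// sqr_ge0. Qed.

Lemma slope_bose0 : slope bose0 bose1.
Proof.
apply: slope_derive => [x x0|x y x0 xy].
  have p := onem_expRN_gt0 x0.
  rewrite /bose0 /bose1; apply: isdN; apply: is_derive_eq.
    apply: (@isdcomp _ (fun y => 1 - expR (- y)) (@ln R)).
    exact: is_derive1_ln.
  by rewrite /=; field; rewrite gt_eqF.
have py := onem_expRN_gt0 (lt_le_trans x0 xy).
have px := onem_expRN_gt0 x0.
rewrite /bose1 ler_pM ?expR_ge0 ?invr_ge0 ?(ltW py)// ?ler_expR ?lerN2//.
by rewrite lef_pV2 ?posrE// lerB// ler_expR lerN2.
Qed.

Lemma slope_bose1 : slope bose1 bose2.
Proof.
apply: slope_derive => [x x0|x y x0 xy].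
  have p := onem_expRN_gt0 x0.
  have de : is_derive x 1 (fun y => expR (- y)) (- expR (- x)).
    by apply: is_derive_eq; rewrite mulrN1.
  have p' : 1 - expR (- x) != 0 by rewrite gt_eqF.
  have D := isdM de (@isdV _ (fun y => 1 - expR (- y)) x _ p' (isdB (isdC 1 x) de)).
  apply: (@is_derive_eq _ _ _ _ _ _ _ _ D).
  by rewrite /bose2; field.
have py := onem_expRN_gt0 (lt_le_trans x0 xy).
have px := onem_expRN_gt0 x0.
rewrite /bose2 ler_pM ?expR_ge0 ?invr_ge0 ?sqr_ge0// ?ler_expR ?lerN2//.
rewrite lef_pV2 ?posrE ?exprn_gt0// ler_pXn2r ?nnegrE ?(ltW px) ?(ltW py)//.
by rewrite lerB// ler_expR lerN2.
Qed.

Lemma bose1_le x : 0 < x -> x * bose1 x <= 1.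
Proof.
move=> x0; rewrite /bose1 mulrA ler_pdivrMr ?onem_expRN_gt0// mul1r.
rewrite -(ler_pM2l (expR_gt0 x)) mulrBr mulr1 mulrCA expRxMexpNx_1 mulr1.
by have := expR_ge1Dx x; lra.
Qed.

Lemma expR_sub_ge y : 0 <= y -> 2 * y <= expR y - expR (- y).
Proof.
move=> y0.
have [x _|c _] := @MVT_is_derive R (fun y => expR y - expR (- y) - 2 * y)
   (fun y => expR y + expR (- y) - 2) 0 y y0.
  have -> : expR x + expR (- x) - 2 =
            (expR x - (- 1) * expR (- x)) - (0 * x + 2 * 1) by ring.
  by apply: is_derive_eq; rewrite /GRing.scale/=; ring.
rewrite expR0 oppr0 expR0 mulr0 !subr0 subrr subr0 => e.
rewrite -subr_ge0 e mulr_ge0 ?addr0//= expRN.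
have c0 := expR_gt0 c; have : 0 <= (expR c - 1) ^+ 2 / expR c.
  by rewrite divr_ge0 ?sqr_ge0// ltW.
suff -> : (expR c - 1) ^+ 2 / expR c = expR c + (expR c)^-1 - 2 by [].
by field; rewrite gt_eqF.
Qed.

(** This is the inequality y <= sinh y at y = x / 2. *)
Lemma bose2_le x : 0 < x -> x ^+ 2 * bose2 x <= 1.
Proof.
move=> x0; have p := onem_expRN_gt0 x0.
rewrite /bose2 mulrA ler_pdivrMr ?exprn_gt0// mul1r.
have -> : expR (- x) = expR (- (x / 2)) ^+ 2.
  by rewrite -expRM_natl; congr expR; field.
rewrite -exprMn ler_pXn2r ?nnegrE ?mulr_ge0 ?expR_ge0 ?(ltW x0)//; last first.
  by rewrite -expRM_natl (_ : 2 * _ = - x) ?(ltW p)//; field.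
have h0 : 0 <= x / 2 by rewrite divr_ge0// ltW.
have := expR_sub_ge h0; rewrite -(ler_pM2l (expR_gt0 (- (x / 2)))).
rewrite mulrBr -expRD addNr expR0 -expr2; congr (_ <= _).
by field.
Qed.

Lemma bose2_ge x : 0 < x -> expR (- x) / x ^+ 2 <= bose2 x.
Proof.
move=> x0; have p := onem_expRN_gt0 x0.
rewrite /bose2 ler_wpM2l ?expR_ge0// lef_pV2 ?posrE ?exprn_gt0//.
by rewrite ler_pXn2r ?nnegrE ?(ltW p) ?(ltW x0)// onem_expRN_le.
Qed.

(** The M-th partial sum plus ln (1 - s) has derivative - s^M / (1 - s), so the
    mean value theorem bounds the remainder by x^M / (1 - x). *)
Lemma log_series x : 0 <= x < 1 ->
  series (fun m => x ^+ m.+1 / m.+1%:R) @ \oo --> - ln (1 - x).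
Proof.
move=> /andP[x0 x1].
have d M s : 0 <= s <= x -> is_derive s 1
   (fun s => series (fun m => s ^+ m.+1 / m.+1%:R) M + ln (1 - s))
   (- s ^+ M / (1 - s)).
  move=> /andP[s0 sx]; have s1 : 0 < 1 - s by rewrite subr_gt0 (le_lt_trans sx).
  apply: is_derive_eq.
    apply: (@isdD _ _ _ _ ((1 - s ^+ M) / (1 - s)) (- 1 / (1 - s))).
      elim: M => [|M IH].
        rewrite expr0 subrr mul0r.
        have -> : (fun s0 : R => series (fun m => s0 ^+ m.+1 / m.+1%:R) 0%N) = cst 0.
          by apply/funext => z; rewrite /series /= big_geq.
        exact: isdC.
      have {IH} IH : is_derive s 1 _ _ := IH.
      have -> : (fun s0 : R => series (fun m => s0 ^+ m.+1 / m.+1%:R) M.+1) =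
                (fun s0 => series (fun m => s0 ^+ m.+1 / m.+1%:R) M +
                           s0 ^+ M.+1 * M.+1%:R^-1).
        by apply/funext => z; rewrite seriesSr.
      apply: (is_derive_eq (isdD IH
        (isdM (isdX M.+1 (isdI s)) (isdC M.+1%:R^-1 s)))).
      rewrite /= exprS; field; rewrite gt_eqF//=; lra.
    apply: (is_derive_eq (isdcomp (isdB (isdC 1 s) (isdI s))
                                  (is_derive1_ln s1))).
    by rewrite sub0r.
  by field; rewrite gt_eqF.
have x1' : 0 < 1 - x by rewrite subr_gt0.
have b M : `|- ln (1 - x) - series (fun m => x ^+ m.+1 / m.+1%:R) M| <=
     x ^+ M / (1 - x).
  have [c /andP[c0 cx]] := MVT_is_derive x0 (d M).
  rewrite [X in _ - (X + _)](_ : _ = 0); last first.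
    by rewrite /series /= big1// => i _; rewrite expr0n /= mul0r.
  rewrite subr0 ln1 add0r !subr0 => e.
  rewrite -opprD addrC e; have c1 : 0 < 1 - c by lra.
  rewrite !mulNr opprK ger0_norm; last first.
    by rewrite mulr_ge0 ?divr_ge0 ?exprn_ge0 ?(ltW c1).
  apply: (@le_trans _ _ (c ^+ M / (1 - c))).
    by rewrite ler_piMr ?divr_ge0 ?exprn_ge0// ltW.
  rewrite ler_pM ?exprn_ge0 ?invr_ge0 ?(ltW c1)//.
    by rewrite lerXn2r ?nnegrE.
  by rewrite lef_pV2 ?posrE// lerB.
apply/cvgrPdist_le => e e0.
have : (fun M => x ^+ M / (1 - x)) @ \oo --> 0.
  rewrite -[0](mul0r (1 - x)^-1); apply: cvgMl.
  by apply: cvg_expr; rewrite ger0_norm.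
move=> /cvgrPdist_le/(_ e e0); apply: filterS => M /=.
rewrite sub0r normrN ger0_norm; last first.
  by rewrite divr_ge0 ?exprn_ge0// ltW.
exact: le_trans.
Qed.

End BoseFunctions.

(** * The leading coefficient of log P as a zeta value *)

Section DilogBounds.
Context {R : realType}.
Implicit Types (x y d t u e : R).

Lemma limn_seriesZ (f : R^nat) (k : R) : cvgn (series f) ->
  limn (series (fun n => k * f n)) = k * limn (series f).
Proof. by move=> cf; rewrite -[RHS](lim_seriesZ _ cf). Qed.

Lemma cvgn_seriesZ (f : R^nat) (k : R) : cvgn (series f) ->
  cvgn (series (fun n => k * f n)).
Proof. by move=> cf; have := @is_cvg_seriesZ _ _ k cf. Qed.

Lemma limn_seriesD (f g : R^nat) : cvgn (series f) -> cvgn (series g) ->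
  limn (series (fun n => f n + g n)) = limn (series f) + limn (series g).
Proof. by move=> cf cg; rewrite -(lim_seriesD cf cg). Qed.

Lemma cvgn_seriesD (f g : R^nat) : cvgn (series f) -> cvgn (series g) ->
  cvgn (series (fun n => f n + g n)).
Proof. by move=> cf cg; have := @is_cvg_seriesD _ _ _ cf cg. Qed.

Definition dilog x : R :=
  limn (series (fun m => m.+1%:R ^- 2 * expR (- (m.+1%:R * x)) : R)).
Definition zeta2 : R := limn (series (fun m => m.+1%:R ^- 2 : R)).

Let ge0_series_nd (f : R^nat) : (forall n, 0 <= f n) ->
  {homo series f : n m / (n <= m)%N >-> n <= m}.
Proof. by move=> f0; apply: nondecreasing_series => n _ _; exact: f0. Qed.

Lemma bounded_series_cvg (f : R^nat) (B : R) : (forall n, 0 <= f n) ->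
  (forall n, series f n <= B) -> cvgn (series f) /\ limn (series f) <= B.
Proof.
move=> f0 fB; have c : cvgn (series f).
  apply: nondecreasing_is_cvgn; first exact: ge0_series_nd.
  by exists B => _ [n _ <-].
by split=> //; apply: limr_le => //; apply: nearW.
Qed.

Lemma is_cvg_zeta2 : cvgn (series (fun m => m.+1%:R ^- 2 : R)).
Proof.
apply: (@bounded_series_cvg _ 2 _ _).1 => // -[|n].
  by rewrite /series /= big_geq.
suff : series (fun m => m.+1%:R ^- 2 : R) n.+1 <= 2 - n.+1%:R^-1.
  by move=> /le_trans; apply; rewrite gerBl.
elim: n => [|n IH].
  by rewrite /series /= big_nat1 expr1n !invr1; lra.
rewrite seriesSr (le_trans (lerD IH (lexx _)))//.
rewrite -[n.+2]addn1 natrD; set a : R := n.+1%:R.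
have a0 : 0 < a by [].
rewrite -subr_ge0.
have -> : 2 - (a + 1)^-1 - (2 - a^-1 + (a + 1) ^- 2) = (a * (a + 1) ^+ 2)^-1.
  by field; rewrite !gt_eqF// ltr_wpDl// ltW.
by rewrite invr_ge0 mulr_ge0 ?sqr_ge0// ltW.
Qed.

Lemma series_le_lim (f : R^nat) n : (forall n, 0 <= f n) -> cvgn (series f) ->
  series f n <= limn (series f).
Proof. by move=> f0 cf; apply: nondecreasing_cvgn_le => //; exact: ge0_series_nd. Qed.

Lemma is_cvg_dilog x : 0 <= x ->
  cvgn (series (fun m => m.+1%:R ^- 2 * expR (- (m.+1%:R * x)) : R)).
Proof.
move=> x0; apply: (series_le_cvg _ _ _ is_cvg_zeta2) => // n.
by rewrite ler_piMr// expR_le1 oppr_le0 mulr_ge0.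
Qed.

Lemma dilog_ge0 x : 0 <= x -> 0 <= dilog x.
Proof.
move=> x0; apply: limr_ge; first exact: is_cvg_dilog.
by apply: nearW => n; apply: sumr_ge0 => i _; rewrite mulr_ge0 ?expR_ge0.
Qed.

Lemma dilog_le x : 0 <= x -> dilog x <= expR (- x) * zeta2.
Proof.
move=> x0; rewrite /dilog /zeta2 -(limn_seriesZ _ is_cvg_zeta2).
apply: lim_series_le; first exact: is_cvg_dilog.
  by apply: cvgn_seriesZ; exact: is_cvg_zeta2.
move=> n; rewrite mulrC ler_wpM2r// ler_expR lerN2 ler_peMl//.
by rewrite ler1n.
Qed.

Lemma log_series_expR x : 0 < x ->
  series (fun m => m.+1%:R ^- 2 * (m.+1%:R * expR (- (m.+1%:R * x)))) @ \oo
    --> bose0 x.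
Proof.
move=> x0; have := @log_series _ (expR (- x)).
rewrite expR_ge0 expR_lt1 oppr_lt0 => /(_ x0).
suff -> : (fun m => expR (- x) ^+ m.+1 / m.+1%:R) =
  (fun m => m.+1%:R ^- 2 * (m.+1%:R * expR (- (m.+1%:R * x)))) by [].
apply/funext => m; rewrite -mulrN expRM_natl; field.
by rewrite nat1r pnatr_eq0.
Qed.

(** Termwise, the sum of exp(- m x) / m^2 has slope the sum of exp(- m x) / m. *)
Lemma slope_dilog : slope dilog bose0.
Proof.
have sE : slope (fun x : R => expR (- x)) (fun x => expR (- x)).
  apply: slope_derive => [x x0|x y x0 xy]; last by rewrite ler_expR lerN2.
  by apply: is_derive_eq; rewrite mulrN1.
have [//|m x _|m x _|x x0|_ s] := @slope_series R
    (fun m x => m.+1%:R ^- 2 * expR (- (m.+1%:R * x)))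
    (fun m x => m.+1%:R ^- 2 * (m.+1%:R * expR (- (m.+1%:R * x)))).
- by move=> m; apply: (slope_scale _ _ sE).
- by rewrite mulr_ge0 ?expR_ge0.
- by rewrite !mulr_ge0 ?expR_ge0.
- by apply: is_cvg_dilog; exact: ltW.
move=> x d x0 d0; have := s x d x0 d0.
rewrite (cvg_lim _ (log_series_expR x0))//.
by rewrite (cvg_lim _ (log_series_expR (addr_gt0 x0 d0))).
Qed.

(** Termwise this is (1 + m t) exp(- m t) <= 1. It controls the first term of
    the sum of bose0 (k t), where the comparison with increments of dilog has
    nothing on its left. *)
Lemma dilog_bose0_le t : 0 < t -> t * bose0 t + dilog t <= zeta2.
Proof.
move=> t0; have lc := log_series_expR t0.
have cd := is_cvg_dilog (ltW t0).
have cl := cvgP _ lc; have ctl := @cvgn_seriesZ _ t cl.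
rewrite -(cvg_lim _ lc)// /dilog -(limn_seriesZ _ cl) -limn_seriesD//.
apply: lim_series_le => //; [exact: cvgn_seriesD|exact: is_cvg_zeta2|].
move=> n.
rewrite (_ : _ + _ = n.+1%:R ^- 2 * ((1 + n.+1%:R * t) * expR (- (n.+1%:R * t)))); last first.
  by ring.
rewrite ler_piMr// expRN ler_pdivrMr ?expR_gt0// mul1r.
exact: expR_ge1Dx.
Qed.

(** Only the lower bound needs work: a finite partial sum already comes close to
    zeta2, and its terms are continuous at 0. *)
Lemma dilog_cvg0 : dilog t @[t --> 0^'+] --> zeta2.
Proof.
have z0 : 0 <= zeta2.
  by apply: limr_ge; [exact: is_cvg_zeta2|apply: nearW => n; exact: sumr_ge0].
apply/cvgrPdist_le => e e0; have e2 : 0 < e / 2 by rewrite divr_gt0.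
have /cvgrPdist_le/(_ _ e2)[M _ /(_ M (leqnn _))/=] := is_cvg_zeta2.
rewrite -/zeta2; set S := series _ M => zS.
have p : 0 < e / 2 / (M%:R * zeta2 + 1).
  by rewrite divr_gt0// ltr_wpDl// mulr_ge0.
near=> t.
have t0 : 0 < t by near: t; exact: nbhs_right_gt.
have te : t <= e / 2 / (M%:R * zeta2 + 1) by near: t; exact: nbhs_right_le.
have dz : dilog t <= zeta2.
  by have := dilog_bose0_le t0; have := mulr_ge0 (ltW t0) (bose0_ge0 t0); lra.
rewrite ger0_norm ?subr_ge0//.
have Sd : S - M%:R * t * S <= dilog t.
  apply: le_trans (series_le_lim M _ (is_cvg_dilog (ltW t0))); last first.
    by move=> n; rewrite mulr_ge0 ?expR_ge0.
  rewrite /S /series /= mulr_sumr -sumrB ler_sum_nat// => i /= iM.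
  rewrite -{1}[_ ^- 2]mul1r -mulrBl mulrC ler_wpM2l//.
  apply: le_trans (expR_ge1Dx _); rewrite lerD2l lerN2 ler_wpM2r ?(ltW t0)//.
  by rewrite ler_nat.
have SZ : S <= zeta2 by apply: series_le_lim => //; exact: is_cvg_zeta2.
have : M%:R * t * S <= e / 2.
  move: te; rewrite ler_pdivlMr; last by rewrite ltr_wpDl// mulr_ge0.
  apply: le_trans; rewrite mulrAC [t * _]mulrC ler_wpM2r ?(ltW t0)//.
  by rewrite ler_wpDr// ler_wpM2l.
move: zS; rewrite ger0_norm ?subr_ge0//; lra.
Unshelve. all: by end_near. Qed.

Let bose0_series_ge t n : 0 < t ->
  dilog t - dilog (n.+1%:R * t) <= t * series (fun k => bose0 (k.+1%:R * t)) n.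
Proof.
move=> t0; elim: n => [|n IH]; first by rewrite mul1r subrr /series/= big_geq// mulr0.
have x0 : 0 < n.+1%:R * t by rewrite mulr_gt0.
have /andP[_] := slope_dilog x0 t0.
have -> : n.+1%:R * t + t = n.+2%:R * t by rewrite -[n.+2]addn1 natrD mulrDl mul1r.
rewrite seriesSr mulrDr; move: IH; lra.
Qed.

Let bose0_series_le t n : 0 < t ->
  t * series (fun k => bose0 (k.+1%:R * t)) n.+1 <= zeta2.
Proof.
move=> t0; suff : t * series (fun k => bose0 (k.+1%:R * t)) n.+1 <=
    t * bose0 t + dilog t - dilog (n.+1%:R * t).
  move=> /le_trans; apply.
  have := dilog_bose0_le t0; have : 0 <= dilog (n.+1%:R * t).
    by apply: dilog_ge0; rewrite mulr_ge0// ltW.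
  lra.
elim: n => [|n IH].
  by rewrite /series /= big_nat1 mul1r addrK.
have x0 : 0 < n.+1%:R * t by rewrite mulr_gt0.
have /andP[+ _] := slope_dilog x0 t0.
have -> : n.+1%:R * t + t = n.+2%:R * t by rewrite -[n.+2]addn1 natrD mulrDl mul1r.
rewrite seriesSr mulrDr; move: IH; lra.
Qed.

(** Comparing the sum with the dilogarithm, whose increments telescope, shows
    that the leading coefficient of the logarithm of the partition product is
    the value of the zeta function at 2. *)
Lemma bose0_lambert_crude :
  (forall t, 0 < t -> cvgn (series (fun k => bose0 (k.+1%:R * t)))) /\
  t * limn (series (fun k => bose0 (k.+1%:R * t))) @[t --> 0^'+] --> zeta2.
Proof.
have b0 t n : 0 < t -> 0 <= bose0 (n.+1%:R * t).
  by move=> t0; rewrite bose0_ge0// mulr_gt0.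
have c t : 0 < t -> cvgn (series (fun k => bose0 (k.+1%:R * t))) /\
     limn (series (fun k => bose0 (k.+1%:R * t))) <= zeta2 / t.
  move=> t0; apply: bounded_series_cvg => [n|n]; first exact: b0.
  rewrite ler_pdivlMr// mulrC; case: n => [|n]; last exact: bose0_series_le.
  rewrite (le_trans _ (bose0_series_le 0 t0))// ler_pM2l// /series/=.
  by rewrite big_geq// sumr_ge0// => i _; exact: b0.
split=> [t /c[]//|].
apply: (@squeeze_cvgr _ _ _ _ dilog (cst zeta2)); last 2 first.
- exact: dilog_cvg0.
- exact: cvg_cst.
near=> t; have t0 : 0 < t by near: t; exact: nbhs_right_gt.
have [ct lt] := c t t0; rewrite /= [X in _ && (X <= _)]mulrC -ler_pdivlMr// lt andbT.
rewrite -subr_le0; set D := _ - _.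
have h : (fun n => expR (- t) ^+ n.+1 * zeta2) @ \oo --> (0 : R).
  rewrite -[0](mul0r zeta2); apply: cvgMl.
  have : (fun n => expR (- t) ^+ n) @ \oo --> (0 : R).
    by apply: cvg_expr; rewrite ger0_norm ?expR_ge0// expR_lt1 oppr_lt0.
  by rewrite -(cvg_shiftS (fun n => expR (- t) ^+ n)).
rewrite -(cvg_lim _ h)//; apply: limr_ge; first by apply: cvgP; exact: h.
apply: nearW => n.
have h0 : 0 <= n.+1%:R * t by rewrite mulr_ge0// ltW.
have := dilog_le h0; rewrite -mulrN expRM_natl; apply: le_trans.
have := bose0_series_ge n t0; have := series_le_lim n (b0 t ^~ t0) ct.
rewrite /D -(ler_pM2l t0); lra.
Unshelve. all: by end_near. Qed.

End DilogBounds.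

(** * Lambert series and differentiation of asymptotics *)

Section SlopeTransfer.
Context {R : realType}.
Implicit Types (x y d t u e : R).

(** The logarithm of the generating function and the cumulants of the random
    partition are Lambert series of this form. *)
Definition lambert (a : nat) (F : R -> R) t : R :=
  limn (series (fun k => k.+1%:R ^+ a * F (k.+1%:R * t))).

Lemma slope_lambert (a : nat) (F f : R -> R) : slope F f ->
  (forall x, 0 < x -> 0 <= F x) -> (forall x, 0 < x -> 0 <= f x) ->
  (forall t, 0 < t -> cvgn (series (fun k => k.+1%:R ^+ a * F (k.+1%:R * t)))) ->
  (forall t, 0 < t ->
     cvgn (series (fun k => k.+1%:R ^+ a.+1 * f (k.+1%:R * t)))) /\
  slope (lambert a F) (lambert a.+1 f).
Proof.
move=> sF F0 f0 cF.
have [k|k x x0|k x x0|x x0|c s] := @slope_series R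
    (fun k x => k.+1%:R ^+ a * F (k.+1%:R * x))
    (fun k x => k.+1%:R ^+ a * (k.+1%:R * f (k.+1%:R * x))).
- exact: slope_scale.
- by rewrite mulr_ge0// F0// mulr_gt0.
- by rewrite !mulr_ge0// f0// mulr_gt0.
- exact: cF.
have E t : (fun k => k.+1%:R ^+ a.+1 * f (k.+1%:R * t)) =
     (fun k : nat => k.+1%:R ^+ a * (k.+1%:R * f (k.+1%:R * t))).
  by apply/funext => k; rewrite exprSr mulrA.
by rewrite /lambert; split=> [t t0|x d x0 d0]; rewrite !E; [exact: c|exact: s].
Qed.

(** Convexity lets one differentiate an asymptotic expansion: if F is convex
    and close to the convex function P, then the difference quotients of F over
    the window eta * w t squeeze its slope around that of P. *)
Lemma slope_transfer (F f P p N w : R -> R) (C : R) : 0 <= C ->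
  slope F f -> slope P p ->
  (forall t, 0 < t < 1 -> 0 < w t <= t) -> (forall t, 0 < t -> 0 < N t) ->
  (forall h, 0 < h <= 1 / 2 -> N t * ((F (t - h * w t) - P (t - h * w t)) -
     (F t - P t)) @[t --> 0^'+] --> 0) ->
  (forall h, 0 < h <= 1 / 2 -> N t * ((F t - P t) -
     (F (t + h * w t) - P (t + h * w t))) @[t --> 0^'+] --> 0) ->
  (forall h t, 0 < h <= 1 / 2 -> 0 < t < 1 ->
    N t * w t * (p (t - h * w t) - p t) <= C * h /\
    N t * w t * (p t - p (t + h * w t)) <= C * h) ->
  N t * w t * (f t - p t) @[t --> 0^'+] --> 0.
Proof.
move=> C0 sF sP w0 N0 El Er pC; apply/cvgrPdist_le => e e0.
(* A window of relative width h makes the variation of p cost C h; once h is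
   fixed, the hypotheses on F - P make the other error negligible. *)
have [h [h0 h2 he]] : exists h, [/\ 0 < h, h <= 1 / 2 & C * h <= e / 2].
  exists (Num.min (1 / 2) (e / 2 / (C + 1))).
  have C1 : 0 < C + 1 by rewrite ltr_wpDl.
  rewrite lt_min ge_min lexx/= !divr_gt0//; split=> //.
  apply: (@le_trans _ _ ((C + 1) * (e / 2 / (C + 1)))).
    by rewrite ler_pM ?lerDl// ?ge_min ?lexx ?orbT// le_min !divr_ge0// ltW.
  by rewrite mulrCA divff ?gt_eqF// mulr1.
have hh : 0 < h <= 1 / 2 by rewrite h0.
have q0 : 0 < h * (e / 2) by rewrite mulr_gt0// divr_gt0.
have /cvgrPdist_le/(_ _ q0) nl := El h hh.
have /cvgrPdist_le/(_ _ q0) nr := Er h hh.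
near=> t.
have t0 : 0 < t by near: t; exact: nbhs_right_gt.
have t1 : t < 1 by near: t; exact: nbhs_right_lt.
have tt : 0 < t < 1 by rewrite t0.
have : `|0 - N t * ((F (t - h * w t) - P (t - h * w t)) - (F t - P t))| <= h * (e / 2).
  by near: t.
have : `|0 - N t * ((F t - P t) - (F (t + h * w t) - P (t + h * w t)))| <= h * (e / 2).
  by near: t.
have [pl pr] := pC h t hh tt.
have /andP[wt0 wtt] := w0 t tt.
have d0 : 0 < h * w t by rewrite mulr_gt0.
have dt : 0 < t - h * w t.
  by rewrite subr_gt0 (le_lt_trans (ler_wpM2l (ltW h0) wtt))// gtr_pMl//; lra.
have := sF _ _ dt d0; have := sP _ _ dt d0.
have := sF _ _ t0 d0; have := sP _ _ t0 d0.
rewrite subrK; have n0 := N0 t t0; move: pl pr.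
set pm := p (t - _); set FM := F (t - _); set PM := P (t - _).
set pp := p (t + _); set FP := F (t + _); set PP := P (t + _).
set Ft := F t; set ft := f t; set Pt := P t; set pt := p t.
move=> pl pr /andP[a1 a2] /andP[b1 b2] /andP[c1 c2] /andP[d1 d2].
rewrite !sub0r !normrN !ler_norml => /andP[e1 e2] /andP[f1 f2].
have g1 : h * w t * (ft - pm) <= (FM - PM) - (Ft - Pt) by lra.
have g2 : (Ft - Pt) - (FP - PP) <= h * w t * (ft - pp) by lra.
have {}g1 := le_trans (ler_wpM2l (ltW n0) g1) f2.
have {}g2 := le_trans e1 (ler_wpM2l (ltW n0) g2).
have {}g1 : N t * w t * (ft - pm) <= e / 2.
  by rewrite -(ler_pM2l h0); move: g1; congr (_ <= _); ring.
have {}g2 : - (e / 2) <= N t * w t * (ft - pp).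
  by rewrite -(ler_pM2l h0) mulrN; move: g2; congr (_ <= _); ring.
apply/andP; split; lra.
Unshelve. all: by end_near. Qed.

End SlopeTransfer.

(** * The Basel sum and Wallis' product *)

Section SegmentIntegral.
Context {R : realType}.
Implicit Types (f g F : R -> R) (a b x : R).
Notation mu := (@lebesgue_measure R).

Lemma segment_integrable f a b : continuous f ->
  mu.-integrable `[a, b] (EFin \o f).
Proof.
move=> cf; apply: continuous_compact_integrable; first exact: segment_compact.
exact: continuous_subspaceT.
Qed.

Lemma segment_FTC f F a b : a < b -> continuous f ->
  (forall x, is_derive x 1 F (f x)) ->
  \int[mu]_(x in `[a, b]) f x = F b - F a.
Proof.
move=> ab cf dF; have cF : continuous F.
  by move=> x; exact: is_derive_continuous (dF x).
rewrite /Rintegral (@continuous_FTC2 _ f F)//.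
- exact: continuous_subspaceT.
- split; first by move=> x _; have [] := dF x.
    by apply: cvg_at_right_filter; exact: cF.
  by apply: cvg_at_left_filter; exact: cF.
- by move=> x _; rewrite derive1E; have [_ ->] := dF x.
Qed.

Lemma segment_integralD f g a b : continuous f -> continuous g ->
  \int[mu]_(x in `[a, b]) (f x + g x) =
  \int[mu]_(x in `[a, b]) f x + \int[mu]_(x in `[a, b]) g x.
Proof. by move=> cf cg; apply: RintegralD => //; exact: segment_integrable. Qed.

Lemma segment_integralZ f k a b : continuous f ->
  \int[mu]_(x in `[a, b]) (k * f x) = k * \int[mu]_(x in `[a, b]) f x.
Proof. by move=> cf; apply: RintegralZl => //; exact: segment_integrable. Qed.

Lemma segment_le_integral f g a b : continuous f -> continuous g ->
  (forall x, a <= x <= b -> f x <= g x) ->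
  \int[mu]_(x in `[a, b]) f x <= \int[mu]_(x in `[a, b]) g x.
Proof.
by move=> cf cg fg; apply: le_Rintegral => //; exact: segment_integrable.
Qed.

End SegmentIntegral.

Section CosineIntegrals.
Context {R : realType}.
Implicit Types (x y t : R) (n k : nat).
Notation mu := (@lebesgue_measure R).

(** The chord of the concave function sin on [0, pi/2] lies below its graph. *)
Lemma jordan_sin x : 0 <= x <= pi / 2 -> 2 * x / pi <= sin x.
Proof.
move=> /andP[]; rewrite le_eqVlt => /predU1P[<- _|x0 xp].
  by rewrite mulr0 mul0r sin0.
have p0 := pi_gt0 R.
have [c1 /andP[c10 c1x]] := @MVT_is_derive R (@sin R) (@cos R) 0 x (ltW x0) (fun x _ => is_derive_sin x).
have [c2 /andP[xc2 c2p]] := @MVT_is_derive R (@sin R) (@cos R) x (pi / 2) xp (fun x _ => is_derive_sin x).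
rewrite sin0 !subr0 sin_pihalf => e2 e1.
have cc : cos c2 <= cos c1.
  rewrite leNgt ltr_cos ?in_itv/= -?leNgt ?(le_trans c1x)// ?c10/=; lra.
have : 0 <= (cos c1 - cos c2) * (x * (pi / 2 - x)).
  by rewrite mulr_ge0 ?subr_ge0// mulr_ge0 ?subr_ge0// ltW.
have -> : (cos c1 - cos c2) * (x * (pi / 2 - x)) =
   (cos c1 * x) * (pi / 2 - x) - (cos c2 * (pi / 2 - x)) * x by ring.
rewrite -e1 -e2 ler_pdivrMr//; lra.
Qed.

Definition cosI n : R := \int[mu]_(x in `[0, pi / 2]) cos x ^+ n.
Definition cosJ n : R := \int[mu]_(x in `[0, pi / 2]) (x ^+ 2 * cos x ^+ n).

Let pih0 : 0 < pi / 2 :> R. Proof. by rewrite divr_gt0// pi_gt0. Qed.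

Lemma continuous_cosX n : continuous (fun x => cos x ^+ n : R).
Proof.
by move=> x; exact: (is_derive_continuous (isdX n (is_derive_cos x))).
Qed.

Lemma continuous_sqrX_cosX n : continuous (fun x => x ^+ 2 * cos x ^+ n : R).
Proof.
move=> x; apply: (is_derive_continuous (isdM (isdX 2 (isdI x))
   (isdX n (is_derive_cos x)))).
Qed.

Lemma cosI0 : cosI 0 = pi / 2.
Proof.
rewrite /cosI (@segment_FTC R _ id)//; first by rewrite subr0.
exact: continuous_cosX.
Qed.

Lemma cosI1 : cosI 1 = 1.
Proof.
rewrite /cosI (@segment_FTC R _ sin)//.
  by rewrite sin_pihalf sin0 subr0.
exact: continuous_cosX.
Qed.

Lemma cosJ0 : cosJ 0 = pi ^+ 3 / 24.
Proof.
have D x : is_derive x 1 (fun x => x ^+ 3 / 3) (x ^+ 2 * cos x ^+ 0 : R).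
  apply: (is_derive_eq (isdM (isdX 3 (isdI x)) (isdC 3^-1 x))).
  by rewrite /=; field.
rewrite /cosJ (segment_FTC pih0 _ D); last exact: continuous_sqrX_cosX.
by field.
Qed.

(** The boundary terms of cos^(n+1) sin vanish at 0 and pi / 2. *)
Lemma cosI_rec n : n.+2%:R * cosI n.+2 = n.+1%:R * cosI n.
Proof.
apply/eqP; rewrite -subr_eq0 /cosI -mulNr.
rewrite -!segment_integralZ -?segment_integralD; try exact: continuous_cosX.
- have D x : is_derive x 1 (fun x => cos x ^+ n.+1 * sin x)
      (n.+2%:R * cos x ^+ n.+2 + - n.+1%:R * cos x ^+ n : R).
    apply: (is_derive_eq (isdM (isdX n.+1 (is_derive_cos x)) (is_derive_sin x))).
    rewrite /= !exprS; have := sin2cos2 x; rewrite expr2 => E.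
    rewrite (_ : n.+1%:R * cos x ^+ n * - sin x * sin x = - n.+1%:R * cos x ^+ n * (sin x * sin x)); last by ring.
    rewrite E -[n.+2]addn1 natrD; ring.
  rewrite (segment_FTC pih0 _ D).
    by rewrite cos_pihalf expr0n/= sin0 mul0r mulr0 subrr.
  move=> x; apply: (is_derive_continuous (isdD (isdM (isdC n.+2%:R x) (isdX n.+2 (is_derive_cos x)))
     (isdM (isdC (- n.+1%:R) x) (isdX n (is_derive_cos x))))).
- by move=> x; apply: (is_derive_continuous (isdM (isdC n.+2%:R x) (isdX n.+2 (is_derive_cos x)))).
- by move=> x; apply: (is_derive_continuous (isdM (isdC (- n.+1%:R) x) (isdX n (is_derive_cos x)))).
Qed.

Lemma cosI_nonincr n : cosI n.+1 <= cosI n.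
Proof.
apply: segment_le_integral; try exact: continuous_cosX.
move=> x /andP[x0 xp]; rewrite exprS ler_piMl ?cos_le1// exprn_ge0//.
by rewrite cos_ge0_pihalf// xp (le_trans _ x0)// oppr_le0 ltW.
Qed.

Lemma cosI_gt0 n : 0 < cosI n.
Proof.
have E m : cosI m.+2 = m.+1%:R / m.+2%:R * cosI m.
  by rewrite -mulrAC -cosI_rec mulrAC mulfV ?mul1r// pnatr_eq0.
suff : 0 < cosI n /\ 0 < cosI n.+1 by case.
elim: n => [|n [IH1 IH2]]; first by rewrite cosI0 cosI1.
by split=> //; rewrite E mulr_gt0// divr_gt0.
Qed.

(** The function x cos^(2n+2) + (n+1) x^2 sin cos^(2n+1) vanishes at 0 and at
    pi / 2, and its derivative is the combination of integrands below. *)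
Lemma cosJ_rec n : cosI n.+1.*2 =
  n.+1%:R * n.*2.+1%:R * cosJ n.*2 - 2 * n.+1%:R ^+ 2 * cosJ n.+1.*2.
Proof.
apply/eqP; rewrite -subr_eq0 opprB addrA addrAC -addrA; apply/eqP.
rewrite -mulNr /cosI /cosJ.
pose k := n.*2.
have kE : n.+1.*2 = k.+2 by rewrite doubleS.
have nE : n.+1%:R = k.+2%:R / 2 :> R.
  by rewrite /k -doubleS -muln2 natrM mulfK// pnatr_eq0.
rewrite kE -/k nE.
have c1 := continuous_cosX; have c2 := continuous_sqrX_cosX.
have c3 m (a : R) : continuous (fun x => a * (x ^+ 2 * cos x ^+ m) : R).
  by move=> x; apply: (is_derive_continuous (isdM (isdC a x) (isdM (isdX 2 (isdI x)) (isdX m (is_derive_cos x))))).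
rewrite -!segment_integralZ// -?segment_integralD//; last first.
  by move=> x; apply: cvgD; [exact: c3|exact: c3].
have D x : is_derive x 1
    (fun x => x * cos x ^+ k.+2 + k.+2%:R / 2 * (x ^+ 2 * (sin x * cos x ^+ k.+1)))
    (cos x ^+ k.+2 + (- (k.+2%:R / 2 * k.+1%:R) * (x ^+ 2 * cos x ^+ k) +
       2 * (k.+2%:R / 2) ^+ 2 * (x ^+ 2 * cos x ^+ k.+2)) : R).
  apply: (is_derive_eq (isdD (isdM (isdI x) (isdX k.+2 (is_derive_cos x)))
    (isdM (isdC (k.+2%:R / 2) x) (isdM (isdX 2 (isdI x))
      (isdM (is_derive_sin x) (isdX k.+1 (is_derive_cos x))))))).
  rewrite /= !exprS expr0; have := sin2cos2 x; rewrite expr2 => E.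
  have -> : sin x * (k.+1%:R * cos x ^+ k * - sin x) = - k.+1%:R * cos x ^+ k * (sin x * sin x) by ring.
  by rewrite E -[k.+2]addn1 natrD; field.
rewrite (segment_FTC pih0 _ D).
  by rewrite cos_pihalf !exprS !(mulr0, mul0r, addr0) subrr.
by move=> x; apply: cvgD; [exact: c1|apply: cvgD; exact: c3].
Qed.

Let cosI_ratio n : cosI n.+2 / cosI n = n.+1%:R / n.+2%:R.
Proof.
have I0 : cosI n != 0 by rewrite gt_eqF// cosI_gt0.
by apply/eqP; rewrite eqr_div// ?pnatr_eq0// mulrC cosI_rec.
Qed.

(** By the chord inequality x <= (pi / 2) sin x, so x^2 cos^n is at most
    (pi^2 / 4) (1 - cos^2) cos^n. *)
Lemma cosJ_bounds n : 0 <= cosJ n.*2 <= pi ^+ 2 / 4 * (cosI n.*2 - cosI n.*2.+2).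
Proof.
set k := n.*2; apply/andP; split.
  apply: Rintegral_ge0 => x _.
  by rewrite mulr_ge0 ?sqr_ge0// /k -muln2 mulnC exprM exprn_ge0// sqr_ge0.
have c3 m (a : R) : continuous (fun x => a * cos x ^+ m : R).
  by move=> x; apply: (is_derive_continuous (isdM (isdC a x) (isdX m (is_derive_cos x)))).
rewrite -mulN1r /cosI -segment_integralZ//; last exact: continuous_cosX.
rewrite -segment_integralD//; last exact: continuous_cosX.
rewrite -segment_integralZ//; last first.
  by move=> x; apply: cvgD; [exact: continuous_cosX|exact: c3].
apply: segment_le_integral; first exact: continuous_sqrX_cosX.
  move=> x; apply: cvgM; first exact: cvg_cst.
  by apply: cvgD; [exact: continuous_cosX|exact: c3].
move=> x x0p; have p0 := pi_gt0 R.
have := jordan_sin x0p; rewrite ler_pdivrMr// => xs.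
have {}xs : x <= pi / 2 * sin x by lra.
have ck : 0 <= cos x ^+ k by rewrite /k -muln2 mulnC exprM exprn_ge0// sqr_ge0.
have -> : cos x ^+ k + -1 * cos x ^+ k.+2 = (1 - cos x ^+ 2) * cos x ^+ k.
  by rewrite !exprS; ring.
rewrite -sin2cos2 mulrA ler_wpM2r//.
have -> : pi ^+ 2 / 4 * sin x ^+ 2 = (pi / 2 * sin x) ^+ 2 by field.
by move/andP: x0p => [x0 _]; rewrite lerXn2r// nnegrE (le_trans x0).
Qed.

(** Dividing the recurrence for cosJ by cosI turns 1 / (2 n^2) into a difference
    of consecutive quotients cosJ / cosI. *)
Lemma cosJ_telescope n :
  series (fun m => m.+1%:R ^- 2) n = pi ^+ 2 / 6 - 2 * (cosJ n.*2 / cosI n.*2).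
Proof.
elim: n => [|n IH].
  rewrite /series/= big_geq// cosI0 cosJ0.
  have p : pi != 0 :> R by rewrite gt_eqF// pi_gt0.
  by move: p; generalize (@pi R) => q q0; field.
rewrite seriesSr IH.
have I0 := cosI_gt0 n.*2; have I2 := cosI_gt0 n.+1.*2.
suff : cosJ n.*2 / cosI n.*2 - cosJ n.+1.*2 / cosI n.+1.*2 = n.+1%:R ^- 2 / 2.
  set u := cosJ _ / _; set v := cosJ _ / _; set w := _ ^- 2; move=> uv.
  have -> : u = v + w / 2 by rewrite -uv addrC subrK.
  by field.
have E : cosI n.+1.*2 = n.*2.+1%:R / n.*2.+2%:R * cosI n.*2.
  by rewrite doubleS -cosI_ratio mulfVK// gt_eqF.
have d : n.*2.+2%:R = 2 * n.+1%:R :> R by rewrite -doubleS -mul2n natrM.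
have n0 : n.+1%:R != 0 :> R by rewrite pnatr_eq0.
have n1 : n.*2.+1%:R != 0 :> R by rewrite pnatr_eq0.
have := cosJ_rec n; rewrite d in E; move: E n0 n1 I0 I2.
move: (n.+1%:R) (n.*2.+1%:R) (cosI n.*2) (cosI n.+1.*2) (cosJ n.*2) (cosJ n.+1.*2).
move=> a b I I' J J' E a0 b0 I0 I'0 JE.
have {}JE : J = (I' + 2 * a ^+ 2 * J') / (a * b).
  by rewrite JE; field; rewrite a0 b0.
have {}E : I = I' * (2 * a) / b by rewrite E; field; rewrite a0 b0.
by rewrite JE E; field; rewrite a0 b0 gt_eqF.
Qed.

(** Matsuoka's argument: the remainder cosJ / cosI in the telescoped sum is
    O(1/n), because cosI (n + 2) / cosI n tends to 1. *)
Lemma zeta2E : zeta2 = pi ^+ 2 / 6 :> R.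
Proof.
apply: cvg_lim => //; apply/cvgrPdist_le => e e0.
have h : (fun n => pi ^+ 2 / 4 * harmonic n) @ \oo --> (0 : R).
  by rewrite -[0](mulr0 (pi ^+ 2 / 4)); apply: cvgMr; exact: cvg_harmonic.
move/cvgrPdist_le : h => /(_ e e0); apply: filterS => n /=.
rewrite sub0r normrN ger0_norm; last by rewrite mulr_ge0// divr_ge0// sqr_ge0.
apply: le_trans; rewrite cosJ_telescope opprB addrCA subrr addr0.
have I0 := cosI_gt0 n.*2.
have /andP[J0 J1] := cosJ_bounds n.
rewrite ger0_norm; last by rewrite mulr_ge0// divr_ge0// ltW.
have : cosJ n.*2 / cosI n.*2 <= pi ^+ 2 / 4 * (1 - n.*2.+1%:R / n.*2.+2%:R).
  rewrite ler_pdivrMr// -cosI_ratio; move: J1 I0.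
  move: (cosI n.*2.+2) (cosI n.*2) (cosJ n.*2) (pi ^+ 2) => I' I J q J1 I0.
  suff -> : q / 4 * (1 - I' / I) * I = q / 4 * (I - I') by [].
  by field; rewrite gt_eqF.
rewrite -[n.*2.+2]addn1 natrD.
have d : n.*2.+1%:R = 2 * n.+1%:R - 1 :> R by rewrite -addn1 -mul2n natrD natrM -[n.+1]addn1 natrD; ring.
rewrite d subrK.
have n0 : n.+1%:R != 0 :> R by rewrite pnatr_eq0.
have -> : 1 - (2 * n.+1%:R - 1) / (2 * n.+1%:R) = (n.+1%:R)^-1 / 2 :> R by field.
by rewrite /harmonic/=; set a := pi ^+ 2 / 4; set b := _ / cosI _; set c := n.+1%:R^-1; lra.
Qed.

Definition wallis n : R :=
  \prod_(k < n) (1 + ((2 * k.+1%:R) ^+ 2 - 1)^-1).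

(** The partial product of Wallis is, up to the factor pi / 2, the quotient of
    two consecutive cosine integrals, which tends to 1. *)
Lemma wallisE n : cosI n.*2.+1 * (pi / 2) = wallis n * cosI n.*2.
Proof.
elim: n => [|n IH]; first by rewrite /wallis big_ord0 mul1r cosI1 cosI0 mul1r.
rewrite /wallis big_ord_recr /= -/(wallis n) doubleS.
have E m : cosI m.+2 = m.+1%:R / m.+2%:R * cosI m.
  by rewrite -cosI_ratio mulfVK// gt_eqF// cosI_gt0.
rewrite !E -[LHS]mulrA IH.
have d2 : n.*2.+2%:R = 2 * n.+1%:R :> R by rewrite -doubleS -mul2n natrM.
have d1 : n.*2.+1%:R = 2 * n.+1%:R - 1 :> R by rewrite -d2 -[n.*2.+2]addn1 natrD addrK.
have d3 : n.*2.+3%:R = 2 * n.+1%:R + 1 :> R by rewrite -d2 -[n.*2.+3]addn1 natrD.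
rewrite d1 d2 d3.
have n1 : 1 <= n.+1%:R :> R by rewrite ler1n.
set a : R := n.+1%:R in n1 *; field.
by rewrite !gt_eqF; nra.
Qed.

Lemma wallis_cvg : wallis n @[n --> \oo] --> (pi / 2 : R).
Proof.
apply: (@squeeze_cvgr _ _ _ _ (fun n => (1 - harmonic n) * (pi / 2)) (cst (pi / 2))); last 2 first.
- have : (1 - harmonic n) * (pi / 2) @[n --> \oo] --> (1 - 0) * (pi / 2 : R).
    by apply: cvgMl; apply: cvgB; [exact: cvg_cst|exact: cvg_harmonic].
  by rewrite subr0 mul1r.
- exact: cvg_cst.
apply: nearW => n; have I0 := cosI_gt0 n.*2.
have -> : wallis n = cosI n.*2.+1 / cosI n.*2 * (pi / 2).
  by rewrite mulrAC wallisE mulfK// gt_eqF.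
have p2 := ltW pih0.
rewrite ler_wpM2r//=; last first.
  rewrite (le_trans (y := cosI n.*2.+2 / cosI n.*2))//; last first.
    by rewrite ler_wpM2r ?cosI_nonincr// invr_ge0 ltW.
  rewrite cosI_ratio /harmonic /=.
  have d2 : n.*2.+2%:R = 2 * n.+1%:R :> R by rewrite -doubleS -mul2n natrM.
  have d1 : n.*2.+1%:R = 2 * n.+1%:R - 1 :> R by rewrite -d2 -[n.*2.+2]addn1 natrD addrK.
  have n0 : 0 < n.+1%:R :> R by [].
  rewrite d1 d2; move: n0; move: (n.+1%:R) => a a0.
  rewrite ler_pdivlMr ?mulr_gt0// mulrBl mul1r (mulrCA _ 2) mulVf ?gt_eqF//.
  lra.
by rewrite ler_piMl// ler_pdivrMr// mul1r cosI_nonincr.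
Qed.

End CosineIntegrals.

(** * The logarithm of the partition generating function near t = 0 *)

Section QWallis.
Context {R : realType}.
Implicit Types (x y t p e : R) (n k K : nat).

(** The logarithm of the product over k >= 1 of 1 / (1 - exp(- k t)). *)
Definition logP t : R := limn (series (fun k => bose0 (k.+1%:R * t))).

Lemma is_cvg_logP t : 0 < t -> cvgn (series (fun k => bose0 (k.+1%:R * t))).
Proof. exact: (bose0_lambert_crude.1). Qed.

(** Divided by 1 - p, the right side is the sum of the p^i with i <= 2k, which
    pair up around the middle one by the inequality 2 p^k <= p^i + p^(2k-i). *)
Lemma onem_exprn_ge p k : 0 <= p <= 1 ->
  (k.*2.+1)%:R * p ^+ k * (1 - p) <= 1 - p ^+ k.*2.+1.
Proof.
move=> /andP[p0 p1]; elim: k => [|k IH]; first by rewrite expr0 expr1 !mul1r.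
have d : k.+1.*2.+1%:R = k.*2.+1%:R + 2 :> R by rewrite doubleS -[k.*2.+3]addn2 natrD.
rewrite d doubleS.
have -> : 1 - p ^+ k.*2.+3 = (1 - p) * (1 + p ^+ k.*2.+2) + p * (1 - p ^+ k.*2.+1).
  by rewrite !exprS; ring.
have h : 2 * p ^+ k.+1 <= 1 + p ^+ k.*2.+2.
  rewrite -doubleS -muln2 exprM.
  have := sqr_ge0 (p ^+ k.+1 - 1); rewrite sqrrB1; lra.
have {}h : (1 - p) * (2 * p ^+ k.+1) <= (1 - p) * (1 + p ^+ k.*2.+2).
  by rewrite ler_wpM2l// subr_ge0.
have {}IH := ler_wpM2l p0 IH.
rewrite exprS in h *; lra.
Qed.

Lemma onem_exprn_le p k : 0 <= p <= 1 -> 1 - p ^+ k <= k%:R * (1 - p).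
Proof.
move=> /andP[p0 p1]; elim: k => [|k IH]; first by rewrite expr0 subrr mul0r.
have -> : 1 - p ^+ k.+1 = (1 - p ^+ k) + p ^+ k * (1 - p) by rewrite exprS; ring.
rewrite -[k.+1]addn1 natrD mulrDl lerD// ler_wpM2r ?subr_ge0//.
by rewrite exprn_ile1.
Qed.

(** With p = exp(- t), one plus this term is
    (1 - p^(2k+2))^2 / ((1 - p^(2k+1)) (1 - p^(2k+3))), the factor of the
    q-analogue of Wallis' product. *)
Definition qwallis_term t k : R :=
  expR (- t) ^+ k.*2.+1 * (1 - expR (- t)) ^+ 2 /
  ((1 - expR (- t) ^+ k.*2.+1) * (1 - expR (- t) ^+ k.*2.+3)).

Definition wallis_term k : R := ((2 * k.+1%:R) ^+ 2 - 1)^-1.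

Lemma wallis_termE k : wallis_term k = (k.*2.+1%:R * k.*2.+3%:R)^-1.
Proof.
have d : k.*2.+2%:R = 2 * k.+1%:R :> R by rewrite -doubleS -mul2n natrM.
rewrite /wallis_term -d -[k.*2.+3]addn1 -[k.*2.+2]addn1 !natrD; congr (_^-1).
by ring.
Qed.

Lemma wallis_term_ge0 k : 0 <= wallis_term k.
Proof. by rewrite wallis_termE invr_ge0. Qed.

Lemma qwallis_term_bounds t k : 0 < t ->
  expR (- t) ^+ k.*2.+1 * wallis_term k <= qwallis_term t k <= wallis_term k.
Proof.
move=> t0; rewrite wallis_termE /qwallis_term.
have /andP[p0 p1] := expRN_gt0_lt1 t0; set p := expR (- t) in p0 p1 *.
have pp : 0 <= p <= 1 by rewrite !ltW.
have f1 : 0 < 1 - p ^+ k.*2.+1 by rewrite subr_gt0 exprn_ilt1// ltW.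
have f3 : 0 < 1 - p ^+ k.*2.+3 by rewrite subr_gt0 exprn_ilt1// ltW.
have p10 : 0 < 1 - p by rewrite subr_gt0.
have a0 : 0 < k.*2.+1%:R :> R by []. 
have b0 : 0 < k.*2.+3%:R :> R by [].
apply/andP; split.
  rewrite -mulrA ler_wpM2l ?exprn_ge0 ?(ltW p0)//.
  rewrite ler_pdivlMr ?mulr_gt0// mulrC ler_pdivrMr ?mulr_gt0//.
  have h1 := onem_exprn_le k.*2.+1 pp; have h3 := onem_exprn_le k.*2.+3 pp.
  have := ler_pM (ltW f1) (ltW f3) h1 h3.
  by congr (_ <= _); ring.
rewrite ler_pdivrMr ?mulr_gt0// [leRHS]mulrC ler_pdivlMr ?mulr_gt0//.
have h1 := onem_exprn_ge k pp; have h3 := onem_exprn_ge k.+1 pp.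
rewrite doubleS in h3.
have g1 : 0 <= k.*2.+1%:R * p ^+ k * (1 - p).
  by rewrite !mulr_ge0 ?exprn_ge0// ltW.
have g3 : 0 <= k.*2.+3%:R * p ^+ k.+1 * (1 - p).
  by rewrite !mulr_ge0 ?exprn_ge0// ltW.
have := ler_pM g1 g3 h1 h3; congr (_ <= _).
by rewrite -addnn !exprS exprD; ring.
Qed.

Lemma bose0_qwallis t k : 0 < t ->
  bose0 (k.*2.+1%:R * t) + bose0 (k.*2.+3%:R * t) - 2 * bose0 (k.*2.+2%:R * t) =
  ln (1 + qwallis_term t k).
Proof.
move=> t0; rewrite /bose0 -!mulrN !expRM_natl /qwallis_term.
have /andP[p0 p1] := expRN_gt0_lt1 t0; set p := expR (- t) in p0 p1 *.
have f j : 0 < 1 - p ^+ j.+1 by rewrite subr_gt0 exprn_ilt1// ltW.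
have -> : 1 + p ^+ k.*2.+1 * (1 - p) ^+ 2 / ((1 - p ^+ k.*2.+1) * (1 - p ^+ k.*2.+3)) =
   (1 - p ^+ k.*2.+2) ^+ 2 / ((1 - p ^+ k.*2.+1) * (1 - p ^+ k.*2.+3)).
  have := f k.*2; have := f k.*2.+2.
  rewrite !exprS !expr0; move: (p ^+ k.*2) => y f3 f1.
  by field; rewrite !gt_eqF.
rewrite ln_div ?posrE ?exprn_gt0 ?mulr_gt0//.
rewrite lnXn// lnM ?posrE// -mulr_natl; ring.
Qed.

(** An even multiple of t has the coefficient 2 - 4 = -2, and an odd one the
    coefficient 2, shared by two consecutive q-Wallis factors except for the
    first and the last. *)
Lemma bose0_series_qwallis t K :  0 < t ->
  2 * series (fun k => bose0 (k.+1%:R * t)) K.*2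
  - 4 * series (fun k => bose0 (k.+1%:R * (2 * t))) K
  - bose0 t + bose0 (K.*2.+1%:R * t) =
  \sum_(k < K) ln (1 + qwallis_term t k).
Proof.
move=> t0; elim: K => [|K IH].
  by rewrite big_ord0 /series/= !big_geq// mul1r; ring.
rewrite big_ord_recr/= -IH -bose0_qwallis// doubleS !seriesSr.
have -> : K.+1%:R * (2 * t) = K.*2.+2%:R * t.
  by rewrite -doubleS -muln2 natrM mulrA.
ring.
Qed.

Lemma qwallis_prod_bounds t K : 0 < t ->
  ln (wallis K) - t * (K * K.*2.+1)%:R <= \sum_(k < K) ln (1 + qwallis_term t k)
    <= ln (wallis K).
Proof.
move=> t0.
have w0 k : 0 < 1 + wallis_term k by rewrite ltr_pwDl// wallis_term_ge0.
have -> : ln (wallis K) = \sum_(k < K) ln (1 + wallis_term k).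
  rewrite /wallis; elim: K => [|K IH]; first by rewrite !big_ord0 ln1.
  rewrite !big_ord_recr/= lnM ?posrE ?IH//; last exact: (w0 K).
  by apply: prodr_gt0 => i _; exact: (w0 i).
have -> : t * (K * K.*2.+1)%:R = \sum_(k < K) t * K.*2.+1%:R.
  by rewrite sumr_const card_ord -mulr_natl natrM; ring.
rewrite -sumrB; apply/andP; split; apply: ler_sum => k _.
  have /andP[h _] := qwallis_term_bounds k t0.
  have q0 : 0 < expR (- t) ^+ k.*2.+1 by rewrite exprn_gt0// expR_gt0.
  have q1 : expR (- t) ^+ k.*2.+1 <= 1.
    by rewrite exprn_ile1 ?expR_ge0// expR_le1 oppr_le0 ltW.
  apply: (@le_trans _ _ (ln (expR (- t) ^+ k.*2.+1 * (1 + wallis_term k)))).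
    have -> : ln (expR (- t) ^+ k.*2.+1 * (1 + wallis_term k)) =
              ln (1 + wallis_term k) - t * k.*2.+1%:R.
      by rewrite lnM ?posrE// lnXn ?expR_gt0// expRK -mulr_natl; ring.
    rewrite lerD2l lerN2 ler_pM2l// ler_nat; have := ltn_ord k; lia.
  rewrite ler_ln ?posrE ?mulr_gt0//; last first.
    rewrite ltr_pwDl//; apply: le_trans h.
    by rewrite mulr_ge0 ?wallis_term_ge0// ltW.
  by rewrite mulrDr mulr1 lerD.
have /andP[h0 h1] := qwallis_term_bounds k t0.
rewrite ler_ln ?posrE ?lerD2l//.
rewrite ltr_pwDl//; apply: le_trans h0.
by rewrite mulr_ge0 ?wallis_term_ge0// exprn_ge0// expR_ge0.
Qed.

Lemma qwallis_term_ge0 t k : 0 < t -> 0 <= qwallis_term t k.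
Proof.
move=> t0; have /andP[+ _] := qwallis_term_bounds k t0; apply: le_trans.
by rewrite mulr_ge0 ?wallis_term_ge0// exprn_ge0// expR_ge0.
Qed.

Lemma logP_qwallis t : 0 < t ->
  (fun K => \sum_(k < K) ln (1 + qwallis_term t k)) @ \oo -->
  2 * logP t - 4 * logP (2 * t) - bose0 t.
Proof.
move=> t0; rewrite (_ : (fun _ => _) = fun K =>
  2 * series (fun k => bose0 (k.+1%:R * t)) K.*2
  - 4 * series (fun k => bose0 (k.+1%:R * (2 * t))) K
  - bose0 t + bose0 (K.*2.+1%:R * t)); last first.
  by apply/funext => K; rewrite bose0_series_qwallis.
have dbl : (fun K => K.*2) @ \oo --> \oo.
  apply/cvgnyPge => n; near=> K.
  have : (n <= K)%N by near: K; exact: nbhs_infty_ge.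
  by move=> /leq_trans; apply; rewrite -addnn leq_addr.
have c1 := is_cvg_logP t0.
have c2 := is_cvg_logP (mulr_gt0 (ltr0Sn R 1) t0).
rewrite -[X in _ --> X]addr0; apply: cvgD; last first.
  have := cvg_series_cvg_0 c1 => h.
  exact: (cvg_comp _ (fun k => bose0 (k.+1%:R * t)) dbl h).
apply: cvgB; last exact: cvg_cst.
apply: cvgB; apply: cvgM; try exact: cvg_cst; last exact: c2.
exact: (cvg_comp _ (series (fun k => bose0 (k.+1%:R * t))) dbl c1).
Unshelve. all: by end_near. Qed.

End QWallis.

Section LogPAsymptotics.
Context {R : realType}.
Implicit Types (x y t p e s : R) (n k K j : nat).

(** The q-Wallis factors are at most the classical ones and tend to them as t
    tends to 0: the infinite product is at most pi / 2, and at least its K-th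
    partial product, which tends to the K-th Wallis product. *)
Lemma qwallis_limit :
  2 * logP t - 4 * logP (2 * t) - bose0 t @[t --> 0^'+] --> ln (pi / 2 : R).
Proof.
have p2 : 0 < pi / 2 :> R by rewrite divr_gt0// pi_gt0.
have wcvg : ln (wallis n) @[n --> \oo] --> ln (pi / 2 : R).
  by apply: continuous_cvg; [exact: continuous_ln|exact: wallis_cvg].
have wallis_gt0 K : 0 < wallis K :> R.
  by apply: prodr_gt0 => i _; rewrite ltr_pwDl// (wallis_term_ge0 i).
have wle K : ln (wallis K) <= ln (pi / 2) :> R.
  rewrite ler_ln ?posrE// -(cvg_lim _ wallis_cvg)//.
  apply: nondecreasing_cvgn_le; last by apply: cvgP; exact: wallis_cvg.
  apply/nondecreasing_seqP => n; rewrite /wallis big_ord_recr/=.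
  by rewrite ler_peMr ?lerDl ?(wallis_term_ge0 n)// ltW// (wallis_gt0 n).
apply/cvgrPdist_le => e e0; have e2 : 0 < e / 2 by rewrite divr_gt0.
have /cvgrPdist_le/(_ _ e2)[K _ /(_ K (leqnn _))/=] := wcvg.
rewrite ger0_norm ?subr_ge0// => hK.
pose c : R := (K * K.*2.+1)%:R.
have c1 : 0 < c + 1 by rewrite ltr_wpDl.
near=> t.
have t0 : 0 < t by near: t; exact: nbhs_right_gt.
have tc : t <= e / 2 / (c + 1).
  by near: t; apply: nbhs_right_le; rewrite divr_gt0.
have h := logP_qwallis t0.
set l := _ - bose0 t in h *.
have lu : l <= ln (pi / 2).
  rewrite -(cvg_lim _ h)//; apply: limr_le; first by apply: cvgP; exact: h.
  apply: nearW => n; have /andP[_ /le_trans] := qwallis_prod_bounds n t0.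
  by apply; exact: wle.
have ll : ln (wallis K) - t * c <= l.
  have /andP[+ _] := qwallis_prod_bounds K t0 => /le_trans; apply.
  rewrite -(cvg_lim _ h)//.
  apply: (@nondecreasing_cvgn_le _ (fun K => \sum_(k < K) ln (1 + qwallis_term t k))).
    apply/nondecreasing_seqP => n; rewrite big_ord_recr/= lerDl ln_ge0//.
    by rewrite lerDl qwallis_term_ge0.
  by apply: cvgP; exact: h.
rewrite ger0_norm ?subr_ge0//.
have : t * c <= e / 2.
  move: tc; rewrite ler_pdivlMr// => /(le_trans _); apply.
  by rewrite ler_pM2l// lerDl.
lra.
Unshelve. all: by end_near. Qed.

Lemma mul_ln_cvg0 : t * ln t @[t --> 0^'+] --> (0 : R).
Proof.
apply/cvgrPdist_le => e e0; near=> t.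
have t0 : 0 < t by near: t; exact: nbhs_right_gt.
have t1 : t < 1 by near: t; exact: nbhs_right_lt.
have te : t <= (e / 2) ^+ 2.
  by near: t; apply: nbhs_right_le; rewrite exprn_gt0// divr_gt0.
pose u := Num.sqrt t; have u0 : 0 < u by rewrite sqrtr_gt0.
have ut : t = u ^+ 2 by rewrite sqr_sqrtr// ltW.
have ue : u <= e / 2.
  by rewrite -(@ler_pXn2r _ 2) ?nnegrE ?(ltW u0) ?divr_ge0 ?(ltW e0)// -ut.
have := @ln_sublinear _ u^-1; rewrite invr_gt0 => /(_ u0).
rewrite lnV ?posrE// => h.
have ln0 : ln t <= 0 by rewrite ln_le0// ltW.
rewrite sub0r normrN ler0_norm; last by rewrite mulr_ge0_le0// ltW.
rewrite -mulrN ut lnXn// -mulr_natl.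
have : u ^+ 2 * - (2 * ln u) <= u ^+ 2 * (2 * u^-1).
  by rewrite ler_wpM2l ?sqr_ge0//; lra.
have -> : u ^+ 2 * (2 * u^-1) = 2 * u by field; rewrite gt_eqF.
lra.
Unshelve. all: by end_near. Qed.

Lemma bose0_ln_bounds t : 0 < t -> 0 <= bose0 t + ln t <= t.
Proof.
move=> t0; have p := onem_expRN_gt0 t0.
have -> : bose0 t + ln t = ln (t / (1 - expR (- t))).
  by rewrite ln_div ?posrE// /bose0 addrC.
apply/andP; split.
  by rewrite ln_ge0// ler_pdivlMr// mul1r onem_expRN_le.
rewrite -[leRHS]expRK ler_ln ?posrE ?divr_gt0 ?expR_gt0// ler_pdivrMr//.
by rewrite mulrBr mulr1 expRxMexpNx_1; have := expR_ge1Dx t; lra.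
Qed.

(** The constant ln (2 pi) / 2 is the one for which the doubling relation
    has no constant term in the limit. *)
Definition logP_rem t : R :=
  logP t - pi ^+ 2 / 6 / t - ln t / 2 + ln (2 * pi) / 2.

Lemma mul_logP_rem_cvg0 : t * logP_rem t @[t --> 0^'+] --> (0 : R).
Proof.
have h : t * logP t - pi ^+ 2 / 6 - t * ln t / 2 + t * (ln (2 * pi) / 2)
    @[t --> 0^'+] --> pi ^+ 2 / 6 - pi ^+ 2 / 6 - 0 / 2 + (0 : R) * (ln (2 * pi) / 2).
  apply: cvgD.
    apply: cvgB; last by apply: cvgMl; exact: mul_ln_cvg0.
    apply: cvgB; last exact: cvg_cst.
    by rewrite -zeta2E; exact: bose0_lambert_crude.2.
  by apply: cvgMl; apply: cvg_at_right_filter; exact: cvg_id.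
move: h; rewrite subrr sub0r !mul0r addr0 oppr0; apply: cvg_trans.
apply: near_eq_cvg; near=> t.
have t0 : 0 < t by near: t; exact: nbhs_right_gt.
rewrite /logP_rem; move: (@pi R) => q; field.
by rewrite gt_eqF.
Unshelve. all: by end_near. Qed.

(** The terms 1 / t cancel in 2 logP t - 4 logP (2 t), and the terms in ln t
    cancel against bose0 t = - ln t + o(1). *)
Lemma logP_rem_double e : 0 < e -> \forall t \near (0 : R)^'+,
  `|logP_rem t - 2 * logP_rem (2 * t)| <= e.
Proof.
move=> e0; have e1 : 0 < e by [].
have /cvgrPdist_le/(_ _ e1) := qwallis_limit; apply: filter_app; near=> t.
have t0 : 0 < t by near: t; exact: nbhs_right_gt.
have te : t <= e by near: t; exact: nbhs_right_le.
have /andP[b0 b1] := bose0_ln_bounds t0.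
have p0 := pi_gt0 R.
rewrite /logP_rem (lnM (x := 2) (y := t)) ?posrE//.
rewrite ln_div ?posrE// (lnM (x := 2) (y := pi)) ?posrE//.
have -> : pi ^+ 2 / 6 / (2 * t) = pi ^+ 2 / 6 / t / 2 :> R.
  by move: (@pi R) => q; field; rewrite gt_eqF.
move: (pi ^+ 2 / 6 / t) (ln pi) (ln 2) (ln t) (logP t) (logP (2 * t)) (bose0 t) b0 b1.
move=> a b c d f g h h0 h1; rewrite !ler_norml => /andP[u v].
by apply/andP; split; lra.
Unshelve. all: by end_near. Qed.

(** The doubling relation determines the remainder: its value at t is, up to a
    small error, 2^(-j) times its value at t / 2^j, and this tends to 0 as j
    grows by the a priori bound o(1/t). *)
Lemma logP_rem_cvg0 : logP_rem t @[t --> 0^'+] --> (0 : R).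
Proof.
apply/cvgrPdist_le => e e0.
have [r /= r0 rP] := logP_rem_double e0.
have {}rP t : 0 < t -> t < r -> `|logP_rem t - 2 * logP_rem (2 * t)| <= e.
  by move=> t0 tr; apply: rP => //=; rewrite sub0r normrN gtr0_norm.
near=> t.
have t0 : 0 < t by near: t; exact: nbhs_right_gt.
have tr : t < r by near: t; exact: nbhs_right_lt.
have it j : `|logP_rem t| <= `|logP_rem (t / 2 ^+ j)| / 2 ^+ j + e * (1 - (2 ^+ j)^-1).
  elim: j => [|j IH]; first by rewrite expr0 invr1 !mulr1 subrr mulr0 addr0.
  apply: (le_trans IH).
  have p2 : 0 < 2 ^+ j :> R by rewrite exprn_gt0.
  pose s := t / 2 ^+ j.+1.
  have s0 : 0 < s by rewrite divr_gt0// exprn_gt0.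
  have sr : s < r.
    apply: le_lt_trans tr; rewrite ler_pdivrMr ?exprn_gt0// ler_peMr ?(ltW t0)//.
    by rewrite exprn_ege1// ler1n.
  have st : t / 2 ^+ j = 2 * s by rewrite /s exprS; field; rewrite gt_eqF.
  have := rP s s0 sr; rewrite -st -/s => h.
  have {}h : `|logP_rem (t / 2 ^+ j)| * 2 <= `|logP_rem s| + e.
    have := ler_normB (logP_rem s) (logP_rem s - 2 * logP_rem (t / 2 ^+ j)).
    rewrite opprB addrC subrK normrM (ger0_norm (x := 2))//; lra.
  have {}h : `|logP_rem (t / 2 ^+ j)| / 2 ^+ j <= (`|logP_rem s| + e) / 2 / 2 ^+ j.
    by rewrite ler_pM2r ?invr_gt0//; lra.
  rewrite -/s exprS invfM; move: h; move: (2 ^+ j)^-1 => z; lra.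
have h : `|logP_rem (t / 2 ^+ j)| / 2 ^+ j @[j --> \oo] --> 0.
  have lim : (fun j => t / 2 ^+ j) @ \oo --> (0 : R).
    have : (fun j => t * (2^-1) ^+ j) @ \oo --> (t * 0).
      by apply: cvgMr; apply: cvg_expr; rewrite ger0_norm// invf_lt1// ltr1n.
    by rewrite mulr0; under eq_fun do rewrite exprVn.
  have pos j : 0 < t / 2 ^+ j by rewrite divr_gt0// exprn_gt0.
  have /cvg_at_rightP/(_ (fun j => t / 2 ^+ j) (conj pos lim)) := mul_logP_rem_cvg0.
  move=> /cvg_norm; rewrite normr0 => H.
  have : `|t / 2 ^+ j * logP_rem (t / 2 ^+ j)| / t @[j --> \oo] --> 0 / t.
    by apply: cvgMl; exact: H.
  rewrite mul0r; under eq_fun => j.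
    rewrite normrM (gtr0_norm (pos j)) (_ : _ / t = `|logP_rem (t / 2 ^+ j)| / 2 ^+ j).
      over.
    by field; rewrite !gt_eqF// exprn_gt0.
  by [].
rewrite sub0r normrN -subr_le0 -(cvg_lim _ h)//.
apply: limr_ge; first by apply: cvgP; exact: h.
apply: nearW => j; rewrite lerBlDr (le_trans (it j))// lerD2l.
by rewrite ler_piMr ?(ltW e0)// gerBl invr_ge0 exprn_ge0.
Unshelve. all: by end_near. Qed.

End LogPAsymptotics.

(** * Mean and variance of the random partition *)

Section CumulantAsymptotics.
Context {R : realType}.
Implicit Types (x y t d e s h : R) (n k K j : nat).

Definition meanP t : R := lambert 1 bose1 t.
Definition varP t : R := lambert 2 bose2 t.

Lemma lambert_bose :
  [/\ forall t, 0 < t -> cvgn (series (fun k => k.+1%:R ^+ 1 * bose1 (k.+1%:R * t))),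
      forall t, 0 < t -> cvgn (series (fun k => k.+1%:R ^+ 2 * bose2 (k.+1%:R * t))),
      slope (@logP R) meanP & slope meanP varP].
Proof.
have E t : (fun k : nat => k.+1%:R ^+ 0 * bose0 (k.+1%:R * t)) =
    (fun k => bose0 (k.+1%:R * t)).
  by apply/funext => k; rewrite expr0 mul1r.
have [|c1 s1] := @slope_lambert R 0 _ _ slope_bose0 (@bose0_ge0 R) (@bose1_ge0 R).
  by move=> t t0; rewrite E; exact: is_cvg_logP.
have [c2 s2] := @slope_lambert R 1 _ _ slope_bose1 (@bose1_ge0 R) (fun x _ => bose2_ge0 x) c1.
split=> //.
have -> // : @logP R = lambert 0 bose0 by apply/funext => t; rewrite /lambert E.
Qed.

Let slope_inv1 c : 0 <= c -> slope (fun x => c / x) (fun x => c / x ^+ 2).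
Proof.
move=> c0; apply: slope_derive => [x x0|x y x0 xy].
  have xn0 : x != 0 by rewrite gt_eqF.
  have D := isdM (isdC c x) (@isdV _ (fun y => y) x 1 xn0 (isdI x)).
  by apply: (@is_derive_eq _ _ _ _ _ _ _ _ D); ring.
have y0 := lt_le_trans x0 xy.
rewrite ler_wpM2l// lef_pV2 ?posrE ?exprn_gt0//.
by rewrite lerXn2r// nnegrE ltW.
Qed.

Let slope_inv2 c : 0 <= c -> slope (fun x => c / x ^+ 2) (fun x => 2 * c / x ^+ 3).
Proof.
move=> c0; apply: slope_derive => [x x0|x y x0 xy].
  have xn0 : x ^+ 2 != 0 by rewrite gt_eqF// exprn_gt0.
  have D := isdM (isdC c x) (@isdV _ (fun y => y ^+ 2) x _ xn0 (isdX 2 (isdI x))).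
  by apply: (@is_derive_eq _ _ _ _ _ _ _ _ D) => /=; field; rewrite gt_eqF.
have y0 := lt_le_trans x0 xy.
rewrite ler_wpM2l ?mulr_ge0// lef_pV2 ?posrE ?exprn_gt0//.
by rewrite lerXn2r// nnegrE ltW.
Qed.

Let cvg0_comp (g s : R -> R) : g t @[t --> 0^'+] --> 0 ->
  (forall t, 0 < t < 1 -> 0 < s t <= 2 * t) -> g (s t) @[t --> 0^'+] --> 0.
Proof.
move=> g0 sP; apply/cvgrPdist_le => e e0.
have /cvgrPdist_le/(_ _ e0)[r /= r0 rP] := g0.
near=> t.
have t0 : 0 < t by near: t; exact: nbhs_right_gt.
have t1 : t < 1 by near: t; exact: nbhs_right_lt.
have tr : t < r / 2 by near: t; apply: nbhs_right_lt; rewrite divr_gt0.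
have /andP[s0 s2] : 0 < s t <= 2 * t by rewrite sP// t0.
apply: rP => //=; rewrite sub0r normrN gtr0_norm//; lra.
Unshelve. all: by end_near. Qed.

Let ln_diff x y : 0 < x -> x <= y -> 0 <= ln y - ln x <= (y - x) / x.
Proof.
move=> x0 xy; have y0 := lt_le_trans x0 xy.
rewrite subr_ge0 ler_ln ?posrE// xy -ln_div ?posrE//=.
have -> : y / x = 1 + (y - x) / x by field; rewrite gt_eqF.
apply: le_ln1Dx; have : 0 <= (y - x) / x by rewrite divr_ge0 ?subr_ge0// ltW.
lra.
Qed.

Let sqrt_cvg0 : Num.sqrt t @[t --> 0^'+] --> (0 : R).
Proof.
apply/cvgrPdist_le => e e0; near=> t.
have t0 : 0 < t by near: t; exact: nbhs_right_gt.
have te : t <= e ^+ 2 by near: t; apply: nbhs_right_le; rewrite exprn_gt0.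
rewrite sub0r normrN ger0_norm ?sqrtr_ge0//.
by rewrite -(@ler_pXn2r _ 2) ?nnegrE ?sqrtr_ge0 ?(ltW e0)// sqr_sqrtr// ltW.
Unshelve. all: by end_near. Qed.

Local Notation z := (pi ^+ 2 / 6 : R).

Let z0 : 0 <= z. Proof. by rewrite divr_ge0// sqr_ge0. Qed.

(** Since logP is known up to o(1), difference quotients over a window of width
    h t^(3/2) determine its slope up to o(t^(-3/2)). This precision is needed
    because the standard deviation of the random partition is of that order. *)
Lemma meanP_asymp : t * Num.sqrt t * (meanP t - z / t ^+ 2) @[t --> 0^'+] --> 0.
Proof.
have [_ _ sL _] := lambert_bose.
have ww t : 0 < t < 1 -> 0 < t * Num.sqrt t <= t.
  move=> /andP[t0 t1]; have s0 : 0 < Num.sqrt t by rewrite sqrtr_gt0.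
  rewrite mulr_gt0//= ler_piMr ?(ltW t0)//.
  by rewrite -(sqrtr1 R) ler_sqrt// ltW.
have wh h t : 0 < h <= 1 / 2 -> 0 < t < 1 -> 0 < h * (t * Num.sqrt t) <= t / 2.
  move=> /andP[h0 h2] /[dup] tt /ww/andP[w0 w1].
  by rewrite mulr_gt0//= (_ : t / 2 = 1 / 2 * t)// ?ler_pM// ?ltW//; field.
have dln h t : 0 < h <= 1 / 2 -> 0 < t < 1 ->
    `|ln (t - h * (t * Num.sqrt t)) - ln t| <= 2 * Num.sqrt t /\
    `|ln t - ln (t + h * (t * Num.sqrt t))| <= 2 * Num.sqrt t.
  move=> hh tt; have /andP[d0 d2] := wh h t hh tt; have /andP[t0 t1] := tt.
  have s0 : 0 <= Num.sqrt t by exact: sqrtr_ge0.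
  have dt : h * (t * Num.sqrt t) <= t * Num.sqrt t.
    by rewrite ler_piMl ?mulr_ge0// ?(ltW t0)//; case/andP: hh; lra.
  move: d0 d2 dt; set d := h * _ => d0 d2 dt.
  have td : 0 < t - d by lra.
  have tdt : t - d <= t by lra.
  have ttd : t <= t + d by lra.
  have /andP[a1 a2] := ln_diff td tdt; have /andP[b1 b2] := ln_diff t0 ttd.
  split; rewrite distrC ger0_norm//.
    apply: (le_trans a2); rewrite ler_pdivrMr//.
    have -> : t - (t - d) = d by ring.
    apply: (le_trans dt); rewrite -mulrA mulrCA [t * _]mulrC ler_wpM2l//; lra.
  apply: (le_trans b2); rewrite addrAC subrr add0r ler_pdivrMr//.
  apply: (le_trans dt); rewrite mulrAC -mulrA ler_peMl// ?ler1n//.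
  by rewrite mulr_ge0 ?(ltW t0).
have L0 : (2 * Num.sqrt t) / 2 @[t --> 0^'+] --> (0 : R).
  have : (2 * Num.sqrt t) / 2 @[t --> 0^'+] --> ((2 * 0) / 2 : R).
    by apply: cvgMl; apply: cvgMr; exact: sqrt_cvg0.
  by rewrite mulr0 mul0r.
have Ediff (a b : R -> R) : (forall t, 0 < t < 1 -> 0 < a t <= 2 * t) ->
   (forall t, 0 < t < 1 -> 0 < b t <= 2 * t) ->
   (forall t, 0 < t < 1 -> `|ln (a t) - ln (b t)| <= 2 * Num.sqrt t) ->
   1 * ((logP (a t) - z / a t) - (logP (b t) - z / b t)) @[t --> 0^'+] --> 0.
  move=> ha hb hl.
  have E : (logP_rem (a t) - logP_rem (b t)) + (ln (a t) - ln (b t)) / 2 @[t --> 0^'+] --> ((0 - 0) + 0 : R).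
    apply: cvgD; first by apply: cvgB; apply: cvg0_comp => //; exact: logP_rem_cvg0.
    apply: norm_cvg0; apply: (squeeze_cvgr _ (cvg_cst 0) L0); near=> t.
    have t0 : 0 < t by near: t; exact: nbhs_right_gt.
    have t1 : t < 1 by near: t; exact: nbhs_right_lt.
    rewrite normr_ge0/= normrM (ger0_norm (x := 2^-1))// ler_pM2r//.
    by apply: hl; rewrite t0.
  move: E; rewrite subrr addr0; apply: cvg_trans; apply: near_eq_cvg.
  apply: nearW => t; rewrite /logP_rem.
  by move: (pi ^+ 2 / 6 / a t) (pi ^+ 2 / 6 / b t) => u v; field.
have := @slope_transfer R (@logP R) meanP (fun t => z / t) (fun t => z / t ^+ 2)
  (fun=> 1) (fun t => t * Num.sqrt t) (8 * z).
move=> /(_ _ sL) H.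
suff : 1 * (t * Num.sqrt t) * (meanP t - z / t ^+ 2) @[t --> 0^'+] --> 0.
  by under eq_fun do rewrite mul1r.
apply: H => //.
- by rewrite mulr_ge0.
- exact: slope_inv1.
- move=> h hh; apply: Ediff.
  + by move=> t tt; have := wh h t hh tt; case/andP: tt; lra.
  + by move=> t /andP[]; lra.
  + by move=> t tt; have [] := dln h t hh tt.
- move=> h hh; apply: Ediff.
  + by move=> t /andP[]; lra.
  + by move=> t tt; have := wh h t hh tt; case/andP: tt; lra.
  + by move=> t tt; have [] := dln h t hh tt.
- move=> h t hh tt; have /andP[d0 d2] := wh h t hh tt; have /andP[t0 t1] := tt.
  have /andP[w0 w1] := ww t tt.
  have w2 : (t * Num.sqrt t) ^+ 2 = t ^+ 3 by rewrite exprMn sqr_sqrtr ?(ltW t0)// -exprSr.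
  move: w0 w1 w2 d0 d2; set w := t * Num.sqrt t => w0 w1 w2 d0 d2.
  rewrite mul1r; set d := h * w in d0 d2 *.
  have td : 0 < t - d by lra.
  have td' : 0 < t + d by lra.
  have wd : w * d = h * t ^+ 3 by rewrite -w2 /d; ring.
  have h0 : 0 <= h by case/andP: hh => /ltW.
  have zh : 0 <= z * h * t ^+ 2 by apply: mulr_ge0; [exact: mulr_ge0|exact: sqr_ge0].
  split.
    have -> : w * (z / (t - d) ^+ 2 - z / t ^+ 2) =
        z * (w * d) * (2 * t - d) / (t ^+ 2 * (t - d) ^+ 2).
      by move: (pi ^+ 2) => q; field; rewrite !gt_eqF.
    rewrite wd ler_pdivrMr ?mulr_gt0 ?exprn_gt0//.
    have -> : z * (h * t ^+ 3) * (2 * t - d) = z * h * t ^+ 2 * (t * (2 * t - d)) by ring.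
    have -> : 8 * z * h * (t ^+ 2 * (t - d) ^+ 2) = z * h * t ^+ 2 * (8 * (t - d) ^+ 2) by ring.
    rewrite ler_wpM2l//.
    have q1 : 0 <= t * d by rewrite mulr_ge0 ?(ltW t0) ?(ltW d0).
    have q2 : (t / 2) * (t / 2) <= (t - d) * (t - d).
      by rewrite ler_pM ?divr_ge0 ?(ltW t0)//; lra.
    by rewrite expr2; lra.
  have -> : w * (z / t ^+ 2 - z / (t + d) ^+ 2) =
      z * (w * d) * (2 * t + d) / (t ^+ 2 * (t + d) ^+ 2).
    by move: (pi ^+ 2) => q; field; rewrite !gt_eqF.
  rewrite wd ler_pdivrMr ?mulr_gt0 ?exprn_gt0//.
  have -> : z * (h * t ^+ 3) * (2 * t + d) = z * h * t ^+ 2 * (t * (2 * t + d)) by ring.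
  have -> : 8 * z * h * (t ^+ 2 * (t + d) ^+ 2) = z * h * t ^+ 2 * (8 * (t + d) ^+ 2) by ring.
  rewrite ler_wpM2l//.
  have q1 : 0 <= t * d by rewrite mulr_ge0 ?(ltW t0) ?(ltW d0).
  have q2 : 0 <= t * t by rewrite mulr_ge0 ?(ltW t0).
  have q3 : 0 <= d * d by rewrite mulr_ge0 ?(ltW d0).
  by rewrite expr2; lra.
Unshelve. all: by end_near. Qed.

Lemma meanP_asymp_sqr : t ^+ 2 * (meanP t - z / t ^+ 2) @[t --> 0^'+] --> 0.
Proof.
have : Num.sqrt t * (t * Num.sqrt t * (meanP t - z / t ^+ 2)) @[t --> 0^'+] --> (0 * 0 : R).
  by apply: cvgM; [exact: sqrt_cvg0|exact: meanP_asymp].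
rewrite mulr0; apply: cvg_trans; apply: near_eq_cvg; near=> t.
have t0 : 0 < t by near: t; exact: nbhs_right_gt.
have {2}-> : t = Num.sqrt t ^+ 2 by rewrite sqr_sqrtr// ltW.
by rewrite mulrA; congr (_ * _); rewrite -[in RHS](@sqr_sqrtr _ t) ?(ltW t0)//; ring.
Unshelve. all: by end_near. Qed.

(** The same transfer from the mean, known up to o(1/t^2), with windows of width
    h t. *)
Lemma varP_asymp : t ^+ 3 * varP t @[t --> 0^'+] --> (pi ^+ 2 / 3 : R).
Proof.
have [_ _ _ sV] := lambert_bose.
have sE (a : R) (s : R -> R) : (forall t, 0 < t < 1 -> s t = a * t) -> 1 / 2 <= a <= 2 ->
    t ^+ 2 * (meanP (s t) - z / s t ^+ 2) @[t --> 0^'+] --> 0.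
  move=> sa /andP[a1 a2]; have a0 : 0 < a by lra.
  have H : a ^- 2 * ((a * t) ^+ 2 * (meanP (a * t) - z / (a * t) ^+ 2)) @[t --> 0^'+] --> a ^- 2 * 0.
    apply: cvgMr; apply: (cvg0_comp (g := fun t => t ^+ 2 * (meanP t - z / t ^+ 2))).
      exact: meanP_asymp_sqr.
    by move=> t /andP[t0 t1]; rewrite mulr_gt0//= ler_pM2r.
  move: H; rewrite mulr0; apply: cvg_trans; apply: near_eq_cvg; near=> t.
  have t0 : 0 < t by near: t; exact: nbhs_right_gt.
  have t1 : t < 1 by near: t; exact: nbhs_right_lt.
  rewrite sa ?t0//; move: (meanP _) (pi ^+ 2) => u v; field.
  by rewrite !gt_eqF.
have S : t ^+ 2 * t * (varP t - 2 * z / t ^+ 3) @[t --> 0^'+] --> 0.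
  apply: (@slope_transfer R meanP varP (fun t => z / t ^+ 2) (fun t => 2 * z / t ^+ 3)
    (fun t => t ^+ 2) id (48 * z)) => //.
  - by rewrite mulr_ge0.
  - exact: slope_inv2.
  - by move=> t /andP[-> _]/=.
  - by move=> t t0; rewrite exprn_gt0.
  - move=> h /andP[h0 h2]; under eq_fun do rewrite mulrBr.
    rewrite -[X in nbhs X](subrr 0); apply: cvgB.
      by apply: (sE (1 - h)) => [t _|]; [rewrite mulrBl mul1r|lra].
    by apply: (sE 1) => [t _|]; [rewrite mul1r|lra].
  - move=> h /andP[h0 h2]; under eq_fun do rewrite mulrBr.
    rewrite -[X in nbhs X](subrr 0); apply: cvgB.
      by apply: (sE 1) => [t _|]; [rewrite mul1r|lra].
    by apply: (sE (1 + h)) => [t _|]; [rewrite mulrDl mul1r|lra].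
  - move=> h t /andP[h0 h2] /andP[t0 t1]; rewrite -exprSr.
    have a0 : 0 < 1 - h by lra.
    have b0 : 0 < 1 + h by lra.
    have -> : t - h * t = (1 - h) * t by ring.
    have -> : t + h * t = (1 + h) * t by ring.
    have -> : t ^+ 3 * (2 * z / ((1 - h) * t) ^+ 3 - 2 * z / t ^+ 3) =
        2 * z * (h * (3 - 3 * h + h ^+ 2)) / (1 - h) ^+ 3.
      by move: (pi ^+ 2) => q; field; rewrite !gt_eqF.
    have -> : t ^+ 3 * (2 * z / t ^+ 3 - 2 * z / ((1 + h) * t) ^+ 3) =
        2 * z * (h * (3 + 3 * h + h ^+ 2)) / (1 + h) ^+ 3.
      by move: (pi ^+ 2) => q; field; rewrite !gt_eqF.
    rewrite !ler_pdivrMr ?exprn_gt0//.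
    have E u v : 2 * z * (h * u) <= 48 * z * h * v = (2 * z * h * u <= 2 * z * h * (24 * v)).
      by congr (_ <= _); ring.
    have zh : 0 <= 2 * z * h by apply: mulr_ge0; [exact: mulr_ge0|exact: ltW].
    have q1 : 1 / 4 <= (1 - h) ^+ 2 by nra.
    have q2 : 1 <= (1 + h) ^+ 2 by nra.
    rewrite !E; split; rewrite ler_wpM2l// exprS; nra.
have : t ^+ 2 * t * (varP t - 2 * z / t ^+ 3) + pi ^+ 2 / 3 @[t --> 0^'+] --> (0 + pi ^+ 2 / 3 : R).
  by apply: cvgD => //; exact: cvg_cst.
rewrite add0r; apply: cvg_trans; apply: near_eq_cvg; near=> t.
have t0 : 0 < t by near: t; exact: nbhs_right_gt.
by move: (pi ^+ 2) => q; field; rewrite gt_eqF.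
Unshelve. all: by end_near. Qed.

End CumulantAsymptotics.

(** * Characteristic functions of geometric laws *)

Section GeometricCharacteristicFunction.
Context {R : realType}.
Implicit Types (a b q x t m : R) (n k K j : nat).
Notation mu := (@lebesgue_measure R).

(** The number (1 - q) / (1 - q e^(ia)), the characteristic function of a
    geometric law, in polar form: modulus (1 + geo_dev q a)^(-1/2), argument
    geo_arg q a. *)
Definition geo_dev q a : R := 2 * q * (1 - cos a) / (1 - q) ^+ 2.
Definition geo_mod q a : R := (Num.sqrt (1 + geo_dev q a))^-1.
Definition geo_arg q a : R := atan (q * sin a / (1 - q * cos a)).

Lemma geo_dev_ge0 q a : 0 <= q -> 0 <= geo_dev q a.
Proof.
by move=> q0; rewrite /geo_dev divr_ge0 ?sqr_ge0// !mulr_ge0// subr_ge0 cos_le1.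
Qed.

Lemma geo_mod_ge0 q a : 0 <= geo_mod q a.
Proof. by rewrite invr_ge0 sqrtr_ge0. Qed.

Lemma geo_mod_le1 q a : 0 <= q -> geo_mod q a <= 1.
Proof.
move=> q0; rewrite /geo_mod invf_le1; last first.
  by rewrite sqrtr_gt0 ltr_wpDr// geo_dev_ge0.
by rewrite -[leLHS]sqrtr1 ler_wsqrtr// lerDl geo_dev_ge0.
Qed.

Let den_gt0 q a : 0 <= q < 1 -> 0 < 1 - q * cos a.
Proof.
move=> /andP[q0 q1]; rewrite subr_gt0; apply: le_lt_trans q1.
by rewrite ler_piMr// cos_le1.
Qed.

Lemma geo_polar q a : 0 <= q < 1 ->
  geo_mod q a * cos (geo_arg q a) =
    (1 - q) * (1 - q * cos a) / ((1 - q * cos a) ^+ 2 + (q * sin a) ^+ 2) /\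
  geo_mod q a * sin (geo_arg q a) =
    (1 - q) * (q * sin a) / ((1 - q * cos a) ^+ 2 + (q * sin a) ^+ 2).
Proof.
move=> qq; have c0 := den_gt0 a qq; have /andP[q0 q1] := qq.
set c := 1 - _ in c0 *; set s := q * sin a.
have q10 : 0 < 1 - q by rewrite subr_gt0.
have D0 : 0 < c ^+ 2 + s ^+ 2 by rewrite ltr_wpDr ?sqr_ge0// exprn_gt0.
have E1 : 1 + geo_dev q a = (c ^+ 2 + s ^+ 2) / (1 - q) ^+ 2.
  have := cos2Dsin2 a; rewrite /geo_dev /c /s => H.
  have -> : (1 - q * cos a) ^+ 2 + (q * sin a) ^+ 2 =
     1 - 2 * q * cos a + q ^+ 2 * (cos a ^+ 2 + sin a ^+ 2) by ring.
  by rewrite H; field; rewrite gt_eqF.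
have A : tan (geo_arg q a) = s / c by rewrite atanK.
have C : cos (geo_arg q a) = (Num.sqrt (1 + (s / c) ^+ 2))^-1 by rewrite cos_atan.
have M : geo_mod q a * cos (geo_arg q a) = (1 - q) * c / (c ^+ 2 + s ^+ 2).
  rewrite C /geo_mod E1 -invfM -sqrtrM; last by rewrite divr_ge0 ?sqr_ge0// ltW.
  have -> : (c ^+ 2 + s ^+ 2) / (1 - q) ^+ 2 * (1 + (s / c) ^+ 2) =
     ((c ^+ 2 + s ^+ 2) / ((1 - q) * c)) ^+ 2.
    by field; rewrite !gt_eqF.
  rewrite sqrtr_sqr gtr0_norm; last by rewrite divr_gt0// mulr_gt0.
  by rewrite invf_div.
split=> //.
have cn0 : cos (geo_arg q a) != 0.
  by rewrite C invr_eq0 gt_eqF// sqrtr_gt0 ltr_wpDr// sqr_ge0.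
have -> : sin (geo_arg q a) = s / c * cos (geo_arg q a).
  by rewrite -A /tan mulfVK.
rewrite mulrCA M; field.
by rewrite !gt_eqF.
Qed.

(** The real part of e^(ib) times the identity z (1 - q e^(ia)) = 1 - q, for z
    the characteristic function. *)
Lemma geo_rec q a b : 0 <= q < 1 ->
  geo_mod q a * (cos (geo_arg q a + b) - q * cos (geo_arg q a + b + a)) =
  (1 - q) * cos b.
Proof.
move=> qq; have [P1 P2] := geo_polar a qq.
have c0 := den_gt0 a qq.
have -> : geo_mod q a * (cos (geo_arg q a + b) - q * cos (geo_arg q a + b + a)) =
  (geo_mod q a * cos (geo_arg q a)) * (cos b - q * cos (b + a)) -
  (geo_mod q a * sin (geo_arg q a)) * (sin b - q * sin (b + a)).
  by rewrite -addrA !cosD !sinD; ring.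
rewrite P1 P2 cosD sinD; field.
by rewrite gt_eqF// ltr_wpDr ?sqr_ge0// exprn_gt0.
Qed.

Lemma continuous_geo_mod q (c : R) : 0 <= q ->
  continuous (fun x => geo_mod q (c * x)).
Proof.
move=> q0 x; apply: cvgV.
  by rewrite gt_eqF// sqrtr_gt0 ltr_wpDr// geo_dev_ge0.
apply: (@continuous_cvg _ _ _ _ _ _ Num.sqrt); first exact: sqrt_continuous.
rewrite /geo_dev; apply: cvgD; first exact: cvg_cst.
apply: cvgMl; apply: cvgMr; apply: cvgB; first exact: cvg_cst.
apply: (@continuous_cvg _ _ _ _ _ _ cos); first exact: continuous_cos.
by apply: cvgMr; exact: cvg_id.
Qed.

Lemma continuous_geo_arg q (c : R) : 0 <= q < 1 ->
  continuous (fun x => geo_arg q (c * x)).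
Proof.
move=> qq x; apply: (@continuous_cvg _ _ _ _ _ _ atan); first exact: continuous_atan.
have cx : c * y @[y --> x] --> c * x by apply: cvgMr; exact: cvg_id.
apply: cvgM.
  by apply: cvgMr; apply: (@continuous_cvg _ _ _ _ _ _ sin) => //; exact: continuous_sin.
apply: cvgV; first by rewrite gt_eqF// den_gt0.
apply: cvgB; first exact: cvg_cst.
by apply: cvgMr; apply: (@continuous_cvg _ _ _ _ _ _ cos) => //; exact: continuous_cos.
Qed.

End GeometricCharacteristicFunction.

(** * Fourier inversion *)

Section FourierInversion.
Context {R : realType}.
Implicit Types (a b q x t m : R) (n k K j : nat).
Notation mu := (@lebesgue_measure R).
Variable t : R.
Hypothesis t0 : 0 < t.

Definition weight k : R := expR (- (k.+1%:R * t)).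

(** Modulus, argument and, after multiplication by e^(- i m x), real part of the
    characteristic function of the sum of the k G_k over k <= K, where the G_k
    are independent and geometric of ratio exp(- k t). *)
Definition charfun_mod K x : R := \prod_(k < K) geo_mod (weight k) (k.+1%:R * x).
Definition charfun_arg K x : R := \sum_(k < K) geo_arg (weight k) (k.+1%:R * x).
Definition charfun_re K m x : R := charfun_mod K x * cos (charfun_arg K x - m * x).

Let w01 k : 0 <= weight k < 1.
Proof. by rewrite expR_ge0/= expR_lt1 oppr_lt0 mulr_gt0. Qed.

Let w0 k : 0 <= weight k. Proof. by case/andP: (w01 k). Qed.

Lemma charfun_mod_ge0 K x : 0 <= charfun_mod K x.
Proof. by apply: prodr_ge0 => k _; exact: geo_mod_ge0. Qed.

Lemma charfun_mod_le1 K x : charfun_mod K x <= 1.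
Proof.
rewrite /charfun_mod; elim: K => [|K IH]; first by rewrite big_ord0.
by rewrite big_ord_recr/= mulr_ile1 ?geo_mod_ge0 ?geo_mod_le1// charfun_mod_ge0.
Qed.

Lemma norm_charfun_re_le K m x : `|charfun_re K m x| <= charfun_mod K x.
Proof.
rewrite normrM ger0_norm ?charfun_mod_ge0// ler_piMr ?charfun_mod_ge0//.
exact: cos_max.
Qed.

(** Multiplication by 1 - weight * e^(i (K + 1) x) removes the part K + 1; the
    factor e^(i (K + 1) x) shifts m. *)
Lemma charfun_rec K m x :
  charfun_re K.+1 m x - weight K * charfun_re K.+1 (m - K.+1%:R) x =
  (1 - weight K) * charfun_re K m x.
Proof.
rewrite /charfun_re /charfun_mod /charfun_arg !big_ord_recr/=.
set M := \prod_(_ < _) _; set S := \sum_(_ < _) _.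
have := geo_rec (K.+1%:R * x) (S - m * x) (w01 K).
set g := geo_arg _ _; set r := geo_mod _ _ => H.
have -> : S + g - m * x = g + (S - m * x) by ring.
have -> : S + g - (m - K.+1%:R) * x = g + (S - m * x) + K.+1%:R * x by ring.
rewrite [RHS]mulrCA -H; ring.
Qed.

Lemma continuous_charfun_re K m : continuous (charfun_re K m).
Proof.
have cM : continuous (charfun_mod K).
  elim: K => [|K IH] x.
    rewrite (_ : charfun_mod 0 = cst 1); first exact: cvg_cst.
    by apply/funext => y; rewrite /charfun_mod big_ord0.
  rewrite (_ : charfun_mod K.+1 = fun y => charfun_mod K y * geo_mod (weight K) (K.+1%:R * y)).
    by apply: cvgM; [exact: IH|exact: continuous_geo_mod].
  by apply/funext => y; rewrite /charfun_mod big_ord_recr.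
have cA : continuous (charfun_arg K).
  elim: K {cM} => [|K IH] x.
    rewrite (_ : charfun_arg 0 = cst 0); first exact: cvg_cst.
    by apply/funext => y; rewrite /charfun_arg big_ord0.
  rewrite (_ : charfun_arg K.+1 = fun y => charfun_arg K y + geo_arg (weight K) (K.+1%:R * y)).
    by apply: cvgD; [exact: IH|exact: continuous_geo_arg].
  by apply/funext => y; rewrite /charfun_arg big_ord_recr.
move=> x; apply: cvgM; first exact: cM.
apply: (@continuous_cvg _ _ _ _ _ _ cos); first exact: continuous_cos.
by apply: cvgB; [exact: cA|apply: cvgMr; exact: cvg_id].
Qed.

Definition fourier_coef K m : R := \int[mu]_(x in `[- pi, pi]) charfun_re K m x.

Let pipi : - pi < pi :> R.
Proof. by have := pi_gt0 R; move=> p; rewrite (lt_trans _ p)// oppr_lt0. Qed.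

Lemma fourier_coef_rec K m :
  fourier_coef K.+1 m =
  weight K * fourier_coef K.+1 (m - K.+1%:R) + (1 - weight K) * fourier_coef K m.
Proof.
have cc := continuous_charfun_re.
rewrite /fourier_coef -!segment_integralZ// -segment_integralD; last 2 first.
- by move=> x; apply: cvgMr; exact: cc.
- by move=> x; apply: cvgMr; exact: cc.
apply: eq_Rintegral => x _; rewrite -charfun_rec; ring.
Qed.

Lemma sin_nat_pi n : sin (n%:R * pi) = 0 :> R.
Proof.
elim: n => [|n IH]; first by rewrite mul0r sin0.
by rewrite -natr1 mulrDl mul1r sinDpi IH oppr0.
Qed.

Lemma fourier_coef0 : fourier_coef 0 0 = 2 * pi.
Proof.
rewrite /fourier_coef.
under eq_Rintegral do rewrite /charfun_re /charfun_mod /charfun_arg !big_ord0 mul0r subr0 cos0 mul1r.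
have D (x : R) : is_derive x 1 id (1 : R) by exact: isdI.
rewrite (segment_FTC pipi _ D); first by ring.
by move=> x; exact: cvg_cst.
Qed.

Lemma fourier_coef0_nat n (b : bool) : fourier_coef 0 ((-1) ^+ b * n.+1%:R) = 0.
Proof.
rewrite /fourier_coef.
have n0 : n.+1%:R != 0 :> R by rewrite pnatr_eq0.
have D x : is_derive x 1 (fun x => sin (n.+1%:R * x) / n.+1%:R) (charfun_re 0 ((-1) ^+ b * n.+1%:R) x).
  have -> : charfun_re 0 ((-1) ^+ b * n.+1%:R) x = cos (n.+1%:R * x).
    rewrite /charfun_re /charfun_mod /charfun_arg !big_ord0 mul1r sub0r.
    by case: b; rewrite ?expr0 ?expr1 ?mulN1r ?mul1r ?mulNr ?opprK ?cosN.
  apply: (is_derive_eq (isdM (isdcomp (isdM (isdC n.+1%:R x) (isdI x)) (is_derive_sin _)) (isdC n.+1%:R^-1 x))).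
  by field.
rewrite (segment_FTC pipi _ D); last exact: continuous_charfun_re.
by rewrite mulrN sinN sin_nat_pi oppr0 !mul0r subrr.
Qed.

Lemma norm_fourier_coef_le K m : `|fourier_coef K m| <= 2 * pi.
Proof.
have cc := @continuous_charfun_re.
rewrite /fourier_coef; apply: (le_trans (le_normr_Rintegral _ _)) => //.
  exact: segment_integrable.
rewrite -fourier_coef0; apply: segment_le_integral => //.
  by move=> x; apply: cvg_norm; exact: cc.
move=> x _; apply: (le_trans (norm_charfun_re_le _ _ _)).
by rewrite /charfun_re /charfun_arg /charfun_mod !big_ord0 mul0r subr0 cos0 mulr1 charfun_mod_le1.
Qed.

(** By induction on K the recursion reduces to an iterated shift to more and more
    negative arguments, with a factor weight < 1 each time, while the integrals
    stay bounded. *)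
Lemma fourier_coef_neg K n : fourier_coef K (- n.+1%:R) = 0.
Proof.
elim: K n => [n|K IH n]; first by rewrite -mulN1r -(expr1 (-1)) (fourier_coef0_nat _ true).
have it j : exists2 m : nat, fourier_coef K.+1 (- n.+1%:R) = weight K ^+ j * fourier_coef K.+1 (- m.+1%:R) & True.
  elim: j => [|j [m mE _]]; first by exists n => //; rewrite expr0 mul1r.
  exists (m + K.+1)%N => //; rewrite mE fourier_coef_rec IH mulr0 addr0 exprSr -mulrA.
  by congr (_ * (_ * fourier_coef _ _)); rewrite -addSn natrD opprD.
apply/eqP; rewrite -normr_eq0 eq_le normr_ge0 andbT.
have h : weight K ^+ j * (2 * pi) @[j --> \oo] --> (0 * (2 * pi) : R).
  apply: cvgMl; apply: cvg_expr; rewrite ger0_norm ?w0//.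
  by case/andP: (w01 K).
rewrite mul0r in h; rewrite -(cvg_lim _ h)//; apply: limr_ge.
  by apply: cvgP; exact: h.
apply: nearW => j; have [m -> _] := it j.
by rewrite normrM ger0_norm ?exprn_ge0// ler_wpM2l ?exprn_ge0// norm_fourier_coef_le.
Qed.

(** The counts p K n of partitions of n into parts at most K satisfy, after
    multiplication by the weights, the same recursion as the Fourier
    coefficients, and both vanish at negative totals. *)
Lemma fourier_inversion (p : nat -> nat -> R) :
  (forall n, p 0%N n = (n == 0%N)%:R) ->
  (forall K n, p K.+1 n = p K n + (if (K < n)%N then p K.+1 (n - K.+1)%N else 0)) ->
  forall K n, fourier_coef K n%:R =
    2 * pi * (p K n * expR (- (n%:R * t)) * \prod_(k < K) (1 - weight k)).
Proof.
move=> p0 pS; elim=> [[|n]|K IH].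
- by rewrite fourier_coef0 p0 mul0r oppr0 expR0 big_ord0 !mulr1.
- by rewrite -[n.+1%:R]mul1r -(expr0 (-1)) (fourier_coef0_nat n false) p0/= mul0r mul0r mulr0.
elim/ltn_ind => n IHn; rewrite fourier_coef_rec pS IH big_ord_recr/=.
case: ltnP => Kn.
  have -> : n%:R - K.+1%:R = (n - K.+1)%:R :> R by rewrite natrB.
  rewrite IHn; last by lia.
  rewrite big_ord_recr/=.
  have -> : expR (- (n%:R * t)) = weight K * expR (- ((n - K.+1)%:R * t)).
    by rewrite /weight -expRD; congr expR; rewrite natrB//; ring.
  rewrite pS; case: ltnP => _; ring.
have -> : n%:R - K.+1%:R = - (K - n).+1%:R :> R.
  by rewrite -subSn// natrB ?opprB// leqW.
rewrite fourier_coef_neg; ring.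
Qed.

End FourierInversion.

(** * Taylor bounds *)

Section TaylorBounds.
Context {R : realType}.
Implicit Types (x y u w : R).

Lemma ge0_from_derive (f df : R -> R) y : f 0 = 0 -> 0 <= y ->
  (forall x, is_derive x 1 f (df x)) -> (forall x, 0 <= x -> 0 <= df x) ->
  0 <= f y.
Proof.
move=> f0 y0 D d0; have [c /andP[c0 _]] := MVT_is_derive y0 (fun x _ => D x).
by rewrite f0 !subr0 => ->; rewrite mulr_ge0// d0.
Qed.

Lemma sin_le x : 0 <= x -> sin x <= x.
Proof.
move=> x0; rewrite -subr_ge0.
apply: (@ge0_from_derive (fun x => x - sin x) (fun x => 1 - cos x)) => //.
by rewrite sin0 subrr.
Qed.

Lemma onem_cos_le x : 1 - cos x <= x ^+ 2 / 2.
Proof.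
wlog x0 : x / 0 <= x => [H|].
  have [/H//|/ltW x0] := leP 0 x.
  by have := H (- x); rewrite oppr_ge0 cosN sqrrN; exact.
rewrite -subr_ge0.
apply: (@ge0_from_derive (fun x => x ^+ 2 / 2 - (1 - cos x)) (fun x => x - sin x)) => //.
- by rewrite cos0 expr0n/= mul0r !subrr.
- by move=> y; apply: is_derive_eq; rewrite /GRing.scale /=; field.
- by move=> y y0; rewrite subr_ge0 sin_le.
Qed.

Lemma sin_ge x : 0 <= x -> x - x ^+ 3 / 6 <= sin x.
Proof.
move=> x0; rewrite -subr_ge0.
apply: (@ge0_from_derive (fun x => sin x - (x - x ^+ 3 / 6)) (fun x => x ^+ 2 / 2 - (1 - cos x))) => //.
- by rewrite sin0 expr0n/= mul0r !subrr.
- by move=> y; apply: is_derive_eq; rewrite /GRing.scale /=; field.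
- by move=> y y0; rewrite subr_ge0 onem_cos_le.
Qed.

Lemma onem_cos_ge x : x ^+ 2 / 2 - x ^+ 4 / 24 <= 1 - cos x.
Proof.
wlog x0 : x / 0 <= x => [H|].
  have [/H//|/ltW x0] := leP 0 x.
  have e4 : (- x) ^+ 4 = x ^+ 4 by ring.
  by have := H (- x); rewrite oppr_ge0 cosN sqrrN e4; exact.
rewrite -subr_ge0.
apply: (@ge0_from_derive (fun x => 1 - cos x - (x ^+ 2 / 2 - x ^+ 4 / 24)) (fun x => sin x - (x - x ^+ 3 / 6))) => //.
- by rewrite cos0 !expr0n/= !mul0r !subrr.
- by move=> y; apply: is_derive_eq; rewrite /GRing.scale /=; field.
- by move=> y y0; rewrite subr_ge0 sin_ge.
Qed.

Lemma norm_sin_sub_le x : `|sin x - x| <= `|x| ^+ 3 / 6.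
Proof.
wlog x0 : x / 0 <= x => [H|].
  have [/H//|/ltW x0] := leP 0 x.
  by have := H (- x); rewrite oppr_ge0 sinN -opprD !normrN; exact.
rewrite distrC !ger0_norm ?subr_ge0 ?sin_le//; have := sin_ge x0; lra.
Qed.

Lemma norm_sin_le x : `|sin x| <= `|x|.
Proof.
wlog x0 : x / 0 <= x => [H|].
  have [/H//|/ltW x0] := leP 0 x.
  by have := H (- x); rewrite oppr_ge0 sinN !normrN; exact.
have [x1|/ltW x1] := leP x 1; last first.
  by apply: (le_trans (sin_max _)); rewrite ger0_norm.
rewrite (ger0_norm x0) ger0_norm ?sin_le//.
by rewrite sin_ge0_pi// x0/= (le_trans x1)// (le_trans _ (pi_ge2 R))// ler1n.
Qed.

Lemma norm_atan_sub_le x : `|atan x - x| <= `|x| ^+ 3.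
Proof.
wlog x0 : x / 0 <= x => [H|].
  have [/H//|/ltW x0] := leP 0 x.
  by have := H (- x); rewrite oppr_ge0 atanN -opprD !normrN; exact.
have d0 y : 0 < 1 + y ^+ 2 :> R by rewrite ltr_pwDl// sqr_ge0.
have h1 : 0 <= x - atan x.
  apply: (@ge0_from_derive (fun x => x - atan x) (fun x => 1 - (1 + x ^+ 2)^-1)) => //.
    by rewrite atan0 subrr.
  by move=> y _; rewrite subr_ge0 invf_le1// lerDl sqr_ge0.
have h2 : 0 <= x ^+ 3 - (x - atan x).
  apply: (@ge0_from_derive (fun x => x ^+ 3 - (x - atan x)) (fun x => 3 * x ^+ 2 - (1 - (1 + x ^+ 2)^-1))) => //.
  - by rewrite atan0 expr0n/= !subrr.
  - move=> y; apply: is_derive_eq; rewrite /GRing.scale /=; field.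
    by rewrite gt_eqF.
  - move=> y _; have -> : 1 - (1 + y ^+ 2)^-1 = y ^+ 2 / (1 + y ^+ 2) by field; rewrite gt_eqF.
    rewrite subr_ge0 ler_pdivrMr//; have := sqr_ge0 y; move: (y ^+ 2) => z z0; nra.
by rewrite distrC !ger0_norm//; lra.
Qed.

Lemma ln1D_ge u : 0 <= u -> u - u ^+ 2 <= ln (1 + u).
Proof.
move=> u0; have u1 : 0 < 1 + u by rewrite ltr_pwDl.
have : ln (1 + u)^-1 <= (1 + u)^-1 - 1.
  have := @le_ln1Dx R ((1 + u)^-1 - 1); rewrite addrCA subrr addr0; apply.
  by rewrite ltrBrDl subrr invr_gt0.
rewrite lnV ?posrE//.
have -> : (1 + u)^-1 - 1 = - (u / (1 + u)) by field; rewrite gt_eqF.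
rewrite lerN2; apply: le_trans; rewrite ler_pdivlMr//.
have u2 := sqr_ge0 u; have : 0 <= u ^+ 2 * u by rewrite mulr_ge0.
by rewrite !expr2 in u2 *; lra.
Qed.

Lemma onem_cos_jordan x : `|x| <= pi -> 2 * x ^+ 2 / pi ^+ 2 <= 1 - cos x.
Proof.
wlog x0 : x / 0 <= x => [H|].
  have [/H//|/ltW x0] := leP 0 x.
  by have := H (- x); rewrite oppr_ge0 normrN cosN sqrrN; exact.
rewrite ger0_norm// => xp; have p0 := pi_gt0 R.
have -> : cos x = 1 - 2 * sin (x / 2) ^+ 2.
  have -> : x = (x / 2) *+ 2 by rewrite -mulr_natr mulfVK.
  rewrite cos_mulr2n -mulr_natr cos2sin2 mulr2n -mulr_natr mulrA divfK//.
  ring.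
have := @jordan_sin R (x / 2).
rewrite divr_ge0//= ler_pM2r// => /(_ xp).
rewrite mulrCA mulfV// mulr1 => h.
have h0 : 0 <= x / pi by rewrite divr_ge0// ltW.
have := ler_pM h0 h0 h h; rewrite -!expr2 exprMn exprVn -mulrA; lra.
Qed.

End TaylorBounds.

(** * Estimates of the characteristic function *)

Section CharfunEstimates.
Context {R : realType}.
Implicit Types (t x y a : R) (k K : nat).

(** mom4_upto has the order of magnitude of a fourth cumulant; together with the
    variance it governs the error terms of the Gaussian approximation. *)
Definition mean_upto t K : R := \sum_(k < K) k.+1%:R * bose1 (k.+1%:R * t).
Definition var_upto t K : R := \sum_(k < K) k.+1%:R ^+ 2 * bose2 (k.+1%:R * t).
Definition mom4_upto t K : R := \sum_(k < K) k.+1%:R ^+ 4 * bose2 (k.+1%:R * t).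

Let kt0 t k : 0 < t -> 0 < k.+1%:R * t.
Proof. by move=> t0; rewrite mulr_gt0. Qed.

Let dev t k x : R := geo_dev (weight t k) (k.+1%:R * x).

Let devE t k x : dev t k x = 2 * bose2 (k.+1%:R * t) * (1 - cos (k.+1%:R * x)).
Proof. by rewrite /dev /geo_dev /bose2 /weight; ring. Qed.

Let dev_ge0 t k x : 0 <= dev t k x.
Proof. by rewrite geo_dev_ge0// expR_ge0. Qed.

Lemma charfun_modE t K x : charfun_mod t K x =
  expR (- ((\sum_(k < K) ln (1 + dev t k x)) / 2)).
Proof.
elim: K => [|K IH].
  by rewrite /charfun_mod !big_ord0 mul0r oppr0 expR0.
rewrite /charfun_mod !big_ord_recr/= -/(charfun_mod t K x) IH mulrDl opprD expRD.
congr (_ * _); rewrite /geo_mod -/(dev t K x).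
have d1 : 0 < 1 + dev t K x by rewrite ltr_pwDl.
rewrite expRN; congr (_^-1); rewrite -powR12_sqrt ?(ltW d1)//.
by rewrite /powR gt_eqF// mulrC.
Qed.

(** Second order expansion of ln (1 + dev) with dev = 2 bose2 (1 - cos). The
    square of dev is controlled by (k t)^2 bose2 (k t) <= 1. *)
Lemma sum_ln_dev_bounds t K x : 0 < t ->
  x ^+ 2 * var_upto t K - x ^+ 4 * (mom4_upto t K / 12 + var_upto t K / t ^+ 2)
  <= \sum_(k < K) ln (1 + dev t k x) <= x ^+ 2 * var_upto t K.
Proof.
move=> t0; have lnu u : 0 <= u -> ln (1 + u) <= u :> R.
  by move=> u0; apply: le_ln1Dx; rewrite (lt_le_trans _ u0)// ltrN10.
have dev_le k : dev t k x <= x ^+ 2 * (k.+1%:R ^+ 2 * bose2 (k.+1%:R * t)).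
  rewrite devE; have := onem_cos_le (k.+1%:R * x).
  have b0 : 0 <= 2 * bose2 (k.+1%:R * t) by rewrite mulr_ge0// bose2_ge0.
  move=> /(ler_wpM2l b0)/le_trans; apply; rewrite le_eqVlt; apply/orP; left.
  by apply/eqP; field.
apply/andP; split; last first.
  rewrite /var_upto mulr_sumr; apply: ler_sum => k _.
  by apply: (le_trans (lnu _ _)).
rewrite /var_upto /mom4_upto !mulr_suml -big_split/= !mulr_sumr -sumrB.
apply: ler_sum => k _; apply: le_trans (ln1D_ge (dev_ge0 _ _ _)).
set b := bose2 _; have b0 : 0 <= b by exact: bose2_ge0.
have kb : (k.+1%:R ^+ 2 * b) * t ^+ 2 <= 1.
  by have := bose2_le (kt0 k t0); rewrite exprMn -/b; congr (_ <= _); ring.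
have h1 : x ^+ 2 * (k.+1%:R ^+ 2 * b) - x ^+ 4 * (k.+1%:R ^+ 4 * b / 12) <= dev t k x.
  rewrite devE -/b; have := onem_cos_ge (k.+1%:R * x).
  have b2 : 0 <= 2 * b by rewrite mulr_ge0.
  move=> /(ler_wpM2l b2); apply: le_trans; rewrite le_eqVlt; apply/orP; left.
  by apply/eqP; field.
have h2 : dev t k x ^+ 2 <= x ^+ 4 * (k.+1%:R ^+ 2 * b / t ^+ 2).
  have := ler_pM (dev_ge0 _ _ _) (dev_ge0 _ _ _) (dev_le k) (dev_le k).
  rewrite -expr2 -/b => /le_trans; apply.
  set c := k.+1%:R ^+ 2 * b in kb *.
  have c0 : 0 <= c by rewrite mulr_ge0// sqr_ge0.
  have -> : x ^+ 2 * c * (x ^+ 2 * c) = x ^+ 4 * (c * c) by ring.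
  apply: ler_wpM2l; first by rewrite (exprM x 2 2) sqr_ge0.
  by apply: ler_wpM2l => //; rewrite -[leRHS]mul1r ler_pdivlMr ?exprn_gt0.
lra.
Qed.

(** First order expansion of the argument in x. The errors of atan, of sin and of
    the denominator 1 - q cos are all cubic, and are brought to the two stated
    shapes by k^3 <= k^2 / t + t k^4. *)
Lemma geo_arg_bound t k x : 0 < t ->
  `|geo_arg (weight t k) (k.+1%:R * x) - x * (k.+1%:R * bose1 (k.+1%:R * t))| <=
  `|x| ^+ 3 * (2 * (k.+1%:R ^+ 2 * bose2 (k.+1%:R * t)) / t +
               t * (k.+1%:R ^+ 4 * bose2 (k.+1%:R * t))).
Proof.
move=> t0; have T0 := kt0 k t0.
have /andP[q0 q1] := expRN_gt0_lt1 T0.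
have b1 := bose1_le T0.
rewrite /geo_arg /bose1 /bose2 /weight in b1 *.
move: q0 q1 b1; set q := expR _ => q0 q1 b1.
set a := k.+1%:R * x.
have e0 : 0 < 1 - q by rewrite subr_gt0.
have c0 : 1 - q <= 1 - q * cos a.
  by rewrite lerD2l lerN2 ler_piMr ?(ltW q0)// cos_le1.
have d0 : 0 < 1 - q * cos a by exact: lt_le_trans c0.
set y := q * sin a / (1 - q * cos a).
pose B := q / (1 - q) ^+ 2; pose B1 := q / (1 - q).
have B0 : 0 <= B by rewrite divr_ge0 ?sqr_ge0// ltW.
have B10 : 0 <= B1 by rewrite divr_ge0// ltW.
have BB1 : B1 <= B.
  rewrite /B1 /B ler_wpM2l ?(ltW q0)// lef_pV2 ?posrE ?exprn_gt0//.
  by rewrite expr2 ler_piMr ?(ltW e0)// gerBl ltW.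
have a3 : 0 <= `|a| ^+ 3 by rewrite exprn_ge0.
have hy : `|y| <= `|a| * B1.
  rewrite /y normrM normrM (gtr0_norm q0) normfV (gtr0_norm d0) /B1 mulrA.
  rewrite ler_pM ?mulr_ge0 ?invr_ge0 ?(ltW q0) ?(ltW d0)//.
    by rewrite mulrC ler_wpM2r ?(ltW q0)// norm_sin_le.
  by rewrite lef_pV2 ?posrE.
have h1 : `|atan y - y| <= `|a| ^+ 3 * (B1 * B).
  apply: (le_trans (norm_atan_sub_le _)).
  apply: (@le_trans _ _ ((`|a| * B1) ^+ 3)); first by apply: lerXn2r; rewrite ?nnegrE// mulr_ge0.
  rewrite exprMn ler_wpM2l// exprS ler_wpM2l//.
  rewrite /B1 /B exprMn exprVn ler_wpM2r ?invr_ge0 ?sqr_ge0//.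
  by rewrite expr2 ler_piMr ?(ltW q0) ?(ltW q1).
have h2 : `|y - a * B1| <= `|a| ^+ 3 * B.
  have -> : y - a * B1 = q / (1 - q * cos a) * (sin a - a) -
      a * B1 * (q / (1 - q * cos a)) * (1 - cos a).
    by rewrite /y /B1; field; rewrite !gt_eqF.
  have qd : 0 <= q / (1 - q * cos a) <= B1.
    rewrite divr_ge0 ?(ltW q0) ?(ltW d0)//= /B1 ler_wpM2l ?(ltW q0)//.
    by rewrite lef_pV2 ?posrE.
  have /andP[qd0 qd1] := qd.
  apply: (le_trans (ler_normB _ _)).
  have g1 : `|q / (1 - q * cos a) * (sin a - a)| <= B * (`|a| ^+ 3 / 6).
    rewrite normrM ger0_norm// ler_pM//; first exact: le_trans BB1.
    exact: norm_sin_sub_le.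
  have g2 : `|a * B1 * (q / (1 - q * cos a)) * (1 - cos a)| <= B * (`|a| ^+ 3 / 2).
    have cc : 0 <= 1 - cos a by rewrite subr_ge0 cos_le1.
    rewrite normrM (ger0_norm cc) normrM (ger0_norm qd0) normrM (ger0_norm B10).
    have : 1 - cos a <= `|a| ^+ 2 / 2 by rewrite real_normK ?num_real// onem_cos_le.
    have : B1 * (q / (1 - q * cos a)) <= B.
      apply: (le_trans (ler_wpM2l B10 qd1)); rewrite /B1 /B.
      rewrite mulrACA -invfM -expr2 ler_wpM2r ?invr_ge0 ?sqr_ge0//.
      by rewrite ler_piMr ?(ltW q0) ?(ltW q1).
    move=> u1 u2; have u0 : 0 <= B1 * (q / (1 - q * cos a)) by rewrite mulr_ge0.
    have := ler_pM u0 cc u1 u2; move=> /(ler_wpM2l (normr_ge0 a)).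
    by congr (_ <= _); ring.
  apply: (le_trans (lerD g1 g2)); rewrite -mulrDr mulrC ler_wpM2r//.
  by move: a3; move: (`|a| ^+ 3) => A A0; lra.
have -> : x * (k.+1%:R * B1) = a * B1 by rewrite /a; ring.
apply: (le_trans (ler_distD y _ _)).
apply: (le_trans (lerD h1 h2)).
have ka : `|a| ^+ 3 = `|x| ^+ 3 * k.+1%:R ^+ 3.
  by rewrite /a normrM ger0_norm// exprMn mulrC.
rewrite ka -mulrDr -[leLHS]mulrA; apply: ler_wpM2l; first by rewrite exprn_ge0.
rewrite mulrDr.
have kk0 : 0 < k.+1%:R :> R by [].
have kk : k.+1%:R * B1 <= t^-1.
  by rewrite -[_^-1]mul1r ler_pdivlMr//; move: b1; congr (_ <= _); rewrite /B1; ring.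
have l1 : k.+1%:R ^+ 3 * (B1 * B) <= k.+1%:R ^+ 2 * B / t.
  have := ler_wpM2l (mulr_ge0 (sqr_ge0 k.+1%:R) B0) kk.
  by congr (_ <= _); ring.
have l2 : k.+1%:R ^+ 3 * B <= k.+1%:R ^+ 2 * B / t + t * (k.+1%:R ^+ 4 * B).
  have g : k.+1%:R <= t^-1 + t * k.+1%:R ^+ 2.
    have := sqr_ge0 (1 - t * k.+1%:R); set c := k.+1%:R in kk0 *.
    have -> : (1 - t * c) ^+ 2 = t * ((t^-1 + t * c ^+ 2) - 2 * c) by field; rewrite gt_eqF.
    rewrite pmulr_rge0//; lra.
  have := ler_wpM2l (mulr_ge0 (sqr_ge0 k.+1%:R) B0) g.
  by congr (_ <= _); ring.
move: l1 l2; rewrite -/B; lra.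
Qed.

Lemma charfun_arg_bound t K x : 0 < t ->
  `|charfun_arg t K x - x * mean_upto t K| <=
  `|x| ^+ 3 * (2 * var_upto t K / t + t * mom4_upto t K).
Proof.
move=> t0; rewrite /charfun_arg /mean_upto mulr_sumr -sumrB.
apply: (le_trans (ler_norm_sum _ _ _)).
rewrite /var_upto /mom4_upto !(mulr_sumr, mulr_suml) -big_split/= mulr_sumr.
by apply: ler_sum => k _; exact: geo_arg_bound.
Qed.

End CharfunEstimates.

Section CharfunDomination.
Context {R : realType}.
Implicit Types (t x y a : R) (k K : nat).

Lemma dirichlet_kernel K x : 2 * sin (x / 2) * \sum_(k < K) cos (k.+1%:R * x) =
  sin (K%:R * x + x / 2) - sin (x / 2).
Proof.
elim: K => [|K IH]; first by rewrite big_ord0 mulr0 mul0r add0r subrr.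
rewrite big_ord_recr/= mulrDr IH.
have -> : K%:R * x + x / 2 = K.+1%:R * x - x / 2.
  by rewrite -natr1; field.
by rewrite sinB sinD; ring.
Qed.

(** The Dirichlet kernel is at most (1 - sin (x/2)) / (2 sin (x/2)), and
    sin (x/2) >= x / pi. *)
Lemma sum_cos_le K x : 0 < x <= pi ->
  \sum_(k < K) cos (k.+1%:R * x) <= pi / (2 * x) - 1 / 2.
Proof.
move=> /andP[x0 xp]; have p0 := pi_gt0 R.
have h : x / pi <= sin (x / 2).
  have := @jordan_sin R (x / 2); rewrite divr_ge0 ?(ltW x0)//= ler_pM2r// => /(_ xp).
  by rewrite mulrCA mulfV// mulr1.
have xp0 : 0 < x / pi by rewrite divr_gt0.
have s0 : 0 < sin (x / 2) by exact: lt_le_trans h.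
have := dirichlet_kernel K x; set S := \sum_(_ < _) _ => E.
have {}E : 2 * sin (x / 2) * S <= 1 - sin (x / 2) by rewrite E lerD2r sin_le1.
have : S <= (1 - sin (x / 2)) / (2 * sin (x / 2)).
  by rewrite ler_pdivlMr ?mulr_gt0// mulrC.
have -> : (1 - sin (x / 2)) / (2 * sin (x / 2)) = (sin (x / 2))^-1 / 2 - 1 / 2.
  by field; rewrite gt_eqF.
have hi : (sin (x / 2))^-1 <= pi / x.
  by rewrite -[pi / x]invf_div lef_pV2 ?posrE.
have -> : pi / (2 * x) = pi / x / 2 by rewrite invfM mulrCA mulrC -mulrA.
lra.
Qed.

Let weight_ge0 t k : 0 <= weight t k :> R.
Proof. exact: expR_ge0. Qed.

Lemma charfun_mod_sqr t K x :
  charfun_mod t K x ^+ 2 = (\prod_(k < K) (1 + geo_dev (weight t k) (k.+1%:R * x)))^-1.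
Proof.
rewrite /charfun_mod -prodrXl -prodfV; apply: eq_bigr => k _.
rewrite /geo_mod exprVn sqr_sqrtr//.
by rewrite ler_wpDr// geo_dev_ge0.
Qed.

Lemma charfun_mod_sqr_le t K K' x : (K <= K')%N ->
  charfun_mod t K' x ^+ 2 <= charfun_mod t K x ^+ 2.
Proof.
have M0 J := charfun_mod_ge0 t J x.
move=> /subnKC <-; elim: (K' - K)%N => [|j IH]; first by rewrite addn0.
apply: le_trans IH; rewrite addnS; apply: lerXn2r; rewrite ?nnegrE//.
rewrite /charfun_mod big_ord_recr/= ler_piMr//; first exact: M0.
exact: geo_mod_le1.
Qed.

(** For k t <= 1 the variance bose2 (k t) is at least exp(-1) / (k t)^2, and
    exp(-1) >= 1/4. *)
Lemma geo_dev_ge t k x : 0 < t -> k.+1%:R * t <= 1 ->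
  (1 - cos (k.+1%:R * x)) / (2 * (k.+1%:R * t) ^+ 2) <=
  geo_dev (weight t k) (k.+1%:R * x).
Proof.
move=> t0 kt1; have T0 : 0 < k.+1%:R * t by rewrite mulr_gt0.
have b := bose2_ge T0.
have -> : geo_dev (weight t k) (k.+1%:R * x) =
    (1 - cos (k.+1%:R * x)) * (2 * bose2 (k.+1%:R * t)).
  by rewrite /geo_dev /bose2 /weight; ring.
have c0 : 0 <= 1 - cos (k.+1%:R * x) by rewrite subr_ge0 cos_le1.
rewrite ler_wpM2l// invfM.
have e4 : 4^-1 <= expR (- (k.+1%:R * t)).
  apply: (@le_trans _ _ (expR (- 1))); last by rewrite ler_expR lerN2.
  have -> : expR (- 1) = expR (- (1 / 2)) ^+ 2 :> R.
    by rewrite -expRM_natl; congr expR; field.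
  have : 1 / 2 <= expR (- (1 / 2)) :> R by have := expR_ge1Dx (- (1 / 2) : R); lra.
  move=> h; have h0 : (0 : R) <= 1 / 2 by [].
  by have := ler_pM h0 h0 h h; rewrite -expr2; apply: le_trans; lra.
have i0 : 0 <= (k.+1%:R * t) ^- 2 by rewrite invr_ge0 sqr_ge0.
have := le_trans (ler_wpM2r i0 e4) b; move: (_ ^- 2) (bose2 _) => z B; lra.
Qed.

(** For |x| <= pi t each of the first 2 m factors, m of order 1/t, is bounded
    through 1 - cos y >= 2 y^2 / pi^2, and Bernoulli's inequality turns their
    product into a rational function of x^2 / t^3. *)
Lemma charfun_mod_near t K m x : 0 < t -> (m.*2 <= K)%N -> m.*2%:R * t <= 1 ->
  1 / 4 <= m%:R * t -> `|x| <= pi * t ->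
  charfun_mod t K x <= (1 + x ^+ 2 / t ^+ 3 / (4 * pi ^+ 2))^-1.
Proof.
move=> t0 mK mt1 mt4 xt; have p0 := pi_gt0 R.
have p20 : 0 < pi ^+ 2 :> R by rewrite exprn_gt0.
have t20 : 0 < t ^+ 2 by rewrite exprn_gt0.
pose g := x ^+ 2 / (pi ^+ 2 * t ^+ 2).
have g0 : 0 <= g by rewrite divr_ge0 ?sqr_ge0// mulr_ge0// ltW.
have D0 : 0 < 1 + x ^+ 2 / t ^+ 3 / (4 * pi ^+ 2).
  rewrite ltr_wpDr// divr_ge0//; last by rewrite mulr_ge0// ltW.
  by rewrite divr_ge0 ?sqr_ge0// exprn_ge0// ltW.
have mg0 : 0 < 1 + m%:R * g by rewrite ltr_wpDr// mulr_ge0.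
apply: (@le_trans _ _ ((1 + m%:R * g)^-1)); last first.
  rewrite lef_pV2 ?posrE// lerD2l.
  have -> : x ^+ 2 / t ^+ 3 / (4 * pi ^+ 2) = g * (1 / 4) / t.
    by rewrite /g; move: (@pi R) p0 => q q0; field; rewrite !gt_eqF.
  by rewrite ler_pdivrMr// (mulrC m%:R) -[leRHS]mulrA ler_wpM2l.
rewrite -(@ler_pXn2r _ 2) ?nnegrE ?charfun_mod_ge0 ?invr_ge0 ?(ltW mg0)//.
apply: (le_trans (charfun_mod_sqr_le t x mK)).
rewrite charfun_mod_sqr exprVn lef_pV2 ?posrE ?exprn_gt0//; last first.
  by apply: prodr_gt0 => i _; rewrite ltr_wpDr// geo_dev_ge0.
apply: (@le_trans _ _ ((1 + g) ^+ m.*2)).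
  rewrite -muln2 exprM; apply: lerXn2r; rewrite ?nnegrE ?exprn_ge0 ?(ltW mg0) ?addr_ge0//.
  elim: m {mK mt1 mt4 mg0} => [|m IH]; first by rewrite mul0r addr0 expr0.
  rewrite exprS -natr1; have := ler_wpM2l (addr_ge0 ler01 g0) IH.
  apply: le_trans; have : 0 <= m%:R * g * g := mulr_ge0 (mulr_ge0 (ler0n _ _) g0) g0.
  clearbody g; lra.
have -> : (1 + g) ^+ m.*2 = \prod_(k < m.*2) (1 + g) by rewrite prodr_const card_ord.
apply: ler_prod => k _; rewrite addr_ge0//= lerD2l.
have kt1 : k.+1%:R * t <= 1.
  by apply: le_trans mt1; rewrite ler_pM2r// ler_nat ltn_ord.
apply: le_trans (geo_dev_ge x t0 kt1).
have kp : `|k.+1%:R * x| <= pi.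
  rewrite normrM ger0_norm//; apply: (le_trans (ler_wpM2l (ler0n _ _) xt)).
  by rewrite mulrCA ler_piMr ?(ltW p0).
have k0 : 0 < k.+1%:R :> R by [].
have i0 : 0 <= (2 * (k.+1%:R * t) ^+ 2)^-1 by rewrite invr_ge0 mulr_ge0// sqr_ge0.
have := ler_wpM2r i0 (onem_cos_jordan kp).
congr (_ <= _); rewrite /g.
by move: (@pi R) p0 (k.+1%:R : R) k0 => q q0 c c0; field; rewrite !gt_eqF.
Qed.

(** For x >= pi t the average of 1 - cos (k x) over k <= 1/t is bounded below by
    the Dirichlet kernel, so about 1/t factors contribute a constant each. *)
Lemma charfun_mod_far t K m x : 0 < t -> t <= 1 / 2 -> (m <= K)%N ->
  m%:R * t <= 1 -> 1 / t - 1 <= m%:R -> pi * t <= x <= pi ->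
  charfun_mod t K x <= expR (- (32 * t)^-1).
Proof.
move=> t0 t2 mK mt1 mt2 /andP[xt xp]; have p0 := pi_gt0 R.
have x0 : 0 < x by apply: lt_le_trans xt; rewrite mulr_gt0.
rewrite -(@ler_pXn2r _ 2) ?nnegrE ?charfun_mod_ge0 ?expR_ge0//.
apply: (le_trans (charfun_mod_sqr_le t x mK)).
have x0p : 0 < x <= pi by rewrite x0.
have S := sum_cos_le m x0p.
have {}S : \sum_(k < m) cos (k.+1%:R * x) <= 1 / (2 * t) - 1 / 2.
  apply: (le_trans S); rewrite lerD2r ler_pdivrMr ?mulr_gt0// mulrAC mul1r.
  by rewrite ler_pdivlMr ?mulr_gt0//; lra.
pose w k := (1 - cos (k.+1%:R * x)) / 2.
have w01 k : 0 <= w k <= 1.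
  by have := cos_geN1 (k.+1%:R * x); have := cos_le1 (k.+1%:R * x); rewrite /w; lra.
have SW : (8 * t)^-1 <= \sum_(k < m) w k.
  rewrite -mulr_suml sumrB sumr_const card_ord -(mulr_natl 1) mulr1.
  have e1 : (8 * t)^-1 = t^-1 / 8 by rewrite invfM mulrC.
  have e2 : 1 / (2 * t) = t^-1 / 2 by rewrite mul1r invfM mulrC.
  have e3 : 2 <= t^-1 by rewrite -[2]invrK lef_pV2 ?posrE//; lra.
  by rewrite e1 {e1}; move: S mt2; rewrite e2 mul1r; lra.
have P : expR (\sum_(k < m) w k / 2) <= \prod_(k < m) (1 + geo_dev (weight t k) (k.+1%:R * x)).
  rewrite expR_sum; apply: ler_prod => k _; rewrite expR_ge0/=.
  have /andP[w0 w1] := w01 k.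
  apply: (@le_trans _ _ (1 + w k)).
    rewrite -[leLHS]invrK -expRN invf_ple ?posrE ?expR_gt0 ?ltr_wpDr//.
    apply: le_trans (expR_ge1Dx _).
    rewrite -[leLHS]mul1r ler_pdivrMr ?ltr_wpDr//; nra.
  rewrite lerD2l.
  have kt1 : k.+1%:R * t <= 1.
    by apply: le_trans mt1; rewrite ler_pM2r// ler_nat ltn_ord.
  apply: le_trans (geo_dev_ge x t0 kt1).
  have kt0 : 0 < k.+1%:R * t by rewrite mulr_gt0.
  rewrite /w ler_wpM2l ?subr_ge0 ?cos_le1// lef_pV2 ?posrE ?mulr_gt0 ?exprn_gt0//.
  by rewrite ler_piMr// exprn_ile1// ltW.
rewrite charfun_mod_sqr -expRM_natl.
have -> : 2 * - (32 * t)^-1 = - (16 * t)^-1 by rewrite !invfM; field; rewrite gt_eqF.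
rewrite expRN lef_pV2 ?posrE ?expR_gt0//; last first.
  by apply: prodr_gt0 => i _; rewrite ltr_wpDr// geo_dev_ge0.
apply: le_trans P; rewrite ler_expR -mulr_suml.
move: SW; have -> : (8 * t)^-1 = (16 * t)^-1 * 2 by field; rewrite gt_eqF.
lra.
Qed.

(** Large enough for both ranges: far from 0, exp(- 1 / (32 t)) is at most
    6 (32 t)^3. *)
Definition dominating_const : R := 6 * 32 ^+ 3 * (1 + pi ^+ 2).

(** The bound near 0 and the bound far from 0 are absorbed by one integrable
    function of the rescaled variable y = x / t^(3/2). *)
Lemma charfun_mod_dominated t K x : 0 < t -> t <= 1 / 4 -> 1 / t <= K%:R ->
  `|x| <= pi -> charfun_mod t K x <= dominating_const / (1 + x ^+ 2 / t ^+ 3).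
Proof.
move=> t0 t4 tK xp; have p0 := pi_gt0 R.
wlog x0 : x xp / 0 <= x => [H|].
  have [/H//|/ltW x0] := leP 0 x; first exact.
  have E : charfun_mod t K x = charfun_mod t K (- x).
    by rewrite /charfun_mod; apply: eq_bigr => k _; rewrite mulrN /geo_mod /geo_dev cosN.
  by have := H (- x); rewrite normrN oppr_ge0 -E sqrrN => ->.
have x3 : 0 <= x ^+ 2 / t ^+ 3 by rewrite divr_ge0 ?sqr_ge0 ?exprn_ge0// ltW.
have y0 : 0 < 1 + x ^+ 2 / t ^+ 3 by rewrite ltr_wpDr.
have it0 : 0 <= 1 / t by rewrite divr_ge0// ltW.
pose m := Num.truncn (1 / t).
have /andP[m1 m2] : (m%:R <= 1 / t < m.+1%:R) by exact: Num.Theory.truncn_itv.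
have mK : (m <= K)%N by rewrite -(ler_nat R); exact: le_trans m1 tK.
have mt1 : m%:R * t <= 1 by rewrite -ler_pdivlMr.
have mt2 : 1 / t - 1 <= m%:R by move: m2; rewrite -natr1; lra.
have [xt|xt] := leP x (pi * t); last first.
  have := @charfun_mod_far t K m x t0 _ mK mt1 mt2.
  rewrite (ltW xt) -(ger0_norm x0) xp ger0_norm//= => /(_ _ isT)/le_trans; apply; first lra.
  have e3 : ((32 * t)^-1) ^+ 3 / 6 <= expR ((32 * t)^-1).
    have h0 : 0 <= (32 * t)^-1 by rewrite invr_ge0 mulr_ge0// ltW.
    have := @expR_ge1Dxn R _ 2 h0; rewrite (_ : 3`! = 6)%N//; lra.
  rewrite expRN invf_ple ?posrE ?expR_gt0//; last first.
    by rewrite divr_gt0// mulr_gt0// ?mulr_gt0// ltr_pwDl// sqr_ge0.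
  rewrite invf_div; apply: le_trans e3.
  rewrite ler_pdivrMr; last by rewrite !mulr_gt0// ltr_pwDl// sqr_ge0.
  have -> : (32 * t)^-1 ^+ 3 / 6 * dominating_const = (1 + pi ^+ 2) / t ^+ 3.
    by rewrite /dominating_const; move: (@pi R) => q; field; rewrite gt_eqF.
  rewrite mulrDl; apply: lerD.
    by rewrite mul1r invf_ge1 ?exprn_gt0// exprn_ile1 ?(ltW t0)//; lra.
  rewrite ler_wpM2r ?invr_ge0 ?exprn_ge0 ?(ltW t0)//.
  by apply: lerXn2r; rewrite ?nnegrE ?(ltW p0)// -(ger0_norm x0).
pose h := Num.truncn (1 / (2 * t)).
have ih0 : 0 <= 1 / (2 * t) by rewrite divr_ge0 ?mulr_ge0// ltW.
have /andP[h1 h2] : (h%:R <= 1 / (2 * t) < h.+1%:R) by exact: Num.Theory.truncn_itv.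
have e2 : 1 / (2 * t) = 1 / t / 2 by rewrite !mul1r invfM mulrC.
have ht1 : h.*2%:R * t <= 1.
  rewrite -ler_pdivlMr// -muln2 natrM; move: h1; rewrite e2; lra.
have hK : (h.*2 <= K)%N.
  rewrite -(ler_nat R); apply: le_trans tK; rewrite -muln2 natrM; move: h1; rewrite e2; lra.
have ht4 : 1 / 4 <= h%:R * t.
  rewrite -ler_pdivrMr//; move: h2; rewrite e2 -[h.+1%:R]natr1.
  have -> : 1 / 4 / t = 1 / t / 4 by rewrite mulrAC.
  have : 4 <= 1 / t by rewrite ler_pdivlMr//; lra.
  lra.
have := @charfun_mod_near t K h x t0 hK ht1 ht4; rewrite (ger0_norm x0) => /(_ xt).
move=> /le_trans; apply.
have p20 : 1 <= pi ^+ 2 :> R by rewrite exprn_ege1// (le_trans _ (pi_ge2 R))// ler1n.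
have D0 : 0 < 1 + x ^+ 2 / t ^+ 3 / (4 * pi ^+ 2).
  by rewrite ltr_wpDr// divr_ge0// mulr_ge0// sqr_ge0.
rewrite -[leLHS]mul1r ler_pdivrMr// mulrAC ler_pdivlMr// mul1r mulrDr mulr1.
have c4 : 4 * pi ^+ 2 <= dominating_const.
  by rewrite /dominating_const; move: (pi ^+ 2) p20 => q q1; lra.
apply: lerD; first by apply: le_trans c4; lra.
rewrite mulrCA -[leLHS]mulr1 ler_wpM2l//.
by rewrite ler_pdivlMr ?mulr_gt0 ?mul1r// (lt_le_trans _ p20).
Qed.

End CharfunDomination.

(** * Dominated convergence and the Gaussian integral *)

Section RealDominatedConvergence.
Context {R : realType}.
Notation mu := (@lebesgue_measure R).

Lemma Rintegral_dominated_cvg (D : set R) (f_ : nat -> R -> R) (f g : R -> R) :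
  measurable D -> (forall n, measurable_fun D (f_ n)) -> measurable_fun D f ->
  (forall x, D x -> f_ n x @[n --> \oo] --> f x) ->
  mu.-integrable D (EFin \o g) ->
  (forall n x, D x -> `|f_ n x| <= g x) ->
  \int[mu]_(x in D) f_ n x @[n --> \oo] --> \int[mu]_(x in D) f x.
Proof.
move=> mD mf_ mf ff ig fg.
have [|||||If _ H] := @dominated_convergence _ _ R mu D mD
   (fun n => EFin \o f_ n) (EFin \o f) (EFin \o g).
- by move=> n; apply/measurable_EFinP; exact: mf_.
- exact/measurable_EFinP.
- by apply: aeW => x Dx; apply: cvg_EFin; [exact: nearW|exact: ff].
- by [].
- by apply: aeW => x n Dx; rewrite /= lee_fin; exact: fg.
have e : (\int[mu]_(x in D) (EFin \o f) x)%E = (\int[mu]_(x in D) f x)%:E.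
  by rewrite /Rintegral fineK//; exact: integrable_fin_num.
by move: H; rewrite e => /fine_cvgP[].
Qed.

Lemma integrable_oneDsqrV (C : R) :
  mu.-integrable setT (EFin \o (fun x => C / (1 + x ^+ 2))).
Proof.
have c : continuous (fun x : R => (oneDsqr x)^-1) by exact: continuous_oneDsqrV.
have i1 : mu.-integrable setT (EFin \o (fun x : R => (oneDsqr x)^-1)).
  apply/integrableP; split.
    by apply/measurable_EFinP; exact: continuous_measurable_fun.
  have I : (\int[mu]_x ((oneDsqr x)^-1)%:E < +oo)%E.
    rewrite ge0_symfun_integralT//=.
    - have -> : [set x | (0 <= x)%R] = `[0%R, +oo[%classic :> set R.
        by apply/seteqP; split => x/=; rewrite in_itv/= andbT.
      by rewrite integral0y_oneDsqr ltry.
    - by move=> x /=; rewrite /oneDsqr sqrrN.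
  apply: le_lt_trans I; apply: ge0_le_integral => //=.
  - apply/measurable_EFinP; apply: continuous_measurable_fun => x.
    by apply: cvg_norm; exact: c.
  - by apply/measurable_EFinP; exact: continuous_measurable_fun.
  - by move=> x _; rewrite lee_fin ger0_norm// invr_ge0.
by have := integrableZl measurableT C i1.
Qed.

Lemma Rintegral_gauss (v : R) : 0 < v ->
  \int[mu]_x expR (- (v * x ^+ 2 / 2)) = Num.sqrt (2 * pi / v).
Proof.
move=> v0; pose s := Num.sqrt v^-1.
have s0 : 0 < s by rewrite sqrtr_gt0 invr_gt0.
have s2 : s ^+ 2 = v^-1 by rewrite sqr_sqrtr// invr_ge0 ltW.
have sn0 : s != 0 by rewrite gt_eqF.
have p0 := normal_peak_gt0 sn0.
have E x : expR (- (v * x ^+ 2 / 2)) = (normal_peak s)^-1 * normal_pdf 0 s x.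
  rewrite normal_pdfE// mulKf ?gt_eqF// /normal_fun s2 subr0; congr expR.
  by rewrite -mulr_natr; field; rewrite gt_eqF.
under eq_Rintegral do rewrite E.
rewrite RintegralZl//; last exact: integrable_normal_pdf.
rewrite /Rintegral integral_normal_pdf mulr1 /normal_peak invrK s2.
by congr Num.sqrt; rewrite -mulr_natl mulrA mulrAC.
Qed.

Lemma segment_integral_scale (G : R -> R) (c A : R) : 0 < c -> 0 < A ->
  continuous G ->
  \int[mu]_(x in `[- A, A]) G x =
  c * \int[mu]_(x in `[- (A / c), A / c]) G (c * x).
Proof.
move=> c0 A0 cG.
have cGc : continuous (fun x => G (c * x)).
  move=> x; apply: (@continuous_cvg _ _ _ _ _ _ G); first exact: cG.
  by apply: cvgMr; exact: cvg_id.
have dF (x : R) : is_derive x 1 (fun x => c * x) c.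
  by apply: (is_derive_eq (isdM (isdC c x) (isdI x))); ring.
have dE : derive1 (fun x : R => c * x) = cst c.
  by apply/funext => x; rewrite derive1E; have [_ ->] := dF x.
have cF : continuous (fun x : R => c * x).
  by move=> x; exact: (is_derive_continuous (dF x)).
have := @integration_by_substitution_increasing R (fun x => c * x) G (- (A / c)) (A / c).
have -> : c * - (A / c) = - A by field; rewrite gt_eqF.
have -> : c * (A / c) = A by field; rewrite gt_eqF.
rewrite dE => H.
rewrite -segment_integralZ// /Rintegral H.
- by congr fine; apply: eq_integral => x _ /=; rewrite mulrC.
- by rewrite lerNl -subr_ge0 opprK addr_ge0// divr_ge0// ltW.
- by move=> x y _ _; rewrite ltr_pM2l.
- by move=> x _; exact: cvg_cst.
- exact: is_cvg_cst.
- exact: is_cvg_cst.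
- split; first by move=> x _; have [] := dF x.
    by apply: cvg_at_right_filter; exact: cF.
  by apply: cvg_at_left_filter; exact: cF.
- exact: continuous_subspaceT.
Qed.

End RealDominatedConvergence.

(** * The local limit theorem *)

Section LocalLimit.
Context {R : realType}.
Notation mu := (@lebesgue_measure R).
(* Here s stands for the square root of t, so that x = s^3 y is the scale on
   which the characteristic function has a Gaussian limit of variance v. The
   parts are truncated at N n, and m n is the target total. *)
Variables (s : nat -> R) (N : nat -> nat) (m : nat -> R) (v C : R).
Hypothesis v0 : 0 < v.
Hypothesis s0 : forall n, 0 < s n.
Hypothesis s2 : forall n, s n ^+ 2 <= 1 / 4.
Hypothesis s_cvg : s n @[n --> \oo] --> 0.
Hypothesis N_ge : forall n, 1 / s n ^+ 2 <= (N n)%:R.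
Hypothesis mean_cvg :
  s n ^+ 3 * (mean_upto (s n ^+ 2) (N n) - m n) @[n --> \oo] --> 0.
Hypothesis var_cvg : s n ^+ 6 * var_upto (s n ^+ 2) (N n) @[n --> \oo] --> v.
Hypothesis mom4_le : forall n, s n ^+ 10 * mom4_upto (s n ^+ 2) (N n) <= C.

Let t n := s n ^+ 2.

Let t0 n : 0 < t n. Proof. by rewrite exprn_gt0. Qed.

Let mom4_ge0 n : 0 <= mom4_upto (t n) (N n).
Proof. by apply: sumr_ge0 => i _; rewrite mulr_ge0// bose2_ge0. Qed.

Let s2_cvg : s n ^+ 2 @[n --> \oo] --> (0 : R).
Proof.
have : s n * s n @[n --> \oo] --> (0 * 0 : R) by apply: cvgM.
by rewrite mulr0; under eq_fun do rewrite -expr2.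
Qed.

Let mom4_cvg (w : nat -> R) : w n @[n --> \oo] --> (0 : R) -> (forall n, 0 <= w n) ->
  w n * (s n ^+ 10 * mom4_upto (t n) (N n)) @[n --> \oo] --> (0 : R).
Proof.
move=> w0 wge; have wC : w n * C @[n --> \oo] --> (0 : R).
  have : w n * C @[n --> \oo] --> 0 * C by apply: cvgMl.
  by rewrite mul0r.
apply: (squeeze_cvgr _ (cvg_cst (0 : R)) wC); apply: nearW => n.
have h : 0 <= s n ^+ 10 * mom4_upto (t n) (N n) by rewrite mulr_ge0// exprn_ge0// ltW.
by rewrite mulr_ge0//= ler_wpM2l.
Qed.

Let mod_cvg x : charfun_mod (t n) (N n) (s n ^+ 3 * x) @[n --> \oo] -->
  expR (- (v * x ^+ 2 / 2)).
Proof.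
under eq_fun do rewrite charfun_modE.
apply: continuous_cvg; first exact: continuous_expR.
apply: cvgN; apply: cvgMl.
set S := fun n => \sum_(_ < _) _.
have up : x ^+ 2 * (s n ^+ 6 * var_upto (t n) (N n)) @[n --> \oo] --> v * x ^+ 2.
  by rewrite mulrC; apply: cvgMr; exact: var_cvg.
have lo : x ^+ 2 * (s n ^+ 6 * var_upto (t n) (N n)) -
   x ^+ 4 * (s n ^+ 2 * (s n ^+ 10 * mom4_upto (t n) (N n)) / 12 +
             s n ^+ 2 * (s n ^+ 6 * var_upto (t n) (N n))) @[n --> \oo] --> v * x ^+ 2 - x ^+ 4 * (0 / 12 + 0 * v).
  apply: cvgB => //; apply: cvgMr; apply: cvgD; last by apply: cvgM.
  by apply: cvgMl; apply: mom4_cvg => // n; exact: sqr_ge0.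
rewrite !mul0r addr0 mulr0 subr0 in lo.
apply: (squeeze_cvgr _ lo up); apply: nearW => n; rewrite /S.
have := @sum_ln_dev_bounds R (t n) (N n) (s n ^+ 3 * x) (t0 n).
have sn := gt_eqF (s0 n).
move=> /andP[h1 h2]; apply/andP; split.
  by move: h1; congr (_ <= _); rewrite /t; field; rewrite sn.
by move: h2; congr (_ <= _); ring.
Qed.

Let arg_cvg x : charfun_arg (t n) (N n) (s n ^+ 3 * x) - m n * (s n ^+ 3 * x)
  @[n --> \oo] --> (0 : R).
Proof.
pose E n := `|x| * `|s n ^+ 3 * (mean_upto (t n) (N n) - m n)| +
  `|x| ^+ 3 * (2 * (s n * (s n ^+ 6 * var_upto (t n) (N n))) +
               s n * (s n ^+ 10 * mom4_upto (t n) (N n))).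
have E0 : E n @[n --> \oo] --> (0 : R).
  have : E n @[n --> \oo] --> `|x| * `|0 : R| + `|x| ^+ 3 * (2 * (0 * v) + 0 : R).
    rewrite /E; apply: cvgD; first by apply: cvgMr; apply: cvg_norm; exact: mean_cvg.
    apply: cvgMr; apply: cvgD; first by apply: cvgMr; apply: cvgM.
    by apply: mom4_cvg => // n; exact: ltW.
  by rewrite normr0 mul0r !(mulr0, addr0).
apply: norm_cvg0; apply: (squeeze_cvgr _ (cvg_cst (0 : R)) E0); apply: nearW => n.
rewrite normr_ge0/=.
have -> : charfun_arg (t n) (N n) (s n ^+ 3 * x) - m n * (s n ^+ 3 * x) =
  (charfun_arg (t n) (N n) (s n ^+ 3 * x) - s n ^+ 3 * x * mean_upto (t n) (N n)) +
  x * (s n ^+ 3 * (mean_upto (t n) (N n) - m n)) by ring.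
apply: (le_trans (ler_normD _ _)); rewrite addrC /E normrM lerD2l.
have := @charfun_arg_bound R (t n) (N n) (s n ^+ 3 * x) (t0 n).
move=> /le_trans; apply; rewrite le_eqVlt; apply/orP; left; apply/eqP.
have sn := gt_eqF (s0 n).
rewrite normrM (gtr0_norm (exprn_gt0 _ (s0 n))) /t.
by field; rewrite sn.
Qed.

(** In the variable y = x / s^3 the integrand tends to exp(- v y^2 / 2) cos 0,
    under the dominating function C / (1 + y^2). *)
Lemma fourier_coef_cvg :
  (s n ^+ 3)^-1 * fourier_coef (s n ^+ 2) (N n) (m n) @[n --> \oo] -->
  Num.sqrt (2 * pi / v).
Proof.
have p0 := pi_gt0 R.
pose D n : set R := `[- (pi / s n ^+ 3), pi / s n ^+ 3]%classic.
pose f n x := charfun_re (t n) (N n) (m n) (s n ^+ 3 * x).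
have s3 n : 0 < s n ^+ 3 by rewrite exprn_gt0.
have mD n : measurable (D n) by exact: measurable_itv.
have cf n : continuous (f n).
  move=> x; apply: (@continuous_cvg _ _ _ _ _ _ (charfun_re (t n) (N n) (m n))).
    exact: continuous_charfun_re.
  by apply: cvgMr; exact: cvg_id.
have E n : (s n ^+ 3)^-1 * fourier_coef (s n ^+ 2) (N n) (m n) =
    \int[mu]_x ((f n) \_ (D n)) x.
  rewrite -Rintegral_mkcond /fourier_coef (@segment_integral_scale _ _ (s n ^+ 3))//.
    by rewrite mulKf// gt_eqF.
  exact: (continuous_charfun_re (t0 n)).
under eq_fun do rewrite E.
rewrite -Rintegral_gauss//.
apply: (@Rintegral_dominated_cvg _ _ _ _ (fun x => dominating_const / (1 + x ^+ 2))) => //.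
- move=> n; apply/measurable_restrict => //; rewrite setTI.
  by apply: measurable_funTS; exact: continuous_measurable_fun.
- apply: continuous_measurable_fun => x.
  apply: continuous_cvg; first exact: continuous_expR.
  apply: cvgN; apply: cvgMl; apply: cvgMr.
  by apply: cvgM; exact: cvg_id.
- move=> x _.
  have H : f n x @[n --> \oo] --> expR (- (v * x ^+ 2 / 2)) * cos 0.
    apply: cvgM; first exact: mod_cvg.
    by apply: continuous_cvg; [exact: continuous_cos|exact: arg_cvg].
  rewrite cos0 mulr1 in H; apply: cvg_trans H; apply: near_eq_cvg.
  have xs : `|x| * s n ^+ 3 @[n --> \oo] --> (0 : R).
    have : `|x| * (s n * s n ^+ 2) @[n --> \oo] --> `|x| * (0 * 0).
      by apply: cvgMr; apply: cvgM.
    by rewrite !mulr0; under eq_fun do rewrite -exprS.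
  have : \forall n \near \oo, `|x| * s n ^+ 3 < pi by apply: cvgr_lt xs _ _.
  apply: filterS => n xn; rewrite /patch ifT// inE /D /= in_itv/=.
  by rewrite -ler_norml ler_pdivlMr// ltW.
- exact: integrable_oneDsqrV.
- move=> n x _; rewrite /patch; case: ifPn => [|_]; last first.
    rewrite normr0 divr_ge0 ?addr_ge0 ?sqr_ge0// /dominating_const !mulr_ge0//.
    by rewrite addr_ge0// sqr_ge0.
  rewrite inE /D /= in_itv/= -ler_norml ler_pdivlMr// => xn.
  apply: (le_trans (norm_charfun_re_le _ _ _ _)).
  have xp : `|s n ^+ 3 * x| <= pi by rewrite normrM gtr0_norm// mulrC.
  have := charfun_mod_dominated (t0 n) (s2 n) (N_ge n) xp.
  have -> // : (s n ^+ 3 * x) ^+ 2 / t n ^+ 3 = x ^+ 2.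
  by rewrite /t; field; rewrite gt_eqF.
Qed.

End LocalLimit.

(** * The number of partitions of n *)

Section HardyRamanujan.
Context {R : realType}.
Implicit Types (x t : R) (n k K : nat).

(** The extra factor x^2 is absorbed by half of the exponential decay. *)
Let bose2_half x : 0 < x -> x ^+ 4 * bose2 x <= 32 * ((x / 2) ^+ 2 * bose2 (x / 2)).
Proof.
move=> x0; have h0 : 0 < x / 2 by rewrite divr_gt0.
have p := onem_expRN_gt0 x0; have ph := onem_expRN_gt0 h0.
have pp : 1 - expR (- (x / 2)) <= 1 - expR (- x).
  by rewrite lerD2l lerN2 ler_expR lerN2 ler_pdivrMr// ler_peMr ?(ltW x0)// ler1n.
have e : x ^+ 2 * expR (- (x / 2)) <= 8.
  have := expR_ge1Dxn 1 (ltW h0); rewrite (_ : 2`! = 2)%N// => g.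
  rewrite expRN ler_pdivrMr ?expR_gt0//.
  have : (x / 2) ^+ 2 / 2 <= expR (x / 2) by lra.
  have -> : (x / 2) ^+ 2 / 2 = x ^+ 2 / 8 by field.
  by rewrite ler_pdivrMr// mulrC.
have ee : expR (- x) = expR (- (x / 2)) * expR (- (x / 2)).
  by rewrite -expRD; congr expR; field.
rewrite /bose2 ee in p pp *; move: e p pp ph.
move: (expR_gt0 (- (x / 2))); move: (expR (- (x / 2))) => u u0 e p pp ph.
have i : (1 - u * u) ^- 2 <= (1 - u) ^- 2.
  rewrite lef_pV2 ?posrE ?exprn_gt0//.
  by apply: lerXn2r => //; rewrite nnegrE ltW.
have a0 : 0 <= x ^+ 2 * u by rewrite mulr_ge0 ?sqr_ge0// ltW.
have i0 : 0 <= (1 - u * u) ^- 2 by rewrite invr_ge0 sqr_ge0.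
have := ler_pM a0 i0 e i => /(ler_wpM2l a0).
by congr (_ <= _); field; rewrite gt_eqF.
Qed.

Lemma mom4_upto_le t K : 0 < t ->
  t ^+ 5 * mom4_upto t K <= 64 * ((t / 2) ^+ 3 * varP (t / 2)).
Proof.
move=> t0; have h0 : 0 < t / 2 by rewrite divr_gt0.
have [_ cv _ _] := @lambert_bose R.
have b k : 0 <= k.+1%:R ^+ 2 * bose2 (k.+1%:R * (t / 2)) :> R.
  by rewrite mulr_ge0 ?sqr_ge0// bose2_ge0.
have := series_le_lim K b (cv _ h0).
rewrite -/(lambert 2 bose2 (t / 2)) -/(varP _) /series/= big_mkord => S.
apply: (@le_trans _ _ (64 * ((t / 2) ^+ 3 * \sum_(k < K) k.+1%:R ^+ 2 * bose2 (k.+1%:R * (t / 2))))); last first.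
  by rewrite ler_wpM2l// ler_wpM2l// exprn_ge0// ltW.
rewrite /mom4_upto !mulr_sumr; apply: ler_sum => k _.
have T0 : 0 < k.+1%:R * t by rewrite mulr_gt0.
have := ler_wpM2l (ltW t0) (bose2_half T0).
have -> : k.+1%:R * t / 2 = k.+1%:R * (t / 2) by rewrite mulrA.
by congr (_ <= _); field.
Qed.

Lemma prod_weightE t K : 0 < t ->
  \prod_(k < K) (1 - weight t k) = expR (- series (fun k => bose0 (k.+1%:R * t)) K) :> R.
Proof.
move=> t0; elim: K => [|K IH]; first by rewrite big_ord0 /series/= big_geq// oppr0 expR0.
rewrite big_ord_recr/= IH seriesSr opprD expRD; congr (_ * _).
by rewrite /bose0 opprK lnK// posrE onem_expRN_gt0// mulr_gt0.
Qed.

(** The value of t at which pi^2 / (6 t^2), the leading term of the mean total of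
    the random partition, equals n. *)
Definition saddle n : R := pi / Num.sqrt (6 * n%:R).

Lemma saddle_gt0 n : (0 < n)%N -> 0 < saddle n.
Proof. by move=> n0; rewrite divr_gt0 ?pi_gt0// sqrtr_gt0 mulr_gt0// ltr0n. Qed.

Lemma saddle_sqr n : (0 < n)%N -> pi ^+ 2 / 6 / saddle n ^+ 2 = n%:R.
Proof.
move=> n0; have n1 : 0 < n%:R :> R by rewrite ltr0n.
rewrite /saddle expr_div_n sqr_sqrtr ?mulr_ge0//.
have := pi_gt0 R; move: (@pi R) => q q0; field.
by rewrite !gt_eqF.
Qed.

(* The shift by 100 makes n positive and saddle n at most 1/4, as the bounds on
   the characteristic function require. *)
Lemma saddle_shift_cvg0 : saddle (n + 100) @[n --> \oo] --> (0 : R).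
Proof.
have H : pi ^+ 2 / 6 * harmonic (n + 99) @[n --> \oo] --> (pi ^+ 2 / 6 * 0 : R).
  apply: cvgMr; rewrite (@cvg_shiftn 99 R (@harmonic R)); exact: cvg_harmonic.
have {}H : Num.sqrt (pi ^+ 2 / 6 * harmonic (n + 99)) @[n --> \oo] --> (Num.sqrt 0 : R).
  by apply: continuous_cvg; [exact: sqrt_continuous|rewrite mulr0 in H; exact: H].
rewrite sqrtr0 in H; apply: cvg_trans H; apply: near_eq_cvg; apply: nearW => n.
have p0 := pi_gt0 R.
have n0 : (0 < n + 100)%N by rewrite addn_gt0 orbT.
have n1 : 0 < (n + 100)%:R :> R by rewrite ltr0n.
apply/eqP; rewrite -(@eqrXn2 _ 2) ?sqrtr_ge0 ?(ltW (saddle_gt0 n0))//.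
rewrite sqr_sqrtr; last first.
  by apply: mulr_ge0; [rewrite divr_ge0 ?sqr_ge0|exact: harmonic_ge0].
rewrite /saddle expr_div_n sqr_sqrtr ?mulr_ge0// /harmonic /= -addnS.
by apply/eqP; move: (@pi R) => q; field; rewrite gt_eqF.
Qed.

Lemma saddle_shift_le n : saddle (n + 100) <= 1 / 4 :> R.
Proof.
rewrite /saddle ler_pdivrMr; last by rewrite sqrtr_gt0 mulr_gt0// ltr0n addn_gt0 orbT.
have p4 : pi <= 4 :> R by have := pihalf_lt2 R; lra.
have h : Num.sqrt (16 ^+ 2) <= Num.sqrt (6 * (n + 100)%:R) :> R.
  by rewrite ler_wsqrtr// natrD; have := ler0n R n; lra.
by rewrite sqrtr_sqr ger0_norm// in h; lra.
Qed.

Let shift_gt0 n : (0 < n + 100)%N. Proof. by rewrite addn_gt0 orbT. Qed.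

(** For each n the number K of factors is chosen so large that truncating the
    mean, the variance and logP is harmless; K >= n ensures that no partition of
    n is lost. *)
Let truncation (n : nat) : exists K : nat,
  [/\ (n + 100 <= K)%N, 1 / saddle (n + 100) <= K%:R,
      `|meanP (saddle (n + 100)) - mean_upto (saddle (n + 100)) K| <= 1,
      `|varP (saddle (n + 100)) - var_upto (saddle (n + 100)) K| <= 1 &
      `|logP (saddle (n + 100)) -
        series (fun k => bose0 (k.+1%:R * saddle (n + 100))) K| <= harmonic n].
Proof.
set t := saddle _; have t0 : 0 < t by exact: saddle_gt0.
have [c1 c2 _ _] := @lambert_bose R.
have h0 : 0 < harmonic n :> R by exact: harmonic_gt0.
have /cvgrPdist_le/(_ _ ltr01) e1 := c1 t t0.
have /cvgrPdist_le/(_ _ ltr01) e2 := c2 t t0.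
have /cvgrPdist_le/(_ _ h0) e3 := @is_cvg_logP R t t0.
near \oo => K; exists K; split.
- by near: K; exact: nbhs_infty_ge.
- by near: K; exact: nbhs_infty_ger.
- have -> : mean_upto t K = series (fun k => k.+1%:R ^+ 1 * bose1 (k.+1%:R * t)) K.
    by rewrite /series/= big_mkord; apply: eq_bigr => i _; rewrite expr1.
  by near: K.
- have -> : var_upto t K = series (fun k => k.+1%:R ^+ 2 * bose2 (k.+1%:R * t)) K.
    by rewrite /series/= big_mkord.
  by near: K.
- by near: K.
Unshelve. all: by end_near. Qed.

(** By Fourier inversion p n is exp(n t) times the product of the
    1 / (1 - exp(- k t)) times a Fourier coefficient over 2 pi. The local limit
    theorem gives the last factor, of order t^(3/2) with limiting variance
    pi^2 / 3, and logP_rem_cvg0 the product, whose factor sqrt t then leaves t^2,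
    that is 1/n. *)
Lemma hardy_ramanujan (pk : nat -> nat -> R) (p : nat -> R) :
  (forall n, pk 0%N n = (n == 0%N)%:R) ->
  (forall K n, pk K.+1 n = pk K n + (if (K < n)%N then pk K.+1 (n - K.+1)%N else 0)) ->
  (forall K n, (n <= K)%N -> pk K n = p n) ->
  p n * n%:R / expR (pi * Num.sqrt (2 * n%:R / 3)) @[n --> \oo] -->
  (Num.sqrt 3 / 12 : R).
Proof.
move=> pk0 pkS pkE.
rewrite -(cvg_shiftn 100 (fun n => p n * n%:R / expR (pi * Num.sqrt (2 * n%:R / 3)) : R)).
have [N NP] := choice truncation.
pose t n := saddle (n + 100); pose s n := Num.sqrt (t n).
have t0 n : 0 < t n by exact: saddle_gt0.
have s0 n : 0 < s n by rewrite sqrtr_gt0.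
have st n : s n ^+ 2 = t n by rewrite sqr_sqrtr// ltW.
have tn n : pi ^+ 2 / 6 / t n ^+ 2 = (n + 100)%:R by exact: saddle_sqr.
have t_cvg : t n @[n --> \oo] --> (0 : R) := saddle_shift_cvg0.
have s_cvg : s n @[n --> \oo] --> (0 : R).
  by rewrite -sqrtr0; apply: continuous_cvg => //; exact: sqrt_continuous.
have t_right (f : R -> R) (l : R) : f x @[x --> 0^'+] --> l ->
    f (t n) @[n --> \oo] --> l.
  by move=> H; exact: ((cvg_at_rightP _ _ _).1 H t (conj t0 t_cvg)).
have s_pow n (j : nat) : s n ^+ (2 * j) = t n ^+ j by rewrite exprM st.
have small (j : nat) (u : nat -> R) : (forall n, `|u n| <= 1) ->
    s n ^+ j.+1 * u n @[n --> \oo] --> (0 : R).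
  move=> u1; have sj : s n ^+ j.+1 @[n --> \oo] --> (0 : R).
    elim: j => [|j IH]; first by under eq_fun do rewrite expr1.
    have : s n * s n ^+ j.+1 @[n --> \oo] --> (0 * 0 : R) by apply: cvgM.
    by rewrite mulr0; under eq_fun do rewrite -exprS.
  apply: norm_cvg0; apply: (squeeze_cvgr _ (cvg_cst (0 : R)) sj); apply: nearW => n.
  have sj0 : 0 <= s n ^+ j.+1 by rewrite exprn_ge0// ltW.
  by rewrite normr_ge0/= normrM ger0_norm// ler_piMr.
have v0 : 0 < pi ^+ 2 / 3 :> R by rewrite divr_gt0// exprn_gt0// pi_gt0.
have mean_cvg : s n ^+ 3 * (mean_upto (s n ^+ 2) (N n) - (n + 100)%:R) @[n --> \oo] --> (0 : R).
  have h1 := t_right _ _ (@meanP_asymp R).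
  have h2 := @small 2 (fun n => - (meanP (t n) - mean_upto (t n) (N n))) _.
  have {}h2 : s n ^+ 3 * - (meanP (t n) - mean_upto (t n) (N n)) @[n --> \oo] --> (0 : R).
    by apply: h2 => n; rewrite normrN; have [_ _ + _ _] := NP n.
  apply: (cvg_ext (cvgD h1 h2)) => [n|]; last by rewrite addr0.
  rewrite /= tn st -/(s n) -{1}st; ring.
have var_cvg : s n ^+ 6 * var_upto (s n ^+ 2) (N n) @[n --> \oo] --> (pi ^+ 2 / 3 : R).
  have h1 := t_right _ _ (@varP_asymp R).
  have h2 : s n ^+ 6 * - (varP (t n) - var_upto (t n) (N n)) @[n --> \oo] --> (0 : R).
    by apply: (@small 5) => n; rewrite normrN; have [_ _ _ + _] := NP n.
  apply: (cvg_ext (cvgD h1 h2)) => [n|]; last by rewrite addr0.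
  by rewrite /= st (s_pow n 3); ring.
have [C mom4_le] : exists C, forall n, s n ^+ 10 * mom4_upto (s n ^+ 2) (N n) <= C.
  have h : (t n / 2) ^+ 3 * varP (t n / 2) @[n --> \oo] --> (pi ^+ 2 / 3 : R).
    have /cvg_at_rightP/(_ (fun n => t n / 2)) := @varP_asymp R; apply; split.
      by move=> n; rewrite divr_gt0.
    have : t n / 2 @[n --> \oo] --> (0 / 2 : R) by apply: cvgMl.
    by rewrite mul0r.
  have /cvgP/cvg_seq_bounded := h => -[B [_ /(_ (B + 1))]].
  rewrite ltrDl ltr01 => /(_ isT) Bb.
  exists (64 * (B + 1)) => n; rewrite st (s_pow n 5).
  apply: (le_trans (mom4_upto_le _ (t0 n))); rewrite ler_pM2l//.
  by apply: (le_trans (ler_norm _)); exact: Bb.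
have s2 n : s n ^+ 2 <= 1 / 4 by rewrite st saddle_shift_le.
have N_ge n : 1 / s n ^+ 2 <= (N n)%:R by rewrite st; have [_ + _ _ _] := NP n.
have X := @fourier_coef_cvg R s N (fun n => (n + 100)%:R) _ C v0 s0 s2 s_cvg N_ge mean_cvg var_cvg mom4_le.
pose r n := series (fun k => bose0 (k.+1%:R * t n)) (N n) - logP (t n) + logP_rem (t n).
have r_cvg : r n @[n --> \oo] --> (0 : R).
  rewrite -[X in _ --> X](addr0 0); apply: cvgD; last first.
    by apply: t_right; exact: logP_rem_cvg0.
  apply: norm_cvg0; apply: (squeeze_cvgr _ (cvg_cst (0 : R)) (@cvg_harmonic R)).
  by apply: nearW => n; rewrite normr_ge0/= distrC; have [_ _ _ _ ] := NP n.
have p0 := pi_gt0 R.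
pose q : R := Num.sqrt (2 * pi).
have q0 : 0 < q by rewrite sqrtr_gt0 mulr_gt0.
pose c : R := pi ^+ 2 / 6 / (2 * pi * q).
have W : c * expR (r n) @[n --> \oo] --> c.
  rewrite -[X in _ --> X]mulr1 -expR0; apply: cvgMr.
  by apply: continuous_cvg => //; exact: continuous_expR.
apply: (cvg_ext (cvgM X W)) => [n|]; last first.
  have -> : 2 * pi / (pi ^+ 2 / 3) = 3 * (q / pi) ^+ 2.
    rewrite expr_div_n sqr_sqrtr ?mulr_ge0 ?(ltW p0)//.
    by move: p0; move: (@pi R) => a a0; field; rewrite gt_eqF.
  rewrite sqrtrM// sqrtr_sqr ger0_norm ?divr_ge0 ?(ltW q0) ?(ltW p0)//.
  rewrite /c; clear W c; clearbody q.
  by move: p0; move: (@pi R) => a a0; field; rewrite !gt_eqF.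
rewrite /= (fourier_inversion _ pk0 pkS) ?st//.
have [nN _ _ _ _] := NP n.
rewrite pkE// prod_weightE//.
have S : series (fun k => bose0 (k.+1%:R * t n)) (N n) =
    r n + (n + 100)%:R * t n + ln (t n) / 2 - ln (2 * pi) / 2.
  rewrite /r /logP_rem -tn; move: (t0 n) => tt; move: (@pi R) => a.
  by field; rewrite gt_eqF.
rewrite -/(t n) S.
have k0 : 0 < (n + 100)%:R :> R by rewrite ltr0n shift_gt0.
have e1 : expR (ln (t n) / 2) = s n.
  have -> : ln (t n) / 2 = ln (s n) by rewrite -st lnXn// mulr2n; field.
  by rewrite lnK// posrE.
have e2 : expR (ln (2 * pi) / 2) = q.
  have -> : ln (2 * pi) / 2 = ln q.
    have -> : 2 * pi = q ^+ 2 by rewrite sqr_sqrtr// mulr_ge0// ltW.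
    by rewrite lnXn// mulr2n; field.
  by rewrite lnK// posrE.
have e3 : pi * Num.sqrt (2 * (n + 100)%:R / 3) = 2 * ((n + 100)%:R * t n).
  have a0 : 0 <= 2 * ((n + 100)%:R * t n) by rewrite !mulr_ge0// ltW.
  have b0 : 0 <= pi * Num.sqrt (2 * (n + 100)%:R / 3) :> R.
    by rewrite mulr_ge0 ?sqrtr_ge0// ltW.
  apply/eqP; rewrite -(@eqrXn2 _ 2)//; apply/eqP.
  rewrite exprMn sqr_sqrtr ?divr_ge0 ?mulr_ge0// -tn.
  by move: (t0 n); move: (t n) (@pi R) => y a y0; field; rewrite gt_eqF.
have -> : - (r n + (n + 100)%:R * t n + ln (t n) / 2 - ln (2 * pi) / 2) =
    - r n + - ((n + 100)%:R * t n) + - (ln (t n) / 2) + ln (2 * pi) / 2.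
  by ring.
clearbody r; rewrite e3 !expRD e2 !expRN e1 (expRM_natl 2).
have kE : (n + 100)%:R = pi ^+ 2 / 6 / s n ^+ 4 :> R by rewrite (s_pow n 2) tn.
have g := gt_eqF (expR_gt0 ((n + 100)%:R * t n)).
have h := gt_eqF (expR_gt0 (r n)).
move: g h; move: (expR ((n + 100)%:R * t n)) (expR (r n)) => g' h' g h.
rewrite kE /c; have := s0 n; have := q0; have := p0.
move: (p (n + 100)%N) (s n) (@pi R) => P z a a0; clearbody q => y0 z0.
by field; rewrite g h !gt_eqF.
Qed.

End HardyRamanujan.

(** * Partitions containing given parts *)

Section CountingPartitions.
Implicit Types (n k K j : nat) (p Q : seq nat) (a : pred nat).

Definition partition_list n : seq (seq nat) :=
  enum_fset (fset_set (partitions_of n)).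

Lemma mem_partition_list n p : (p \in partition_list n) = is_partition n p.
Proof.
rewrite (in_fset_set (finite_partitions_of n)).
by apply/idP/idP => [/set_mem//|h]; exact: mem_set.
Qed.

Lemma partition_list_uniq n : uniq (partition_list n).
Proof. exact: fset_uniq. Qed.

Definition npart a n : nat := count (all a) (partition_list n).

Definition contains Q p : bool := all (fun k => count_mem k Q <= count_mem k p)%N Q.

Lemma containsP Q p :
  reflect (forall k, (count_mem k Q <= count_mem k p)%N) (contains Q p).
Proof.
apply: (iffP allP) => [H k|H k _]; last exact: H.
by have [/H//|/count_memPn ->] := boolP (k \in Q).
Qed.

Let geq_tr : transitive geq.
Proof. by move=> x y z /= yx zx; exact: leq_trans yx. Qed.

Let geq_anti : antisymmetric geq.
Proof. by move=> x y /= /andP[yx xy]; apply/eqP; rewrite eqn_leq xy yx. Qed.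

Let geq_tot : total geq.
Proof. by move=> x y; exact: leq_total. Qed.

Let sumn_perm p q : perm_eq p q -> sumn p = sumn q.
Proof. by move=> pq; rewrite !sumnE; exact: perm_big. Qed.

Let is_partition_sort n p :
  is_partition n (sort geq p) = all (leq 1) p && (sumn p == n).
Proof.
have E : perm_eq (sort geq p) p by rewrite perm_sort.
by rewrite /is_partition sort_sorted// (perm_all _ E) (sumn_perm E).
Qed.

(** Removing a fixed collection Q of parts is a bijection from the partitions
    that contain Q. *)
Lemma count_contains a Q n : all (leq 1) Q -> all a Q ->
  count (fun p => all a p && contains Q p) (partition_list n) =
  if (sumn Q <= n)%N then npart a (n - sumn Q) else 0%N.
Proof.
move=> Q1 aQ; case: leqP => Qn; last first.
  apply/eqP; rewrite -leqn0 leqNgt -has_count; apply/hasPn => p.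
  rewrite mem_partition_list => /and3P[_ _ /eqP pn].
  apply/negP => /andP[_ /containsP/count_subseqP[s sp Qs]].
  have [s3 /sumn_perm e] := perm_to_subseq sp.
  move: Qn; rewrite -pn e (sumn_perm Qs) sumn_cat.
  by rewrite ltnNge leq_addr.
rewrite /npart -!size_filter; set h := fun p => sort geq (p ++ Q).
rewrite -[RHS](size_map h); apply: perm_size; apply: uniq_perm.
- by rewrite filter_uniq// partition_list_uniq.
- rewrite map_inj_in_uniq ?filter_uniq ?partition_list_uniq// => p q.
  rewrite !mem_filter !mem_partition_list => /and3P[_ sp _] /and3P[_ sq _] e.
  apply: (sorted_eq geq_tr geq_anti) => //; rewrite -(perm_cat2r Q).
  have := perm_refl (h p); rewrite {2}e /h perm_sort perm_sym perm_sort.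
  by rewrite perm_sym.
move=> p; rewrite mem_filter mem_partition_list; apply/idP/mapP.
  move=> /andP[/andP[ap /containsP/count_subseqP[s sp Qs]]].
  move=> /and3P[sortp p1 /eqP pn].
  have [s3 e3] := perm_to_subseq sp.
  have e : perm_eq p (s3 ++ Q).
    rewrite (perm_trans e3)// perm_catC perm_cat2l perm_sym; exact: Qs.
  exists (sort geq s3).
    rewrite mem_filter mem_partition_list is_partition_sort.
    have := perm_all a e; rewrite ap all_cat => /esym/andP[as3 _].
    have := perm_all (leq 1) e; rewrite p1 all_cat => /esym/andP[s31 _].
    rewrite all_sort as3 s31/= -pn (sumn_perm e) sumn_cat addnK//.
  apply: (sorted_eq geq_tr geq_anti) => //; first exact: sort_sorted.
  rewrite perm_sym /h perm_sort perm_sym (perm_trans e)// perm_cat2r.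
  by rewrite perm_sym perm_sort.
move=> [q]; rewrite mem_filter mem_partition_list => /andP[aq /and3P[_ q1 /eqP qn]] ->.
rewrite /h is_partition_sort all_sort !all_cat aq aQ q1 Q1/= sumn_cat qn subnK// eqxx.
rewrite andbT; apply/containsP => k.
by rewrite (permP (permEl (perm_sort geq _))) count_cat leq_addl.
Qed.

Definition parts_le K n : nat := npart (fun k => k <= K)%N n.

Lemma parts_le0 n : parts_le 0 n = (n == 0%N).
Proof.
rewrite /parts_le /npart.
have E p : p \in partition_list n -> all (fun k => k <= 0)%N p = (p == [::]).
  rewrite mem_partition_list => /and3P[_ p1 _].
  by case: p p1 => //= k p /andP[k0 _]; rewrite leqn0 gtn_eqF.
rewrite (eq_in_count E) count_uniq_mem ?partition_list_uniq// mem_partition_list.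
by rewrite /is_partition /= eq_sym.
Qed.

(** A partition with parts at most K + 1 either avoids K + 1 or is obtained by
    adjoining one part K + 1. *)
Lemma parts_leS K n : parts_le K.+1 n =
  (parts_le K n + (if (K < n)%N then parts_le K.+1 (n - K.+1) else 0))%N.
Proof.
have := @count_contains (fun k => k <= K.+1)%N [:: K.+1] n isT.
rewrite /= leqnn addn0 => /(_ isT) <-.
rewrite addnC /parts_le /npart -[LHS]size_filter -(count_predC (contains [:: K.+1])).
rewrite !count_filter; congr addn; apply: eq_in_count => p _ /=; first by rewrite andbC.
rewrite /contains /= eqxx andbT addn0 -has_count has_pred1.
apply/andP/allP => [[Kp /allP pK] k kp|pK].
  have := pK k kp; rewrite leq_eqVlt ltnS => /predU1P[kK|//].
  by move: Kp; rewrite -kK kp.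
split; last by apply/allP => k /pK /leqW.
by apply/negP => /pK; rewrite ltnn.
Qed.

Definition npartitions n : nat := size (partition_list n).

Lemma parts_le_all K n : (n <= K)%N -> parts_le K n = npartitions n.
Proof.
move=> nK; rewrite /parts_le /npart /npartitions; apply/eqP; rewrite -all_count.
apply/allP => p; rewrite mem_partition_list => /and3P[_ _ /eqP pn].
apply/allP => k kp; apply: leq_trans nK.
by rewrite -pn sumnE (big_rem k kp)/= leq_addr.
Qed.

End CountingPartitions.

(** * Power sums of the mex in terms of partition numbers *)

Section MexMoments.
Variables (s M A : nat).
Hypothesis s_gt0 : (0 < s)%N.
Hypothesis A_gt0 : (0 < A)%N.
Hypothesis AM : (A <= M)%N.
Implicit Types (i j k n : nat) (p : seq nat).

Definition progression i : nat := (A + i * M)%N.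

Let M_gt0 : (0 < M)%N. Proof. exact: leq_trans AM. Qed.

Let progression_inj : injective progression.
Proof. by move=> i j /addnI/eqP; rewrite eqn_pmul2r// => /eqP. Qed.

(** The bound A <= M makes A itself the least positive member of its residue
    class, so the positive members are exactly the terms of the progression. *)
Lemma mex_candidateP p k :
  reflect (exists2 j, k = progression j & (count_mem (progression j) p < s)%N)
    (mex_candidate s M A p k).
Proof.
apply: (iffP and3P) => [[k0 kA ks]|[j -> js]]; last first.
  by split=> //; rewrite /progression ?addn_gt0 ?A_gt0// addnC modnMDl.
have Ak : (A <= k)%N.
  rewrite leqNgt; apply/negP => kA'.
  have kM : (k < M)%N by exact: leq_trans AM.
  move: kA; rewrite (modn_small kM); move: AM; rewrite leq_eqVlt => /predU1P[->|AM'].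
    by rewrite modnn (gtn_eqF k0).
  by rewrite (modn_small AM') (ltn_eqF kA').
move: kA; rewrite eqn_mod_dvd// => /dvdnP[j jE]; exists j.
  by rewrite /progression -jE subnKC.
by rewrite /progression -jE subnKC.
Qed.

(** The presence of these parts forces the mex to be at least the j-th term. *)
Definition forced_parts j : seq nat :=
  flatten [seq nseq s (progression i) | i <- iota 0 j].

Lemma count_forced_parts j k :
  count_mem k (forced_parts j) = (s * (k \in [seq progression i | i <- iota 0 j]))%N.
Proof.
rewrite -count_uniq_mem; last by rewrite (map_inj_uniq progression_inj) iota_uniq.
rewrite /forced_parts; elim: (iota 0 j) => [|i r IH]; first by rewrite muln0.
by rewrite /= count_cat count_nseq IH mulnDr mulnC /=.
Qed.

Lemma sumn_forced_parts j : sumn (forced_parts j) = (s * \sum_(i < j) progression i)%N.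
Proof.
rewrite -(big_mkord xpredT progression) /index_iota subn0 /forced_parts.
elim: (iota 0 j) => [|i r IH]; first by rewrite big_nil muln0.
by rewrite /= sumn_cat IH sumn_nseq big_cons mulnDr mulnC.
Qed.

Lemma contains_forced_parts j p :
  contains (forced_parts j) p = all (fun i => s <= count_mem (progression i) p)%N (iota 0 j).
Proof.
apply/containsP/allP => [H i ij|H k].
  have := H (progression i); rewrite count_forced_parts.
  by rewrite map_f// muln1.
rewrite count_forced_parts; case: mapP => [[i ij ->]|_]; last by rewrite muln0.
by rewrite muln1 H.
Qed.

(** The mex is the J-th term for the largest J such that the first J terms all
    have frequency at least s. *)
Lemma mex_progression n p : is_partition n p -> exists J,
  [/\ mex s M A p = progression J, (J <= n)%N &
      forall j, contains (forced_parts j) p = (j <= J)%N].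
Proof.
move=> /and3P[_ p1 /eqP pn].
have AAM : (0 < A <= M)%N by rewrite A_gt0.
have [/mex_candidateP[J mJ Js] min_mex] := @mexP s M A p s_gt0 AAM.
have lt_s i : (i < J)%N -> (s <= count_mem (progression i) p)%N.
  move=> iJ; rewrite leqNgt; apply/negP => is_.
  have : mex_candidate s M A p (progression i) by apply/mex_candidateP; exists i.
  move=> /min_mex; rewrite mJ /progression leq_add2l leq_pmul2r//.
  by rewrite leqNgt iJ.
have cJ j : contains (forced_parts j) p = (j <= J)%N.
  rewrite contains_forced_parts; apply/allP/idP => [H|jJ i].
    rewrite leqNgt; apply/negP => Jj; have := H J; rewrite mem_iota/= add0n => /(_ Jj).
    by rewrite leqNgt Js.
  by rewrite mem_iota/= add0n => ij; apply: lt_s; exact: leq_trans jJ.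
exists J; split=> //.
have /containsP/count_subseqP[q qp /permP] : contains (forced_parts J) p by rewrite cJ.
move=> Q; have [s3 e3] := perm_to_subseq qp.
have : (sumn (forced_parts J) <= n)%N.
  have -> : sumn (forced_parts J) = sumn q.
    by rewrite !sumnE; apply: perm_big; apply/permP.
  by rewrite -pn !sumnE (perm_big _ e3) big_cat/= leq_addr.
apply: leq_trans; rewrite sumn_forced_parts.
apply: leq_trans (leq_pmull _ s_gt0).
rewrite -[leqLHS]card_ord -sum1_card; apply: leq_sum => i _.
by rewrite /progression addn_gt0 A_gt0.
Qed.

Lemma forced_parts_gt0 j : all (leq 1) (forced_parts j).
Proof.
apply/allP => k /flattenP[_ /mapP[i _ ->]]; rewrite mem_nseq => /andP[_ /eqP ->].
by rewrite /progression addn_gt0 A_gt0.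
Qed.

Definition increment (R : realType) r j : R :=
  (progression j)%:R ^+ r - (if j is i.+1 then (progression i)%:R ^+ r else 0).

Definition offset j : nat := (s * \sum_(i < j) progression i)%N.

Lemma sum_increment (R : realType) r J :
  \sum_(j < J.+1) increment R r j = (progression J)%:R ^+ r.
Proof.
elim: J => [|J IH]; first by rewrite big_ord_recl big_ord0 /increment subr0 addr0.
by rewrite big_ord_recr/= IH /increment addrC subrK.
Qed.

(** Write mex^r as the sum of the increments over those j for which the
    partition contains the j-th forced parts, exchange the sums, and count by
    deletion of the forced parts. *)
Lemma varsigmaE (R : realType) r n :
  varsigma R s M A r n = \sum_(j < n.+1) increment R r j *
    (if (offset j <= n)%N then (npartitions (n - offset j))%:R else 0).
Proof.
rewrite /varsigma fsbig_finite; last exact: finite_partitions_of.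
rewrite -/(partition_list n).
transitivity (\sum_(p <- partition_list n)
    \sum_(j < n.+1) increment R r j * (contains (forced_parts j) p)%:R).
  apply: eq_big_seq => p; rewrite mem_partition_list.
  move=> /mex_progression[J [-> Jn cJ]]; rewrite -sum_increment.
  under [RHS]eq_bigr do rewrite cJ.
  rewrite (big_ord_widen _ (increment R r) (_ : J.+1 <= n.+1)%N)//.
  by rewrite big_mkcond/=; apply: eq_bigr => j _; rewrite ltnS; case: leqP => _; rewrite ?mulr1 ?mulr0.
rewrite exchange_big/=; apply: eq_bigr => j _; rewrite -mulr_sumr; congr (_ * _).
have := @count_contains predT (forced_parts j) n (forced_parts_gt0 j) (all_predT _).
rewrite sumn_forced_parts -/(offset j) => E.
have -> : \sum_(p <- partition_list n) (contains (forced_parts j) p)%:R =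
   (count (fun p => all predT p && contains (forced_parts j) p) (partition_list n))%:R :> R.
  rewrite -sum1_count natr_sum [RHS]big_mkcond/=; apply: eq_bigr => p _.
  by rewrite all_predT; case: (contains _ _).
rewrite E; case: ifP => // _; congr (_%:R).
by rewrite /npart /npartitions -[RHS]count_predT; apply: eq_count => p; rewrite all_predT.
Qed.

End MexMoments.

(** * Gaussian moments and the Gamma function *)

Section GammaSubstitution.
Context {R : realType}.
Notation mu := (@lebesgue_measure R).
Variable c : R.
Hypothesis c0 : 0 < c.

(** The half-line ]0, +oo[ is exhausted by segments that stay away from 0, where
    the integrand may be singular. *)
Let exhaust (a b : nat -> R) : (forall n, 0 < a n) ->
  (forall n, a n.+1 <= a n) -> (forall n, b n <= b n.+1) ->
  (forall x, 0 < x -> exists n, a n <= x <= b n) ->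
  forall f : R -> R, measurable_fun setT f -> (forall x, 0 <= f x) ->
  (\int[mu]_(x in `[a n, b n]) (f x)%:E @[n --> \oo] -->
    \int[mu]_(x in `]0%R, +oo[) (f x)%:E)%E.
Proof.
move=> a0 an bn ex f mf f0.
have -> : `]0%R, +oo[%classic = \bigcup_n `[a n, b n]%classic :> set R.
  apply/seteqP; split => x /=; rewrite in_itv/= andbT.
    by move=> /ex[n nx]; exists n => //=; rewrite in_itv.
  by move=> [n _ /=]; rewrite in_itv/= => /andP[anx _]; exact: lt_le_trans anx.
apply: ge0_nondecreasing_set_cvg_integral.
- apply/nondecreasing_seqP => n; apply/subsetPset => x /=; rewrite !in_itv/=.
  by move=> /andP[h1 h2]; rewrite (le_trans (an n) h1) (le_trans h2 (bn n)).
- by move=> n; exact: measurable_itv.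
- by move=> n; apply/measurable_EFinP; exact: measurable_funTS.
- by move=> n x _; rewrite lee_fin.
Qed.

Let harm n : 0 < (n.+1%:R)^-1 :> R. Proof. by rewrite invr_gt0. Qed.

(** The substitution c x^2 on the segments [1/(n+1), n+1] and their images, both
    of which exhaust the half-line. *)
Lemma gamma_integrand_substitution (z : R) :
  (\int[mu]_(x in `]0%R, +oo[) (x `^ (z - 1) * expR (- x))%:E =
   \int[mu]_(x in `]0%R, +oo[)
     ((c * x ^+ 2) `^ (z - 1) * expR (- (c * x ^+ 2)) * (2 * c * `|x|))%:E)%E.
Proof.
pose a n : R := (n.+1%:R)^-1; pose b n : R := n.+1%:R.
pose F (x : R) := c * x ^+ 2.
have a0 n : 0 < a n by exact: harm.
have ab n : a n <= b n.
  by apply: (@le_trans _ _ 1); rewrite /a /b ?invf_le1// ler1n.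
have an n : a n.+1 <= a n by rewrite lef_pV2 ?posrE// ler_nat.
have bn n : b n <= b n.+1 by rewrite ler_nat.
have Fmono x y : 0 < x -> x <= y -> F x <= F y.
  move=> x0 xy; rewrite ler_wpM2l ?(ltW c0)//; apply: lerXn2r => //.
    by rewrite nnegrE ltW.
  by rewrite nnegrE (le_trans (ltW x0)).
have F0 x : 0 < x -> 0 < F x by move=> x0; rewrite mulr_gt0// exprn_gt0.
have ex x : 0 < x -> exists n, a n <= x <= b n.
  move=> x0; pose n := maxn (Num.truncn x) (Num.truncn x^-1).
  exists n; rewrite /a /b invf_ple ?posrE//; apply/andP; split.
    have : x^-1 < (Num.truncn x^-1).+1%:R by rewrite Num.Theory.truncnS_gt.
    by move=> /ltW/le_trans; apply; rewrite ler_nat ltnS leq_maxr.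
  have : x < (Num.truncn x).+1%:R by rewrite Num.Theory.truncnS_gt.
  by move=> /ltW/le_trans; apply; rewrite ler_nat ltnS leq_maxl.
have exF y : 0 < y -> exists n, F (a n) <= y <= F (b n).
  move=> y0; have s0 : 0 < Num.sqrt (y / c) by rewrite sqrtr_gt0 divr_gt0.
  have yE : y = F (Num.sqrt (y / c)).
    by rewrite /F sqr_sqrtr ?divr_ge0 ?(ltW y0) ?(ltW c0)// mulrC divfK// gt_eqF.
  have [n /andP[h1 h2]] := ex _ s0; exists n.
  by rewrite yE !Fmono.
pose G (x : R) := x `^ (z - 1) * expR (- x).
have mG : measurable_fun setT G.
  apply: measurable_funM; first exact: measurable_powR.
  by apply: measurableT_comp.
have mF : measurable_fun setT F by apply: measurable_funM => //; exact: measurable_funX.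
pose H x := (c * x ^+ 2) `^ (z - 1) * expR (- (c * x ^+ 2)) * (2 * c * `|x|).
have mH : measurable_fun setT H.
  apply: measurable_funM; last by apply: measurable_funM => //; exact: measurableT_comp.
  exact: (measurableT_comp mG mF).
have HG0 x : 0 <= G x by rewrite mulr_ge0 ?powR_ge0 ?expR_ge0.
have HH0 x : 0 <= H x.
  by rewrite mulr_ge0 ?mulr_ge0 ?powR_ge0 ?expR_ge0 ?(ltW c0).
have C1 := @exhaust (fun n => F (a n)) (fun n => F (b n)) (fun n => F0 _ (a0 n))
  (fun n => Fmono _ _ (a0 n.+1) (an n))
  (fun n => Fmono _ _ (ltr0Sn _ _) (bn n)) exF G mG HG0.
have C2 := @exhaust a b a0 an bn ex H mH HH0.
have E n : (\int[mu]_(x in `[F (a n), F (b n)]) (G x)%:E = \int[mu]_(x in `[a n, b n]) (H x)%:E)%E.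
  have dF (x : R) : is_derive x 1 F (2 * c * x).
    apply: (is_derive_eq (isdM (isdC c x) (isdX 2 (isdI x)))).
    by rewrite /=; ring.
  have dE : derive1 F = fun x => 2 * c * x.
    by apply/funext => x; rewrite derive1E; have [_ ->] := dF x.
  have cF : continuous F by move=> x; exact: (is_derive_continuous (dF x)).
  have cdF : continuous (fun x : R => 2 * c * x).
    by move=> x; apply: cvgMr; exact: cvg_id.
  rewrite (@integration_by_substitution_increasing R F G (a n) (b n)) ?dE//.
  - apply: eq_integral => x; rewrite inE/= in_itv/= => /andP[ax _].
    by rewrite /H /G /F /= ger0_norm// (le_trans (ltW (a0 n))).
  - move=> x y; rewrite !in_itv/= => /andP[ax _] _ xy.
    have x0 : 0 < x := lt_le_trans (a0 n) ax.
    rewrite ltr_pM2l// ltr_pXn2r ?nnegrE ?(ltW x0)//.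
    by rewrite (le_trans (ltW x0))// ltW.
  - by apply/cvg_ex; exists (2 * c * a n); apply: cvg_at_right_filter; exact: cdF.
  - by apply/cvg_ex; exists (2 * c * b n); apply: cvg_at_left_filter; exact: cdF.
  - split; first by move=> x _; have [] := dF x.
      by apply: cvg_at_right_filter; exact: cF.
    by apply: cvg_at_left_filter; exact: cF.
  - apply: continuous_in_subspaceT => x; rewrite inE/= in_itv/= => /andP[ax _].
    have x0 : 0 < x := lt_le_trans (F0 _ (a0 n)) ax.
    have -> : G = (fun y => y `^ (z - 1)) \* (fun y => expR (- y)) by [].
    apply: cvgM; first exact: (is_derive_continuous (is_derive1_powR _ x0)).
    by apply: (@continuous_cvg _ _ _ _ _ _ expR); [exact: continuous_expR|apply: cvgN; exact: cvg_id].
have C1' : (\int[mu]_(x in `[a n, b n]) (H x)%:E @[n --> \oo] -->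
    \int[mu]_(x in `]0%R, +oo[) (G x)%:E)%E.
  by under eq_fun do rewrite -E; exact: C1.
exact: cvg_unique C1' C2.
Qed.

End GammaSubstitution.

Section GaussianMoments.
Context {R : realType}.
Notation mu := (@lebesgue_measure R).

(** Since (1 + x)^r <= 2^r (1 + x^2)^r, it suffices that a power of 1 + x^2 is
    bounded by a multiple of exp(g (1 + x^2)). *)
Lemma poly_gauss_dominated (r : nat) (g : R) : 0 < g ->
  exists2 C, 0 <= C &
    forall x, 0 <= x -> (1 + x) ^+ r * expR (- (g * x ^+ 2)) <= C / (1 + x ^+ 2).
Proof.
move=> g0; exists (2 ^+ r * ((r.+1)`!%:R / g ^+ r.+1 * expR g)).
  by rewrite !mulr_ge0// ?invr_ge0 ?exprn_ge0 ?expR_ge0// ltW.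
move=> x x0; have z0 : 0 < 1 + x ^+ 2 by rewrite ltr_pwDl// sqr_ge0.
rewrite ler_pdivlMr//.
have h1 : (1 + x) ^+ r <= 2 ^+ r * (1 + x ^+ 2) ^+ r.
  rewrite -exprMn; apply: lerXn2r; rewrite ?nnegrE ?mulr_ge0 ?addr_ge0 ?sqr_ge0//.
  by have := sqr_ge0 (x - 1 / 2); rewrite sqrrB; lra.
have y0 : 0 <= g * (1 + x ^+ 2) by rewrite mulr_ge0// ltW.
have h2 : (1 + x ^+ 2) ^+ r.+1 <= (r.+1)`!%:R / g ^+ r.+1 * expR (g * (1 + x ^+ 2)).
  have := expR_ge1Dxn r y0; rewrite exprMn => h.
  have f0 : 0 < (r.+1)`!%:R :> R by rewrite ltr0n fact_gt0.
  have gr : 0 < g ^+ r.+1 by rewrite exprn_gt0.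
  move: h f0 gr; move: ((r.+1)`!%:R) (g ^+ r.+1) ((1 + x ^+ 2) ^+ r.+1) (expR _).
  move=> f G Z e h f0 G0.
  have fg : 0 <= f / G by rewrite divr_ge0// ltW.
  have {h} : G * Z / f <= e by lra.
  move=> /(ler_wpM2l fg); apply: le_trans; rewrite le_eqVlt; apply/orP; left.
  by apply/eqP; field; rewrite !gt_eqF.
rewrite mulrAC -ler_pdivlMr ?expR_gt0// expRN invrK.
apply: (@le_trans _ _ (2 ^+ r * (1 + x ^+ 2) ^+ r.+1)).
  by rewrite [(1 + x ^+ 2) ^+ r.+1]exprSr mulrA ler_wpM2r// ltW.
rewrite -[leRHS]mulrA ler_wpM2l ?exprn_ge0//; apply: (le_trans h2).
by rewrite mulrDr mulr1 expRD mulrA.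
Qed.

Lemma measurable_gauss_moment (r : nat) (c : R) :
  measurable_fun setT (fun x : R => x ^+ r * expR (- (c * x ^+ 2))).
Proof.
apply: measurable_funM; first exact: measurable_funX.
do 2! apply: measurableT_comp => //.
by apply: measurable_funM => //; exact: measurable_funX.
Qed.

Lemma gauss_moment (r : nat) (c : R) : 0 < c ->
  mu.-integrable `]0, +oo[ (EFin \o (fun x : R => x ^+ r * expR (- (c * x ^+ 2)))) /\
  \int[mu]_(x in `]0, +oo[) (x ^+ r * expR (- (c * x ^+ 2))) =
  Gamma (r.+1%:R / 2) / (2 * c `^ (r.+1%:R / 2)).
Proof.
move=> c0; have [C C0 CP] := poly_gauss_dominated r c0.
have I : mu.-integrable `]0, +oo[ (EFin \o (fun x : R => x ^+ r * expR (- (c * x ^+ 2)))).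
  have J : mu.-integrable `]0, +oo[ (EFin \o (fun x : R => C / (1 + x ^+ 2))).
    by apply: integrableS (integrable_oneDsqrV C).
  apply: le_integrable J => //.
  - by apply/measurable_EFinP; apply: measurable_funTS; exact: measurable_gauss_moment.
  - move=> x /=; rewrite in_itv/= andbT => x0; rewrite lee_fin.
    have X0 := ltW x0.
    rewrite ger0_norm ?mulr_ge0 ?exprn_ge0 ?expR_ge0//.
    rewrite ger0_norm ?divr_ge0 ?addr_ge0 ?sqr_ge0//.
    apply: le_trans (CP x X0); rewrite ler_wpM2r ?expR_ge0//.
    by apply: lerXn2r; rewrite ?nnegrE ?addr_ge0// lerDr.
split=> //.
have p0 : 0 < c `^ (r.+1%:R / 2) by rewrite powR_gt0.
have -> : Gamma (r.+1%:R / 2) = 2 * c `^ (r.+1%:R / 2) *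
   \int[mu]_(x in `]0, +oo[) (x ^+ r * expR (- (c * x ^+ 2))).
  rewrite -RintegralZl// /Gamma /Rintegral (gamma_integrand_substitution c0).
  congr fine; apply: eq_integral => x; rewrite inE/= in_itv/= andbT => x0.
  congr EFin; rewrite (gtr0_norm x0).
  have cx0 : 0 < c * x ^+ 2 by rewrite mulr_gt0// exprn_gt0.
  have -> : (c * x ^+ 2) `^ (r.+1%:R / 2 - 1) = c `^ (r.+1%:R / 2) * x ^+ r.+1 / (c * x ^+ 2).
    rewrite powRB ?(gt_eqF cx0) ?implybT// powRr1 ?(ltW cx0)//; congr (_ / _).
    rewrite powRM ?(ltW c0) ?sqr_ge0//; congr (_ * _).
    rewrite -powR_mulrn ?(ltW x0)// -powRrM mulrCA mulfV// mulr1.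
    by rewrite powR_mulrn// ltW.
  rewrite exprS; field.
  by rewrite !gt_eqF.
by rewrite mulrC mulKf// mulf_neq0 ?gt_eqF.
Qed.

End GaussianMoments.

(** * Sums as integrals of step functions *)

Section StepFunctions.
Context {R : realType}.
Notation mu := (@lebesgue_measure R).
Variables (h : nat -> R) (w : R).
Hypothesis w0 : 0 < w.

Let cell j : set R := `[j%:R / w, j.+1%:R / w[%classic.

Let step J (x : R) : R := \sum_(j < J) h j * \1_(cell j) x.

Let stepE J x : (forall j, (J <= j)%N -> h j = 0) -> 0 <= x ->
  step J x = h (Num.truncn (x * w)).
Proof.
move=> hJ x0; set k := Num.truncn _.
have xw : 0 <= x * w by rewrite mulr_ge0// ltW.
have kP j : (x \in cell j) = (j == k).
  have -> : (x \in cell j) = (j%:R / w <= x < j.+1%:R / w).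
    by apply/idP/idP; rewrite inE /cell /= in_itv.
  by rewrite ler_pdivrMr// ltr_pdivlMr// -truncn_eq// eq_sym.
have E j : \1_(cell j) x = (j == k)%:R :> R by rewrite indicE kP.
rewrite /step; under eq_bigr do rewrite E.
have [kJ|Jk] := ltnP k J.
  rewrite (bigD1 (Ordinal kJ))//= eqxx mulr1 big1 ?addr0// => j jk.
  by rewrite -val_eqE/= in jk; rewrite (negbTE jk) mulr0.
rewrite hJ// big1// => j _; rewrite ltn_eqF ?mulr0//.
exact: leq_trans Jk.
Qed.

Let step_integral0 J : mu.-integrable `[0, +oo[ (EFin \o step J) /\
  \int[mu]_(x in `[0, +oo[) step J x = (\sum_(j < J) h j) / w.
Proof.
elim: J => [|J [I1 I2]].
  have -> : step 0 = cst 0 by apply/funext => x; rewrite /step big_ord0.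
  split; first exact: integrable0.
  by rewrite big_ord0 mul0r Rintegral_cst// mul0r.
have -> : step J.+1 = fun x => step J x + h J * \1_(cell J) x.
  by apply/funext => x; rewrite /step big_ord_recr.
have sub : cell J `<=` `[0, +oo[.
  move=> x; rewrite /cell /= !in_itv/= andbT => /andP[h1 _]; apply: le_trans h1.
  by rewrite divr_ge0// ltW.
have mc : measurable (cell J) by exact: measurable_itv.
have muc : mu (cell J) = (w^-1)%:E.
  rewrite lebesgue_measure_itv/= lte_fin ltr_pM2r ?invr_gt0// ltr_nat ltnSn.
  by rewrite -EFinD -mulrBl -natrB// subSnn mul1r.
have Ii : mu.-integrable `[0, +oo[ (EFin \o (\1_(cell J) : R -> R)).
  apply/integrableP; split.
    by apply/measurable_EFinP; exact: measurable_indic.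
  under eq_integral do rewrite /= ger0_norm//.
  by rewrite integral_indic// setIidl// [X in (X < _)%E]muc ltry.
have Ic : mu.-integrable `[0, +oo[ (EFin \o (fun x => h J * \1_(cell J) x)).
  by have := @integrableZl _ _ _ mu `[0, +oo[ (measurable_itv _) (h J) _ Ii.
have Ie : \int[mu]_(x in `[0, +oo[) \1_(cell J) x = w^-1.
  by rewrite /Rintegral integral_indic// setIidl// [X in fine X]muc.
split; first by have := @integrableD _ _ _ mu `[0, +oo[ (measurable_itv _) _ _ I1 Ic.
rewrite RintegralD// I2 RintegralZl// Ie big_ord_recr/= mulrDl.
done.
Qed.

Lemma step_integral J : (forall j, (J <= j)%N -> h j = 0) ->
  measurable_fun (`]0, +oo[ : set R) (fun x : R => h (Num.truncn (x * w))) /\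
  \int[mu]_(x in `]0, +oo[) h (Num.truncn (x * w)) = (\sum_(j < J) h j) / w.
Proof.
move=> hJ; have [I1 I2] := step_integral0 J.
have sub : (`]0, +oo[ : set R) `<=` `[0, +oo[.
  by move=> x /=; rewrite !in_itv/= !andbT => /ltW.
have I3 : mu.-integrable `]0, +oo[ (EFin \o step J) by exact: integrableS I1.
have E : {in `]0, +oo[%classic, step J =1 fun x => h (Num.truncn (x * w))}.
  by move=> x; rewrite inE /= in_itv/= andbT => /ltW x0; exact: stepE.
split.
  apply: (eq_measurable_fun (step J)) => //.
  by apply/measurable_EFinP; case/integrableP: I3.
transitivity (\int[mu]_(x in `]0, +oo[) step J x).
  by apply: eq_Rintegral => x xD; rewrite E.
by rewrite -I2; exact: Rintegral_itv_obnd_cbnd.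
Qed.

End StepFunctions.

(** * Partition numbers and their ratios *)

Section PartitionRatio.
Context {R : realType}.
Implicit Types (k n m : nat).

Definition growth k : R := pi * Num.sqrt (2 * k%:R / 3).
Definition growth_rate : R := pi * Num.sqrt (2 / 3).

Lemma growthE k : growth k = growth_rate * Num.sqrt k%:R.
Proof. by rewrite /growth /growth_rate -[RHS]mulrA -sqrtrM// mulrAC. Qed.

Lemma growth_rate_gt0 : 0 < growth_rate.
Proof. by rewrite mulr_gt0 ?pi_gt0// sqrtr_gt0. Qed.

Lemma npartitions_asymp :
  (npartitions n)%:R * n%:R / expR (growth n) @[n --> \oo] --> (Num.sqrt 3 / 12 : R).
Proof.
apply: (@hardy_ramanujan R (fun K n => (parts_le K n)%:R) (fun n => (npartitions n)%:R)).
- by move=> n; rewrite parts_le0.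
- by move=> K n; rewrite parts_leS natrD; case: ifP.
- by move=> K n nK; rewrite parts_le_all.
Qed.

(** The weight k + 1 instead of k makes the bound uniform down to k = 0. *)
Lemma npartitions_le : exists2 C : R, 0 < C &
  forall k, (npartitions k)%:R * k.+1%:R <= C * expR (growth k).
Proof.
have /cvgP/cvg_seq_bounded := npartitions_asymp => -[B [_ /(_ (`|B| + 1))]].
rewrite ltr_pwDr ?ler_norm// => /(_ isT) Bb.
have B0 : 0 < `|B| + 1 by rewrite ltr_wpDl.
have P0 : 0 <= (npartitions 0)%:R :> R by [].
exists (2 * (`|B| + 1) + (npartitions 0)%:R); first by rewrite ltr_pwDl// mulr_gt0.
move=> [|k].
  rewrite mulr1 /growth mulr0 mul0r sqrtr0 mulr0 expR0 mulr1 lerDr.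
  by rewrite mulr_ge0// ltW.
have := Bb k.+1 I; rewrite /= ger0_norm; last by rewrite divr_ge0 ?mulr_ge0// expR_ge0.
rewrite ler_pdivrMr ?expR_gt0// => h.
have e0 := expR_ge0 (growth k.+1).
apply: (@le_trans _ _ (2 * ((npartitions k.+1)%:R * k.+1%:R))).
  rewrite mulrCA ler_wpM2l// -[k.+2]addn1 natrD; have : 1 <= k.+1%:R :> R by rewrite ler1n.
  lra.
rewrite [leRHS]mulrDl; apply: (@le_trans _ _ (2 * (`|B| + 1) * expR (growth k.+1))).
  by rewrite -[leRHS]mulrA ler_wpM2l.
by rewrite lerDl mulr_ge0.
Qed.

(** Removing m from n costs a factor exp(-c m / (2 sqrt n)) in the number of
    partitions; half of the exponent absorbs the polynomial factor n / (n - m),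
    which is large only when m is comparable with n. *)
Lemma npartitions_ratio_le : exists2 C : R, 0 < C &
  forall n m, (0 < n)%N -> (m <= n)%N ->
    (npartitions (n - m))%:R * n%:R / expR (growth n) <=
    C * expR (- (growth_rate / 4 * (m%:R / Num.sqrt n%:R))).
Proof.
have [C C0 CP] := npartitions_le; have c0 := growth_rate_gt0.
pose C2 := 2 + 128 / growth_rate ^+ 2.
have C20 : 0 < C2 by rewrite ltr_pwDl// divr_ge0// sqr_ge0.
exists (C * C2); first exact: mulr_gt0.
move=> n m n0 mn.
have n1 : 0 < n%:R :> R by rewrite ltr0n.
pose W : R := Num.sqrt n%:R; have W0 : 0 < W by rewrite sqrtr_gt0.
have W2 : n%:R = W ^+ 2 by rewrite sqr_sqrtr.
pose u := m%:R / W; have u0 : 0 <= u by rewrite divr_ge0// ltW.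
have mu_ : m%:R = u * W by rewrite /u divfK// gt_eqF.
have nm : (n - m)%:R = W ^+ 2 - u * W by rewrite natrB// W2 mu_.
have uW : u <= W.
  by rewrite /u ler_pdivrMr// -expr2 -W2 ler_nat.
have g : growth (n - m) <= growth n - growth_rate / 2 * u.
  rewrite !growthE -/W nm -mulrA -mulrBr ler_wpM2l ?(ltW c0)//.
  have d0 : 0 <= W - u / 2 by lra.
  have -> : W - 2^-1 * u = Num.sqrt ((W - u / 2) ^+ 2) by rewrite sqrtr_sqr ger0_norm// mulrC.
  rewrite ler_wsqrtr// sqrrB; have := sqr_ge0 (u / 2); lra.
have h1 : (npartitions (n - m))%:R <= C * expR (growth n - growth_rate / 2 * u) / (n - m).+1%:R.
  rewrite ler_pdivlMr//; apply: (le_trans (CP _)).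
  by rewrite ler_wpM2l ?(ltW C0)// ler_expR.
have h2 : n%:R / (n - m).+1%:R * expR (- (growth_rate / 4 * u)) <= C2.
  (* Either m <= n / 2, and n / (n - m + 1) <= 2, or u is at least half of
     W = sqrt n, and n <= (2 u)^2 is absorbed by the exponential. *)
  have [u2|u2] := leP u (W / 2).
    apply: (@le_trans _ _ 2); last by rewrite lerDl divr_ge0// sqr_ge0.
    have e1 : expR (- (growth_rate / 4 * u)) <= 1.
      by rewrite expR_le1 oppr_le0 mulr_ge0// divr_ge0// ltW.
    have q0 : 0 <= n%:R / (n - m).+1%:R :> R by rewrite divr_ge0.
    apply: (le_trans (ler_wpM2l q0 e1)); rewrite mulr1 ler_pdivrMr//.
    rewrite -[(n - m).+1]addn1 natrD nm W2.
    have : u * W <= W ^+ 2 / 2.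
      by have := ler_wpM2r (ltW W0) u2; congr (_ <= _); ring.
    by rewrite -/W; lra.
  apply: (@le_trans _ _ (128 / growth_rate ^+ 2)); last by rewrite lerDr.
  have y0 : 0 <= growth_rate / 4 * u by rewrite mulr_ge0// divr_ge0// ltW.
  have := expR_ge1Dxn 1 y0; rewrite (_ : 2`! = 2)%N// => e2.
  rewrite expRN ler_pdivrMr ?expR_gt0//.
  have q1 : n%:R / (n - m).+1%:R <= n%:R :> R by rewrite ler_pdivrMr// ler_peMr// ler1n.
  apply: (le_trans q1); rewrite W2.
  apply: (@le_trans _ _ (128 / growth_rate ^+ 2 * ((growth_rate / 4 * u) ^+ 2 / 2))); last first.
    by rewrite ler_wpM2l ?divr_ge0 ?sqr_ge0//; lra.
  have -> : 128 / growth_rate ^+ 2 * ((growth_rate / 4 * u) ^+ 2 / 2) = (2 * u) ^+ 2.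
    by field; rewrite gt_eqF.
  have v2 : W <= 2 * u by move: u2; rewrite ltr_pdivrMr// mulrC => /ltW.
  by apply: lerXn2r; rewrite ?nnegrE ?(ltW W0)// (le_trans (ltW W0)).
rewrite ler_pdivrMr ?expR_gt0//.
apply: (le_trans (ler_wpM2r (ltW n1) h1)).
have -> : growth n - growth_rate / 2 * u = growth n + - (growth_rate / 4 * u) + - (growth_rate / 4 * u) by field.
rewrite 2!expRD.
have E0 := expR_ge0 (growth n); have F0 := expR_ge0 (- (growth_rate / 4 * u)).
have := ler_wpM2l (mulr_ge0 (mulr_ge0 (ltW C0) E0) F0) h2.
by congr (_ <= _); rewrite -/W -/u; ring.
Qed.

End PartitionRatio.

(** * Offsets and increments along the progression *)

Section OffsetsAndIncrements.
Context {R : realType}.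
Variables (s M A : nat).
Hypothesis s_gt0 : (0 < s)%N.
Hypothesis A_gt0 : (0 < A)%N.
Hypothesis AM : (A <= M)%N.
Implicit Types (i j n : nat).

Local Notation off := (offset s M A).

Lemma offsetE j : (off j)%:R =
  s%:R * (A%:R * j%:R + M%:R * (j%:R * (j%:R - 1) / 2)) :> R.
Proof.
rewrite /offset natrM; congr (_ * _); elim: j => [|j IH].
  by rewrite big_ord0 mulr0 mul0r mul0r mulr0 addr0.
rewrite big_ord_recr/= natrD IH /progression natrD natrM -[j.+1%:R]natr1.
by field.
Qed.

(** The worst case is s = A = M = 1, where the offset is j (j + 1) / 2. *)
Lemma offset_ge j : (j.+1 ^ 2 <= 4 * off j + 1)%N.
Proof.
elim: j => [|j IH]; first by rewrite /offset big_ord0 muln0.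
have E : off j.+1 = (off j + s * (A + j * M))%N.
  by rewrite /offset big_ord_recr/= mulnDr.
have : (1 + j <= s * (A + j * M))%N.
  apply: leq_trans (leq_pmull _ s_gt0); apply: leq_add => //.
  by rewrite leq_pmulr// (leq_trans A_gt0).
rewrite E; move: IH; rewrite -!mulnn; nia.
Qed.

Variable r : nat.
Hypothesis r_gt0 : (0 < r)%N.

Local Notation inc := (increment M A R r).

Lemma incrementSE i : inc i.+1 =
  M%:R * \sum_(k < r) (progression M A i.+1)%:R ^+ (r.-1 - k) * (progression M A i)%:R ^+ k.
Proof.
rewrite /increment subrXX; congr (_ * _).
by rewrite /progression mulSn !natrD; ring.
Qed.

Lemma increment_bounds j : 0 <= inc j <= r%:R * M%:R ^+ r * j.+1%:R ^+ r.-1.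
Proof.
have rr : r = r.-1.+1 by rewrite prednK.
have AMR : A%:R <= M%:R :> R by rewrite ler_nat.
case: j => [|i].
  rewrite /increment subr0 exprn_ge0//= expr1n mulr1 /progression mul0n addn0.
  apply: (@le_trans _ _ (M%:R ^+ r)); first by apply: lerXn2r; rewrite ?nnegrE.
  by rewrite ler_peMl ?exprn_ge0// ler1n.
rewrite incrementSE; apply/andP; split.
  by rewrite mulr_ge0// sumr_ge0// => k _; rewrite mulr_ge0// exprn_ge0.
set x : R := (progression M A i.+1)%:R; set y : R := (progression M A i)%:R.
have yx : y <= x by rewrite ler_nat leq_add2l leq_mul2r leqnSn orbT.
have xM : x <= M%:R * i.+2%:R.
  by rewrite /x /progression -natrM ler_nat [(M * _)%N]mulnS leq_add// mulnC.
have x0 : 0 <= x by []. have y0 : 0 <= y by [].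
apply: (@le_trans _ _ (M%:R * \sum_(k < r) (M%:R * i.+2%:R) ^+ r.-1)).
  rewrite ler_wpM2l//; apply: ler_sum => k _.
  have kr : (k <= r.-1)%N by rewrite -ltnS -rr.
  apply: (@le_trans _ _ (x ^+ (r.-1 - k) * x ^+ k)).
    by rewrite ler_wpM2l ?exprn_ge0//; apply: lerXn2r.
  by rewrite -exprD subnK//; apply: lerXn2r; rewrite ?nnegrE ?mulr_ge0.
have -> : M%:R ^+ r = M%:R * M%:R ^+ r.-1 :> R by rewrite -exprS -rr.
rewrite sumr_const card_ord -mulr_natl exprMn.
by rewrite le_eqVlt; apply/orP; left; apply/eqP; ring.
Qed.

End OffsetsAndIncrements.

(** * Pointwise limits on the scale n^(1/4) *)

Section SequenceLimits.
Context {R : realType}.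
Implicit Types (u : nat -> R) (k n : nat).

Lemma seq_cvgX u (l : R) k : u n @[n --> \oo] --> l ->
  u n ^+ k @[n --> \oo] --> l ^+ k.
Proof.
move=> ul; elim: k => [|k IH]; first by under eq_fun do rewrite expr0; exact: cvg_cst.
by rewrite exprS; under eq_fun do rewrite exprS; exact: cvgM.
Qed.

Lemma seq_cvg_sum (f : nat -> nat -> R) (l : nat -> R) k :
  (forall i, f i n @[n --> \oo] --> l i) ->
  \sum_(i < k) f i n @[n --> \oo] --> \sum_(i < k) l i.
Proof.
move=> fl; elim: k => [|k IH].
  by rewrite big_ord0; under eq_fun do rewrite big_ord0; exact: cvg_cst.
by rewrite big_ord_recr; under eq_fun do rewrite big_ord_recr; exact: cvgD.
Qed.

End SequenceLimits.

Section Scaling.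
Context {R : realType}.
Implicit Types (n : nat) (x : R).

Definition scale n : R := Num.sqrt (Num.sqrt n.+1%:R).

Lemma scale_sqr n : scale n ^+ 2 = Num.sqrt n.+1%:R.
Proof. by rewrite /scale sqr_sqrtr// sqrtr_ge0. Qed.

Lemma scale_pow4 n : scale n ^+ 4 = n.+1%:R.
Proof. by rewrite (exprM _ 2 2) scale_sqr sqr_sqrtr. Qed.

Lemma scale_ge1 n : 1 <= scale n.
Proof. by rewrite /scale -[leLHS]sqrtr1 ler_wsqrtr// -[leLHS]sqrtr1 ler_wsqrtr// ler1n. Qed.

Lemma scale_gt0 n : 0 < scale n.
Proof. exact: lt_le_trans ltr01 (scale_ge1 n). Qed.

Lemma scaleV_cvg0 : (scale n)^-1 @[n --> \oo] --> (0 : R).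
Proof.
have c0 : {for 0, continuous (fun x : R => Num.sqrt (Num.sqrt x))}.
  by apply: (@continuous_comp _ _ _ Num.sqrt Num.sqrt); exact: sqrt_continuous.
have h : Num.sqrt (Num.sqrt n.+1%:R^-1) @[n --> \oo] --> (Num.sqrt (Num.sqrt 0) : R).
  by apply: (@continuous_cvg _ _ _ _ _ _ (fun x : R => Num.sqrt (Num.sqrt x))) => //; exact: cvg_harmonic.
apply: (cvg_ext h) => [n|]; last by rewrite !sqrtr0.
by rewrite /scale -!sqrtrV// sqrtr_ge0.
Qed.

Lemma truncn_scale_cvg x : 0 < x ->
  (Num.truncn (x * scale n))%:R / scale n @[n --> \oo] --> x.
Proof.
move=> x0; have l : x - (scale n)^-1 @[n --> \oo] --> x.
  by rewrite -[X in _ --> X]subr0; apply: cvgB; [exact: cvg_cst|exact: scaleV_cvg0].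
apply: (squeeze_cvgr _ l (cvg_cst x)); apply: nearW => n.
have w0 := scale_gt0 n.
have /andP[h1 h2] : (Num.truncn (x * scale n))%:R <= x * scale n < (Num.truncn (x * scale n)).+1%:R.
  by apply: Num.Theory.truncn_itv; rewrite mulr_ge0// ltW.
apply/andP; split; last by rewrite ler_pdivrMr.
rewrite ler_pdivlMr// mulrBl mulVf ?gt_eqF// lerBlDr.
by rewrite -natr1 in h2; exact: ltW.
Qed.

End Scaling.

Section RatioIdentities.
Context {F : fieldType}.
Implicit Types (g a b p k l c d : F).

Lemma growth_drop_identity g a b : a != 0 -> b + 1 != 0 ->
  g * a ^+ 2 = g * (a ^+ 2 * b) + g * (a ^+ 4 * (1 - b ^+ 2) / a ^+ 2) / (b + 1).
Proof. by move=> a0 b0; field; rewrite a0 b0. Qed.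

Lemma removed_ratio_identity p k l c d : k != 0 -> k - l != 0 -> c != 0 ->
  d != 0 -> p * (k - l) / c * ((1 - l / k)^-1 * d^-1) = p * k / (c * d).
Proof. by move=> k0 kl0 c0 d0; field; rewrite k0 kl0 c0 d0. Qed.

End RatioIdentities.

(* In this section j n is any index of order x n^(1/4). *)

Section PointwiseLimits.
Context {R : realType}.
Variables (s M A : nat).
Variables (x : R) (x0 : 0 < x) (j : nat -> nat).
Hypothesis j_cvg : (j n)%:R / scale n @[n --> \oo] --> x.

Let w0 n : scale n != 0 :> R. Proof. by rewrite gt_eqF// scale_gt0. Qed.

Let j_gt0 : \forall n \near \oo, (0 < j n)%N.
Proof.
apply: filterS (cvgr_gt x j_cvg _ x0) => n.
by rewrite pmulr_lgt0 ?invr_gt0 ?scale_gt0// ltr0n.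
Qed.

Let cw (c : R) : c / scale n @[n --> \oo] --> (0 : R).
Proof.
by rewrite -[X in _ --> X](mulr0 c); apply: cvgMr; exact: scaleV_cvg0.
Qed.

Lemma offset_cvg : (offset s M A (j n))%:R / scale n ^+ 2 @[n --> \oo] -->
  (s%:R * M%:R * x ^+ 2 / 2 : R).
Proof.
pose v n : R := (j n)%:R / scale n.
have v2 : v n * (A%:R / scale n) + M%:R * (v n * (v n - 1 / scale n) / 2) @[n --> \oo] -->
   x * 0 + M%:R * (x * (x - 0) / 2).
  apply: cvgD; first by apply: cvgM => //; exact: cw.
  apply: cvgMr; apply: cvgMl; apply: cvgM => //; apply: cvgB => //; exact: cw.
have h : s%:R * (v n * (A%:R / scale n) + M%:R * (v n * (v n - 1 / scale n) / 2)) @[n --> \oo] -->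
   s%:R * (x * 0 + M%:R * (x * (x - 0) / 2)) by exact: cvgMr.
apply: (cvg_ext h); last by field.
by move=> n; rewrite offsetE /v; field; exact: w0.
Qed.

Let m n := offset s M A (j n).
Let y : R := s%:R * M%:R * x ^+ 2 / 2.

Let ratio_cvg0 : (m n)%:R / n.+1%:R @[n --> \oo] --> (0 : R).
Proof.
have h : ((m n)%:R / scale n ^+ 2) * ((scale n)^-1 ^+ 2) @[n --> \oo] --> (y * 0 ^+ 2 : R).
  by apply: cvgM; [exact: offset_cvg|exact/seq_cvgX/scaleV_cvg0].
apply: (cvg_ext h); last by rewrite expr0n mulr0.
by move=> n; rewrite -scale_pow4; field; exact: w0.
Qed.

Let half_near : \forall n \near \oo, (2 * m n <= n.+1)%N.
Proof.
have h : (0 : R) < 1 / 2 by rewrite divr_gt0.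
apply: filterS (cvgr_lt 0 ratio_cvg0 _ h) => n.
by rewrite ltr_pdivrMr// mulrAC ltr_pdivlMr// mul1r -natrM ltr_nat mulnC => /ltnW.
Qed.

Let rest_pinfty : (n.+1 - m n)%N @[n --> \oo] --> \oo.
Proof.
apply/cvgnyPge => B; near=> n.
have h : (2 * m n <= n.+1)%N by near: n.
have h2 : (2 * B <= n)%N by near: n; exact: nbhs_infty_ge.
by lia.
Unshelve. all: by end_near. Qed.

(** The growth exponent drops by c (sqrt n - sqrt (n - m)), which equals
    c (m / sqrt n) / (1 + sqrt (1 - m / n)). *)
Lemma npartitions_rest_cvg :
  (if (m n <= n.+1)%N then (npartitions (n.+1 - m n))%:R * n.+1%:R / expR (growth n.+1) else 0)
    @[n --> \oo] --> (Num.sqrt 3 / 12 * expR (- (growth_rate * y / 2)) : R).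
Proof.
pose rt n : R := Num.sqrt (1 - (m n)%:R / n.+1%:R).
have rl : rt n @[n --> \oo] --> (1 : R).
  have h : 1 - (m n)%:R / n.+1%:R @[n --> \oo] --> (1 - 0 : R) by apply: cvgB => //; exact: cvg_cst.
  rewrite subr0 in h.
  rewrite -[X in _ --> X]sqrtr1.
  by apply: (@continuous_cvg _ _ _ _ _ _ Num.sqrt) => //; exact: sqrt_continuous.
have L : (npartitions (n.+1 - m n))%:R * (n.+1 - m n)%:R / expR (growth (n.+1 - m n))
   * ((1 - (m n)%:R / n.+1%:R)^-1 *
      expR (- (growth_rate * ((m n)%:R / scale n ^+ 2) / (rt n + 1)))) @[n --> \oo] -->
  Num.sqrt 3 / 12 * ((1 - 0)^-1 * expR (- (growth_rate * y / (1 + 1)))).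
  apply: cvgM.
    exact: (cvg_comp (fun n => (n.+1 - m n)%N) (fun n => (npartitions n)%:R * n%:R / expR (growth n)) rest_pinfty npartitions_asymp).
  apply: cvgM.
    apply: cvgV; first by rewrite subr0 oner_neq0.
    by apply: cvgB => //; exact: cvg_cst.
  apply: (@continuous_cvg _ _ _ _ _ _ expR); first exact: continuous_expR.
  apply: cvgN; apply: cvgM; first by apply: cvgMr; exact: offset_cvg.
  apply: cvgV; first by rewrite gt_eqF.
  by apply: cvgD => //; exact: cvg_cst.
rewrite subr0 invr1 mul1r (_ : 1 + 1 = 2)// in L.
apply: cvg_trans L; apply: near_eq_cvg; near=> n.
have h : (2 * m n <= n.+1)%N by near: n.
have mn : (m n < n.+1)%N by lia.
rewrite (ltnW mn).
set nu : R := n.+1%:R; have nu0 : 0 < nu by rewrite ltr0n.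
have e : (n.+1 - m n)%:R = nu - (m n)%:R by rewrite natrB// ltnW.
have d0 : 0 < nu - (m n)%:R by rewrite subr_gt0 ltr_nat.
have rt0 : 0 <= rt n by rewrite sqrtr_ge0.
have q0 : 0 < 1 - (m n)%:R / nu by rewrite subr_gt0 ltr_pdivrMr// mul1r ltr_nat.
have rt2 : rt n ^+ 2 = 1 - (m n)%:R / nu by rewrite sqr_sqrtr// ltW.
have W : growth n.+1 = growth (n.+1 - m n) + growth_rate * ((m n)%:R / scale n ^+ 2) / (rt n + 1).
  rewrite !growthE e -/nu.
  have -> : Num.sqrt (nu - (m n)%:R) = scale n ^+ 2 * rt n.
    rewrite scale_sqr /rt -sqrtrM ?(ltW nu0)// -/nu mulrBr mulr1.
    by rewrite [nu * _]mulrC divfK// gt_eqF.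
  have -> : Num.sqrt nu = scale n ^+ 2 by rewrite scale_sqr.
  have -> : (m n)%:R = scale n ^+ 4 * (1 - rt n ^+ 2).
    by rewrite rt2 scale_pow4 -/nu subKr [nu * _]mulrC divfK// gt_eqF.
  have rn : rt n + 1 != 0 by rewrite gt_eqF// ltr_wpDl.
  exact: growth_drop_identity.
rewrite W expRD expRN e.
have E1 := expR_gt0 (growth (n.+1 - m n) : R).
have E2 := expR_gt0 (growth_rate * ((m n)%:R / scale n ^+ 2) / (rt n + 1)).
by rewrite removed_ratio_identity ?gt_eqF.
Unshelve. all: by end_near. Qed.

(** The sum of the c_j^(r-1-k) c_(j-1)^k over k < r consists of r terms, each
    asymptotic to (M j)^(r-1). *)
Lemma increment_cvg r (r_gt0 : (0 < r)%N) : increment M A R r (j n) / scale n ^+ r.-1 @[n --> \oo] -->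
  (r%:R * M%:R ^+ r * x ^+ r.-1 : R).
Proof.
pose a n : R := A%:R / scale n + (j n)%:R / scale n * M%:R.
pose b n : R := a n - M%:R / scale n.
have al : a n @[n --> \oo] --> x * M%:R.
  rewrite /a -[X in _ --> X]add0r; apply: cvgD; first exact: cw.
  exact: cvgMl.
have bl : b n @[n --> \oo] --> x * M%:R.
  by rewrite /b -[X in _ --> X]subr0; apply: cvgB.
have L : M%:R * \sum_(k < r) a n ^+ (r.-1 - k) * b n ^+ k @[n --> \oo] -->
  (r%:R * M%:R ^+ r * x ^+ r.-1 : R).
  have -> : r%:R * M%:R ^+ r * x ^+ r.-1 =
     M%:R * \sum_(k < r) (x * M%:R) ^+ (r.-1 - k) * (x * M%:R) ^+ k.
    have rr : r = r.-1.+1 by rewrite prednK.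
    have -> : \sum_(k < r) (x * M%:R) ^+ (r.-1 - k) * (x * M%:R) ^+ k = \sum_(k < r) (x * M%:R) ^+ r.-1.
      by apply: eq_bigr => k _; rewrite -exprD subnK// -ltnS -rr.
    rewrite sumr_const card_ord -mulr_natl exprMn.
    have -> : M%:R ^+ r = M%:R * M%:R ^+ r.-1 :> R by rewrite -exprS -rr.
    by ring.
  apply: cvgMr; apply: (@seq_cvg_sum _ (fun k n => a n ^+ (r.-1 - k) * b n ^+ k)
    (fun k => (x * M%:R) ^+ (r.-1 - k) * (x * M%:R) ^+ k)) => k.
  by apply: cvgM; exact: seq_cvgX.
apply: cvg_trans L; apply: near_eq_cvg.
apply: filterS j_gt0 => n; case ji: (j n) => [|i]// _.
rewrite incrementSE -[RHS]mulrA mulr_suml; congr (_ * _); apply: eq_bigr => k _.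
have E1 : a n = (progression M A i.+1)%:R / scale n.
  by rewrite /a ji /progression natrD natrM mulrDl mulrAC.
have E2 : b n = (progression M A i)%:R / scale n.
  by rewrite /b E1 /progression mulSn !natrD; field; exact: w0.
have kr : (k <= r.-1)%N by rewrite -ltnS prednK.
have -> : scale n ^+ r.-1 = scale n ^+ (r.-1 - k) * scale n ^+ k :> R.
  by rewrite -exprD subnK.
by rewrite E1 E2 !exprMn !exprVn invfM; ring.
Qed.

End PointwiseLimits.

(** * The rescaled sum *)

Section RescaledSum.
Context {R : realType}.
Notation mu := (@lebesgue_measure R).
Variables (s M A r : nat).
Hypothesis s_gt0 : (0 < s)%N.
Hypothesis A_gt0 : (0 < A)%N.
Hypothesis AM : (A <= M)%N.
Hypothesis r_gt0 : (0 < r)%N.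

Local Notation off := (offset s M A).
Local Notation inc := (increment M A R r).
Implicit Types (n j : nat).

(** The share of the partitions of n that contain given parts of total m, up to
    the normalization of npartitions n by its asymptotic order. *)
Let rest n m : R := if (m <= n)%N
  then (npartitions (n - m))%:R * n%:R / expR (growth n) else 0.

Let term n j : R := inc j / scale n ^+ r.-1 * rest n.+1 (off j).

Let term_eq0 n j : (n.+2 <= j)%N -> term n j = 0.
Proof.
move=> nj; rewrite /term /rest ifF ?mulr0//; apply/negbTE; rewrite -ltnNge.
have := offset_ge s_gt0 A_gt0 AM j; rewrite -mulnn; nia.
Qed.

Let sum_term n : (\sum_(j < n.+2) term n j) / scale n =
  varsigma R s M A r n.+1 * n.+1%:R / (scale n ^+ r * expR (growth n.+1)).
Proof.
have w0 : scale n != 0 :> R by rewrite gt_eqF// scale_gt0.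
rewrite (varsigmaE s_gt0 A_gt0 AM) mulr_suml mulr_suml mulr_suml.
apply: eq_bigr => j _; rewrite /term /rest.
have -> : scale n ^+ r = scale n * scale n ^+ r.-1 :> R by rewrite -exprS prednK.
case: ifP => _; last by rewrite !(mulr0, mul0r).
rewrite !invfM; ring.
Qed.

Let term_cvg (x : R) : 0 < x -> term n (Num.truncn (x * scale n)) @[n --> \oo] -->
  r%:R * M%:R ^+ r * x ^+ r.-1 *
  (Num.sqrt 3 / 12 * expR (- (growth_rate * (s%:R * M%:R * x ^+ 2 / 2) / 2))).
Proof.
move=> x0; have jc := truncn_scale_cvg x0; apply: cvgM.
  exact: (increment_cvg A x0 jc r_gt0).
exact: (npartitions_rest_cvg A x0 jc).
Qed.

Let term_ge0 n j : 0 <= term n j.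
Proof.
have /andP[i0 _] := @increment_bounds R _ _ AM _ r_gt0 j.
rewrite mulr_ge0// ?divr_ge0 ?exprn_ge0 ?(ltW (scale_gt0 n))// /rest.
by case: ifP => // _; rewrite divr_ge0 ?mulr_ge0 ?expR_ge0.
Qed.

(** The offset is at least ((j + 1)^2 - 1) / 4, so the exponential bound on the
    partition ratio is Gaussian in x, uniformly in n. *)
Let term_dominated : exists C : R, forall n x, 0 < x ->
  term n (Num.truncn (x * scale n)) <= C / (1 + x ^+ 2).
Proof.
have [C C0 CP] := @npartitions_ratio_le R; have c0 := @growth_rate_gt0 R.
pose g : R := growth_rate / 16; have g0 : 0 < g by rewrite divr_gt0.
have [B B0 BP] := poly_gauss_dominated r.-1 g0.
pose K : R := r%:R * M%:R ^+ r * (C * expR g).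
have K0 : 0 <= K by rewrite !mulr_ge0 ?exprn_ge0 ?expR_ge0// ltW.
exists (K * B) => n x x0; set j := Num.truncn _; set w : R := scale n.
have w1 : 1 <= w := scale_ge1 n; have w0 : 0 < w := scale_gt0 n.
have /andP[j1 j2] : j%:R <= x * w < j.+1%:R.
  by apply: Num.Theory.truncn_itv; rewrite mulr_ge0// ltW.
have i1 : inc j / w ^+ r.-1 <= r%:R * M%:R ^+ r * (1 + x) ^+ r.-1.
  have /andP[_ ib] := @increment_bounds R _ _ AM _ r_gt0 j.
  rewrite ler_pdivrMr ?exprn_gt0//; apply: (le_trans ib).
  rewrite -[leRHS]mulrA ler_wpM2l ?mulr_ge0 ?exprn_ge0// -exprMn.
  apply: lerXn2r; rewrite ?nnegrE ?mulr_ge0 ?addr_ge0 ?(ltW x0) ?(ltW w0)//.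
  by rewrite -natr1 mulrDl mul1r addrC lerD.
have r1 : rest n.+1 (off j) <= C * expR g * expR (- (g * x ^+ 2)).
  rewrite /rest; case: ifP => [oj|_]; last by rewrite !mulr_ge0 ?expR_ge0// ltW.
  apply: (le_trans (CP _ _ (ltn0Sn n) oj)); rewrite -[leRHS]mulrA ler_wpM2l ?(ltW C0)//.
  rewrite -expRD ler_expR -scale_sqr -/w.
  have q : x ^+ 2 - 1 <= 4 * ((off j)%:R / w ^+ 2).
    have o1 : j.+1%:R ^+ 2 <= 4 * (off j)%:R + 1 :> R.
      by have := offset_ge s_gt0 A_gt0 AM j; rewrite -(ler_nat R) natrD natrM natrX.
    have o2 : (x * w) ^+ 2 <= j.+1%:R ^+ 2.
      by apply: lerXn2r; rewrite ?nnegrE ?mulr_ge0 ?(ltW x0) ?(ltW w0) ?(ltW j2).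
    have o3 : 1 <= w ^+ 2 by rewrite exprn_ege1.
    rewrite mulrA ler_pdivlMr ?exprn_gt0// mulrBl mul1r -exprMn.
    by move: o1 o2 o3; lra.
  have := ler_wpM2l (ltW g0) q; rewrite /g; move: growth_rate (_ / w ^+ 2) => c u.
  by lra.
rewrite /term -/w; apply: (@le_trans _ _
   (r%:R * M%:R ^+ r * (1 + x) ^+ r.-1 * (C * expR g * expR (- (g * x ^+ 2))))).
  have /andP[i0 _] := @increment_bounds R _ _ AM _ r_gt0 j.
  apply: ler_pM => //.
    by rewrite divr_ge0 ?exprn_ge0 ?(ltW w0).
  by rewrite /rest; case: ifP => // _; rewrite divr_ge0 ?mulr_ge0 ?expR_ge0.
have := ler_wpM2l K0 (BP x (ltW x0)); rewrite /K; congr (_ <= _); ring.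
Qed.

(** With w = (n + 1)^(1/4), the left side is the integral over x > 0 of the step
    function equal to the j-th term on [j / w, (j + 1) / w[. *)
Lemma varsigma_rescaled_cvg :
  varsigma R s M A r n.+1 * n.+1%:R / (scale n ^+ r * expR (growth n.+1)) @[n --> \oo] -->
  r%:R * M%:R ^+ r * (Num.sqrt 3 / 12) *
  (Gamma (r%:R / 2) / (2 * (growth_rate * s%:R * M%:R / 4) `^ (r%:R / 2))).
Proof.
pose kappa : R := growth_rate * s%:R * M%:R / 4.
have M0 : (0 < M)%N by exact: leq_trans A_gt0 AM.
have kappa0 : 0 < kappa.
  by rewrite /kappa divr_gt0// mulr_gt0 ?ltr0n// mulr_gt0 ?ltr0n// growth_rate_gt0.
pose K : R := r%:R * M%:R ^+ r * (Num.sqrt 3 / 12).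
have [gi gE] := gauss_moment r.-1 kappa0; rewrite prednK// in gE.
have [C CP] := term_dominated.
pose lim x : R := K * (x ^+ r.-1 * expR (- (kappa * x ^+ 2))).
have D : \int[mu]_(x in `]0, +oo[) term n (Num.truncn (x * scale n)) @[n --> \oo] -->
    \int[mu]_(x in `]0, +oo[) lim x.
  apply: (@Rintegral_dominated_cvg _ _ _ _ (fun x => C / (1 + x ^+ 2))) => //.
  - by move=> n; have [] := step_integral (scale_gt0 n) (@term_eq0 n).
  - apply: measurable_funTS; apply: measurable_funM => //.
    exact: measurable_gauss_moment.
  - move=> x; rewrite /= in_itv/= andbT => x0; apply: (cvg_ext (term_cvg x0)) => //.
    rewrite /lim /K /kappa.
    have -> : growth_rate * (s%:R * M%:R * x ^+ 2 / 2) / 2 =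
      growth_rate * s%:R * M%:R / 4 * x ^+ 2 by field.
    by ring.
  - by apply: integrableS (integrable_oneDsqrV C).
  - move=> n x; rewrite /= in_itv/= andbT => x0.
    by rewrite ger0_norm ?term_ge0// CP.
apply: (cvg_ext D) => [n|].
  have [_ ->] := step_integral (scale_gt0 n) (@term_eq0 n).
  exact: sum_term.
by rewrite /lim RintegralZl// gE.
Qed.

End RescaledSum.

(** * The constant and the theorem *)

Section MainConstant.
Context {R : realType}.
Notation mu := (@lebesgue_measure R).

(** Positivity makes the constant in the theorem nonzero. Half of the value is the
    integral of x^(n-1) exp(- x^2), whose integrand is at least exp(-4) on
    [1, 2[. *)
Lemma Gamma_half_gt0 (n : nat) : (0 < n)%N -> 0 < Gamma (n%:R / 2 : R).
Proof.
move=> n0; have [I E] := gauss_moment n.-1 (@ltr01 R).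
rewrite prednK// powR1 mulr1 in E.
pose h j : R := if j == 1%N then expR (- 4) else 0.
have h0 j : (2 <= j)%N -> h j = 0 by case: j => [|[|j]].
have [mh hE] := step_integral (@ltr01 R) h0.
rewrite 2!big_ord_recl big_ord0 /h/= add0r addr0 divr1 in hE.
have le x : 0 < x -> h (Num.truncn (x * 1)) <= x ^+ n.-1 * expR (- (1 * x ^+ 2)).
  move=> x0; rewrite /h mulr1 mul1r; case: eqP => [x1|_]; last first.
    by rewrite mulr_ge0 ?expR_ge0 ?exprn_ge0 ?(ltW x0).
  have := Num.Theory.truncn_itv (ltW x0); rewrite x1 => /andP[h1 /ltW h2].
  apply: (@le_trans _ _ (1 * expR (- x ^+ 2))).
    rewrite mul1r ler_expR lerN2 (_ : 4 = 2 ^+ 2 :> R); last by ring.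
    by apply: lerXn2r; rewrite ?nnegrE ?(ltW x0).
  by rewrite ler_wpM2r ?expR_ge0// exprn_ege1.
have Ih : mu.-integrable `]0, +oo[ (EFin \o (fun x => h (Num.truncn (x * 1)))).
  apply: le_integrable I => //; first exact/measurable_EFinP.
  move=> x; rewrite /= in_itv/= andbT => x0; rewrite lee_fin.
  rewrite !ger0_norm ?le// ?mulr_ge0 ?expR_ge0 ?exprn_ge0 ?(ltW x0)//.
  by rewrite /h; case: ifP => // _; exact: expR_ge0.
have L : expR (- 4) <= Gamma (n%:R / 2) / 2 :> R.
  rewrite -E -hE; apply: le_Rintegral => // x.
  by rewrite /= in_itv/= andbT; exact: le.
have := lt_le_trans (expR_gt0 _) L.
by rewrite pmulr_lgt0 ?invr_gt0.
Qed.

(** Both sides are products of powers of 2, 3, pi, M and s with r and the Gamma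
    value; taking logarithms reduces the identity to a linear one. *)
Lemma constantE (M s r : nat) : (0 < M)%N -> (0 < s)%N ->
  r%:R * M%:R ^+ r * (Num.sqrt 3 / 12) *
    (Gamma (r%:R / 2) / (2 * (growth_rate * s%:R * M%:R / 4) `^ (r%:R / 2))) =
  2 `^ ((3 * r%:R - 12) / 4) * 3 `^ ((r%:R - 2) / 4) * pi `^ (- (r%:R / 2)) *
    M%:R `^ (r%:R / 2) * s%:R `^ (- (r%:R / 2)) * r%:R * Gamma (r%:R / 2) :> R.
Proof.
move=> M0 s0; move: (Gamma _) => G.
pose e (x a : R) := expR (a * ln x).
have powE (x a : R) : 0 < x -> x `^ a = e x a by move=> x0; rewrite /powR gt_eqF.
have p0 := pi_gt0 R.
have Mr : 0 < M%:R :> R by rewrite ltr0n.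
have sr : 0 < s%:R :> R by rewrite ltr0n.
have lM a b : 0 < a -> 0 < b -> ln (a * b) = ln a + ln b :> R by move=> ? ?; rewrite lnM.
have lV a : 0 < a -> ln a^-1 = - ln a :> R by move=> ?; rewrite lnV.
have l4 : ln 4 = 2 * ln 2 :> R by rewrite (_ : 4 = 2 * 2)// ?lM//; ring.
have lS a : 0 < a -> ln (Num.sqrt a) = ln a / 2 :> R.
  move=> a0; rewrite -powR12_sqrt ?(ltW a0)// ln_powR mulrC.
  by [].
have s23 : 0 < Num.sqrt (2 / 3) :> R by rewrite sqrtr_gt0.
have kE : ln (growth_rate * s%:R * M%:R / 4) =
  ln pi + (ln 2 - ln 3) / 2 + ln s%:R + ln M%:R - 2 * ln 2 :> R.
  have g0 := @growth_rate_gt0 R.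
  rewrite lM ?invr_gt0 ?mulr_gt0// lM ?mulr_gt0// lM// lV// l4.
  by rewrite /growth_rate lM// lS ?divr_gt0// lM ?invr_gt0// lV.
have k0 : 0 < growth_rate * s%:R * M%:R / 4 :> R.
  by rewrite divr_gt0// !mulr_gt0 ?growth_rate_gt0.
rewrite !powE// /e kE.
have -> : M%:R ^+ r = expR (r%:R * ln M%:R) :> R.
  by rewrite -powR_mulrn ?ler0n// powE.
have -> : Num.sqrt 3 / 12 = 2 * expR (- (3 * ln 2) - ln 3 / 2) :> R.
  rewrite -[LHS]lnK ?posrE ?divr_gt0 ?sqrtr_gt0//.
  rewrite -[X in X * expR _]lnK ?posrE// -expRD; congr expR.
  rewrite lM ?invr_gt0 ?sqrtr_gt0// lV// lS// (_ : 12 = 2 * 2 * 3) ?lM//; last by ring.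
  by field.
have -> : r%:R * expR (r%:R * ln M%:R) * (2 * expR (- (3 * ln 2) - ln 3 / 2)) *
    (G / (2 * expR (r%:R / 2 * (ln pi + (ln 2 - ln 3) / 2 + ln s%:R + ln M%:R - 2 * ln 2)))) =
  r%:R * G * expR (r%:R * ln M%:R + (- (3 * ln 2) - ln 3 / 2) -
    r%:R / 2 * (ln pi + (ln 2 - ln 3) / 2 + ln s%:R + ln M%:R - 2 * ln 2)) :> R.
  move: (r%:R * ln M%:R) (- (3 * ln 2) - ln 3 / 2) (r%:R / 2 * (_ - 2 * ln 2)) => X Y Z.
  rewrite expRB expRD; have := expR_gt0 Z; move: (expR X) (expR Y) (expR Z) => a b c c0.
  by field; rewrite gt_eqF.
rewrite [RHS](_ : _ = r%:R * G * (expR ((3 * r%:R - 12) / 4 * ln 2) *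
   expR ((r%:R - 2) / 4 * ln 3) * expR (- (r%:R / 2) * ln pi) *
   expR (r%:R / 2 * ln M%:R) * expR (- (r%:R / 2) * ln s%:R))); last first.
  move: (expR _) (expR _) (expR _) (expR _) (expR _) => a b c d f.
  by ring.
rewrite -!expRD; congr (_ * expR _).
move: (ln pi) (ln 2) (ln 3) (ln M%:R) (ln s%:R) => a b c d f.
by field.
Qed.

End MainConstant.

Theorem theorem1p8 (R : realType) (A M r s : nat)
    (hA : (0 < A)%N) (hAM : (A <= M)%N) (hr : (0 < r)%N) (hs : (0 < s)%N) :
  (fun n : nat => varsigma R s M A r n /
     (2 `^ ((3 * r%:R - 12) / 4) * 3 `^ ((r%:R - 2) / 4) *
      pi `^ (- (r%:R / 2)) * M%:R `^ (r%:R / 2) * s%:R `^ (- (r%:R / 2)) *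
      r%:R * Gamma (r%:R / 2) * n%:R `^ ((r%:R - 4) / 4) *
      expR (pi * Num.sqrt (2 * n%:R / 3)))) @ \oo --> (1 : R).
Proof.
have M0 : (0 < M)%N by exact: leq_trans hA hAM.
set K := _ * Gamma _.
have K0 : 0 < K.
  by rewrite /K !mulr_gt0 ?Gamma_half_gt0 ?powR_gt0 ?pi_gt0 ?ltr0n.
(* The limit is taken along n + 1, where the scale is nonzero. *)
rewrite -cvg_shiftS.
have h : varsigma R s M A r n.+1 * n.+1%:R / (scale n ^+ r * expR (growth n.+1))
    @[n --> \oo] --> K.
  by rewrite /K -(constantE r M0 hs); exact: varsigma_rescaled_cvg.
have h1 : varsigma R s M A r n.+1 * n.+1%:R / (scale n ^+ r * expR (growth n.+1)) * K^-1
  @[n --> \oo] --> K * K^-1 by exact: cvgMl.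
apply: (cvg_ext h1) => [n|]; last by rewrite mulfV// gt_eqF.
have nu0 : 0 < n.+1%:R :> R by rewrite ltr0n.
have -> : n.+1%:R `^ ((r%:R - 4) / 4) = scale n ^+ r / n.+1%:R :> R.
  rewrite mulrBl mulfV// powRB ?(gt_eqF nu0) ?implybT// powRr1 ?(ltW nu0)//.
  congr (_ / _); rewrite -powR_mulrn ?(ltW (scale_gt0 n))// /scale.
  rewrite -!powR12_sqrt ?powR_ge0//.
  by rewrite -!powRrM; congr (_ `^ _); field.
rewrite -/(growth n.+1).
have w0 : scale n ^+ r != 0 :> R by rewrite gt_eqF// exprn_gt0// scale_gt0.
have e0 := expR_gt0 (growth n.+1 : R).
clearbody K.
move: (varsigma _ _ _ _ _ _) (scale n ^+ r) w0 (expR _) e0 => v w w0 e e0.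
by field; rewrite w0 !gt_eqF.
Qed.
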